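(* Let $A\in\mathbf{M}_n(\mathbb{C})$. 1) If the numerical range $W(A)$ has nonempty interior, then the numerical measure $\mu_A$ is absolutely continuous with respect to the two-dimensional Lebesgue measure $\mathrm{d}z$ on $\mathbb{C}\simeq\mathbb{R}^2$, and the numerical density $f_A=\mathrm{d}\mu_A/\mathrm{d}z$ is smooth ($C^\infty$) outside the critical set $\Sigma_A$. 2) If $A$ is a nonscalar Hermitian matrix, then $W(A)\subset\mathbb{R}$ and the numerical measure $\mu_A$ is absolutely continuous with respect to the one-dimensional Lebesgue measure $\mathrm{d}x$ on $\mathbb{R}$, and the numerical density $f_A=\mathrm{d}\mu_A/\mathrm{d}x$ is smooth ($C^\infty$) outside the spectrum $\sigma(A)$.
   Context: $\mathbf{M}_n(\mathbb{C})$ is the space of complex $n\times n$ matrices; $\langle x,y\rangle=y^*x$ on $\mathbb{C}^n$, $\|x\|=\langle x,x\rangle^{1/2}$, and $\partial\mathbb{B}^n=\{x\in\mathbb{C}^n:\|x\|=1\}$. The numerical map is $\Phi_A:\partial\mathbb{B}^n\to\mathbb{C}\simeq\mathbb{R}^2$, $\Phi_A(x)=\langle Ax,x\rangle$, and the numerical range is $W(A)=\Phi_A(\partial\mathbb{B}^n)$. A point $x$ is critical for $\Phi_A$ if the $\mathbb{R}$-linear differential of $\Phi_A$ at $x$ is not onto $\mathbb{C}$; $\Sigma_A\subset\mathbb{C}$ is the set of critical values of $\Phi_A$. The numerical measure $\mu_A$ is the Borel probability measure on $\mathbb{C}$ which is the image under $\Phi_A$ of the normalized (probability) Euclidean surface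 measure on $\partial\mathbb{B}^n$. A matrix is scalar if it is a multiple of the identity. When $W(A)\subset\mathbb{R}$, $\mu_A$ is regarded as a measure on $\mathbb{R}$. A density is defined up to equality almost everywhere; ''smooth outside a closed set'' means that it has a representative that is $C^\infty$ on the complement. *)

(* Defs.v *)
From HB Require Import structures.
From mathcomp Require Import all_boot all_order all_algebra.
From mathcomp Require Import complex.
From mathcomp Require Import all_classical all_reals all_analysis.
From mathcomp Require Import measurable_realfun.

Set Implicit Arguments.
Unset Strict Implicit.
Unset Printing Implicit Defensive.

Import Order.TTheory GRing.Theory Num.Theory.
Import numFieldNormedType.Exports.

Local Open Scope classical_set_scope.
Local Open Scope ring_scope.
Local Open Scope complex_scope.
Local Open Scope sesquilinear_scope.

Section product_sigma_finite.
Local Open Scope ereal_scope.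
Context d1 d2 (T1 : measurableType d1) (T2 : measurableType d2) (R : realType).
Variable m1 : {sigma_finite_measure set T1 -> \bar R}.
Variable m2 : {sigma_finite_measure set T2 -> \bar R}.

Lemma sigma_finite_product : sigma_finite [set: T1 * T2] (m1 \x m2).
Proof.
have /sigma_finiteP[F [TF ndF Foo]] := sigma_finiteT m1.
have /sigma_finiteP[G [TG ndG Goo]] := sigma_finiteT m2.
exists (fun n => F n `*` G n).
  rewrite -setXTT TF TG predeqE => -[x y]; split.
    move=> [/= [n _ Fnx] [k _ Gky]]; exists (maxn n k) => //; split.
    - by move: x Fnx; exact/subsetPset/ndF/leq_maxl.
    - by move: y Gky; exact/subsetPset/ndG/leq_maxr.
  by move=> [n _ []/= ? ?]; split; exists n.
move=> k; have [? ?] := Foo k; have [? ?] := Goo k.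
split; first exact: measurableX.
by rewrite product_measure1E// lte_mul_pinfty// ge0_fin_numE.
Qed.

End product_sigma_finite.

Section tuple_measure.
Context d (T : measurableType d) (R : realType).

Section cons_measure.
Variables (n : nat) (m1 : {sigma_finite_measure set T -> \bar R}).
Variable m2 : {sigma_finite_measure set (n.-tuple T) -> \bar R}.

Let cons_pair (p : T * n.-tuple T) : n.+1.-tuple T := [tuple of p.1 :: p.2].

Let measurable_cons_pair : measurable_fun [set: T * n.-tuple T] cons_pair.
Proof. exact: measurable_cons. Qed.

Definition cons_measure : set (n.+1.-tuple T) -> \bar R :=
  pushforward (m1 \x m2)%E cons_pair.

Let cons_measure0 : cons_measure set0 = 0%E.
Proof. exact: measure0. Qed.

Let cons_measure_ge0 A : (0 <= cons_measure A)%E.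
Proof. exact: measure_ge0. Qed.

Let cons_measure_sigma_additive : semi_sigma_additive cons_measure.
Proof. exact: measure_semi_sigma_additive. Qed.

HB.instance Definition _ := isMeasure.Build _ _ _ cons_measure
  cons_measure0 cons_measure_ge0 cons_measure_sigma_additive.

Let sigma_finite_cons_measure : sigma_finite setT cons_measure.
Proof.
have [F TF Foo] := sigma_finite_product m1 m2.
pose split_tuple (t : n.+1.-tuple T) := (thead t, [tuple of behead t]).
have split_tupleK p : split_tuple (cons_pair p) = p.
  by case: p => x t; congr pair => //; apply: val_inj.
have cons_pairK t : cons_pair (split_tuple t) = t.
  by rewrite /cons_pair /= -tuple_eta.
have msplit : measurable_fun setT split_tuple.
  apply/measurable_fun_pairP; split; first exact: measurable_tnth.
  exact: measurable_behead.
exists (fun k => split_tuple @^-1` F k).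
  by rewrite -preimage_bigcup -TF preimage_setT.
move=> k; have [mF Fk] := Foo k; split.
  by rewrite -[X in measurable X]setTI; exact: msplit.
rewrite /cons_measure /pushforward.
rewrite (_ : _ @^-1` _ = F k)//; apply/seteqP.
by split=> p; rewrite /preimage/= split_tupleK.
Qed.

HB.instance Definition _ :=
  Measure_isSigmaFinite.Build _ _ _ cons_measure sigma_finite_cons_measure.

End cons_measure.

(* The n-fold product of mu; on T^0, a point, it is the unit mass. *)
Fixpoint tuple_measure (mu : {sigma_finite_measure set T -> \bar R}) (n : nat) :
    {sigma_finite_measure set (n.-tuple T) -> \bar R} :=
  match n with
  | 0 => dirac [tuple]
  | n'.+1 => cons_measure mu (tuple_measure mu n')
  end.

End tuple_measure.

Notation plane R := (measurableTypeR R * measurableTypeR R)%type.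

Section lebesgue_plane.
Variable R : realType.

Definition lebesgue_plane : set (plane R) -> \bar R :=
  (@lebesgue_measure R \x @lebesgue_measure R)%E.

HB.instance Definition _ := Measure.on lebesgue_plane.

HB.instance Definition _ := Measure_isSigmaFinite.Build _ _ _ lebesgue_plane
  (sigma_finite_product (@lebesgue_measure R) (@lebesgue_measure R)).

End lebesgue_plane.
Arguments lebesgue_plane {R}.

Section numerical_map.
Variables (R : realType) (n : nat).
Implicit Types (A : 'M[R[i]]_n) (x y v : 'cV[R[i]]_n).

Definition inner x y : R[i] := (y ^t* *m x) 0 0.

Definition cnorm x : R := Num.sqrt (complex.Re (inner x x)).

Definition unit_sphere : set 'cV[R[i]]_n := [set x | cnorm x = 1].

Definition numerical_map A x : R[i] := inner (A *m x) x.

Definition numerical_range A : set R[i] := numerical_map A @` unit_sphere.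

Definition to_plane (z : R[i]) : R * R := (complex.Re z, complex.Im z).

Definition tangent_space x : set 'cV[R[i]]_n := [set v | complex.Re (inner v x) = 0].

(* The value at the tangent vector v of the differential of the numerical map
   at x. The numerical map is a real polynomial map on the whole of C^n, so its
   differential on the sphere is the restriction to the tangent space of the
   differential of this extension, which is evaluated along t |-> x + t v. *)
Definition differential A x v : R * R :=
  derive1 (fun t : R => to_plane (numerical_map A (x + t%:C *: v))) 0.

Definition critical_point A x : Prop :=
  unit_sphere x /\ differential A x @` tangent_space x <> setT.

Definition critical_values A : set R[i] :=
  numerical_map A @` [set x | critical_point A x].

End numerical_map.
Arguments to_plane {R}.

Section surface_measure.
Variables (R : realType) (n : nat).

(* (R^2)^n, with its Borel sigma-algebra, is used as a model of C^n. *)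
Definition of_planes (t : n.-tuple (plane R)) : 'cV[R[i]]_n :=
  \col_i ((tnth t i).1 +i* (tnth t i).2).

Definition planes_norm (t : n.-tuple (plane R)) : R := cnorm (of_planes t).

Definition direction (t : n.-tuple (plane R)) : n.-tuple (plane R) :=
  [tuple ((tnth t i).1 / planes_norm t, (tnth t i).2 / planes_norm t) | i < n].

Definition punctured_ball : set (n.-tuple (plane R)) :=
  [set t | 0 < planes_norm t <= 1].



Lemma planes_normE t : planes_norm t =
  Num.sqrt (\sum_(i < n) ((tnth t i).1 ^+ 2 + (tnth t i).2 ^+ 2)).
Proof.
rewrite /planes_norm /cnorm /inner mxE.
rewrite (raddf_sum (@complex.Re R : Rcomplex R -> R)) /=.
congr Num.sqrt; apply: eq_bigr => i _; rewrite !mxE /=.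
by rewrite mulNr opprK -!expr2.
Qed.

Lemma measurable_planes_norm : measurable_fun setT planes_norm.
Proof.
rewrite (_ : planes_norm = fun t =>
    (\sum_(i < n) ((tnth t i).1 ^+ 2 + (tnth t i).2 ^+ 2)) `^ 2^-1); last first.
  apply/funext => t; rewrite planes_normE powR12_sqrt//.
  by apply: sumr_ge0 => i _; rewrite addr_ge0 ?sqr_ge0.
apply: (measurableT_comp (measurable_powR 2^-1)).
apply: measurable_sum => i; apply: measurable_funD; apply: measurable_funX.
  exact: (measurableT_comp measurable_fst (measurable_tnth i)).
exact: (measurableT_comp measurable_snd (measurable_tnth i)).
Qed.

Lemma measurable_punctured_ball : measurable punctured_ball.
Proof.
rewrite (_ : punctured_ball = planes_norm @^-1` `]0, 1]).
  by rewrite -[X in measurable X]setTI; exact: measurable_planes_norm.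
by apply/seteqP; split=> t /=; rewrite in_itv.
Qed.

Lemma measurable_direction : measurable_fun setT direction.
Proof.
have mV : measurable_fun setT (fun t => (planes_norm t)^-1).
  rewrite (_ : (fun t => _) = fun t => planes_norm t `^ (- 1)); last first.
    by apply/funext => t; rewrite powR_inv1// sqrtr_ge0.
  exact: (measurableT_comp (measurable_powR (- 1)) measurable_planes_norm).
apply/measurable_fun_tnthP => i.
rewrite (_ : _ \o direction = fun t =>
    ((tnth t i).1 / planes_norm t, (tnth t i).2 / planes_norm t)); last first.
  by apply/funext => t; rewrite /= tnth_mktuple.
apply/measurable_fun_pairP; split; apply: measurable_funM => //.
  exact: (measurableT_comp measurable_fst (measurable_tnth i)).
exact: (measurableT_comp measurable_snd (measurable_tnth i)).
Qed.

(* The Lebesgue measure of the cone {t x | x \in E, 0 < t <= 1} over the part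
   of E on the unit sphere. *)
Definition cone_measure : set (n.-tuple (plane R)) -> \bar R :=
  pushforward
    (mrestr (tuple_measure (@lebesgue_plane R) n) measurable_punctured_ball)
    direction.

Let cone_measure0 : cone_measure set0 = 0%E.
Proof. by rewrite /cone_measure /pushforward preimage_set0 measure0. Qed.

Let cone_measure_ge0 E : (0 <= cone_measure E)%E.
Proof. by apply: measure_ge0 => //; exact: measurable_direction. Qed.

Let cone_measure_sigma_additive : semi_sigma_additive cone_measure.
Proof.
by apply: measure_semi_sigma_additive; exact: measurable_direction.
Qed.

HB.instance Definition _ := isMeasure.Build _ _ _ cone_measure
  cone_measure0 cone_measure_ge0 cone_measure_sigma_additive.

(* The Euclidean surface measure of the unit sphere of C^n, as a measure on C^n
   carried by the sphere: the dimension 2 n times the volume of the cone. *)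
Definition surface_measure : {measure set (n.-tuple (plane R)) -> \bar R} :=
  mscale (2 * n)%:R%:nng cone_measure.

Definition surface_probability : probability (n.-tuple (plane R)) R :=
  mnormalize surface_measure 
    (dirac ([tuple (0, 0) | i < n] : n.-tuple (plane R))).

End surface_measure.

Section numerical_measure.
Variables (R : realType) (n : nat) (A : 'M[R[i]]_n).

Definition plane_numerical_map (t : n.-tuple (plane R)) : plane R :=
  to_plane (numerical_map A (of_planes t)).

Let measurable_plane_numerical_map : measurable_fun setT plane_numerical_map.
Proof.
pose mC (f : n.-tuple (plane R) -> R[i]) :=
  measurable_fun setT (fun t => complex.Re (f t) : measurableTypeR R) /\
  measurable_fun setT (fun t => complex.Im (f t) : measurableTypeR R).
have mC_cst c : mC (fun=> c) by split; exact: measurable_cst.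
have mC_mul f g : mC f -> mC g -> mC (fun t => f t * g t).
  move=> [mf1 mf2] [mg1 mg2]; split.
    rewrite (_ : (fun t => _) = fun t => complex.Re (f t) * complex.Re (g t)
        - complex.Im (f t) * complex.Im (g t)); last first.
      by apply/funext => t; case: (f t) (g t) => [a b] [c e].
    by apply: measurable_funB; exact: measurable_funM.
  rewrite (_ : (fun t => _) = fun t => complex.Re (f t) * complex.Im (g t)
      + complex.Im (f t) * complex.Re (g t)); last first.
    by apply/funext => t; case: (f t) (g t) => [a b] [c e].
  by apply: measurable_funD; exact: measurable_funM.
have mC_sum (f : 'I_n -> n.-tuple (plane R) -> R[i]) :
    (forall i, mC (f i)) -> mC (fun t => \sum_i f i t).
  move=> mf; split.
    rewrite (_ : (fun t => _) = fun t => \sum_i complex.Re (f i t)).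
      by apply: measurable_sum => i; case: (mf i).
    apply/funext => t.
    by rewrite (raddf_sum (@complex.Re R : Rcomplex R -> R)).
  rewrite (_ : (fun t => _) = fun t => \sum_i complex.Im (f i t)).
    by apply: measurable_sum => i; case: (mf i).
  apply/funext => t.
  by rewrite (raddf_sum (@complex.Im R : Rcomplex R -> R)).
have mC_coord i : mC (fun t => of_planes t i 0).
  split.
    rewrite (_ : (fun t => _) = fun t => (tnth t i).1).
      exact: (measurableT_comp measurable_fst (measurable_tnth i)).
    by apply/funext => t; rewrite mxE.
  rewrite (_ : (fun t => _) = fun t => (tnth t i).2).
    exact: (measurableT_comp measurable_snd (measurable_tnth i)).
  by apply/funext => t; rewrite mxE.
have mC_conj f : mC f -> mC (fun t => (f t)^*).
  move=> [mf1 mf2]; split.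
    rewrite (_ : (fun t => _) = fun t => complex.Re (f t))//.
    by apply/funext => t; case: (f t).
  rewrite (_ : (fun t => _) = fun t => - complex.Im (f t)).
    exact: (measurableT_comp _ mf2).
  by apply/funext => t; case: (f t).
have [mRe mIm] : mC (fun t => numerical_map A (of_planes t)).
  rewrite (_ : (fun t => _) = fun t =>
      \sum_i (of_planes t i 0)^* * \sum_j A i j * of_planes t j 0).
    apply: (mC_sum _) => i; apply: (mC_mul _ _); first exact: mC_conj.
    by apply: (mC_sum _) => j; exact: (mC_mul _ _).
  apply/funext => t; rewrite /numerical_map /inner mxE.
  by apply: eq_bigr => i _; rewrite !mxE.
exact/measurable_fun_pairP.
Qed.

HB.instance Definition _ := isMeasurableFun.Build _ _ _ _ plane_numerical_map
  measurable_plane_numerical_map.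

Definition numerical_measure : probability (plane R) R :=
  distribution (surface_probability R n) plane_numerical_map.

Definition real_axis_coordinate (z : plane R) : measurableTypeR R := z.1.

HB.instance Definition _ := isMeasurableFun.Build _ _ _ _ real_axis_coordinate
  measurable_fst.

(* The numerical measure as a measure on the line, for use when the numerical
   range is real: it is then carried by the real axis. *)
Definition real_numerical_measure : probability (measurableTypeR R) R :=
  distribution numerical_measure real_axis_coordinate.

Definition numerical_density : plane R -> \bar R :=
  Radon_Nikodym (charge_of_finite_measure numerical_measure) lebesgue_plane.

Definition real_numerical_density : measurableTypeR R -> \bar R :=
  Radon_Nikodym (charge_of_finite_measure real_numerical_measure)
    lebesgue_measure.

Definition real_spectrum : set R := [set x | eigenvalue A x%:C].

End numerical_measure.

Section smooth.
Variables (R : realType) (V : normedModType R).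
Implicit Types (U : set V) (f : V -> R).

(* On an open set U of a finite-dimensional V, f is of class C^k iff it is
   continuous and its directional derivatives exist and are of class C^(k-1). *)
Fixpoint of_class_C (k : nat) U f : Prop :=
  (forall x, U x -> {for x, continuous f}) /\
  match k with
  | 0 => True
  | k'.+1 => forall v : V,
      (forall x, U x -> derivable f x v) /\
      of_class_C k' U (fun x => 'D_v f x)
  end.

Definition smooth_on U f : Prop := forall k, of_class_C k U f.

End smooth.

(* Main.v *)
(* The unit sphere carries the flows of the one-parameter unitary groups exp (h S), with
   S = i E_jj or S = s E_ij - conj(s) E_ji, which preserve the surface measure; a derivative
   along such a flow therefore has mean zero. Let X = (X1, X2) be the numerical map, L_a X its
   derivatives along these flows and Delta the sum of the squared minors of the matrix
   (L_a X1, L_a X2). Combining the L_a gives vector fields Y_i with Y_i X_j = Delta if i = j and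
   0 otherwise, and Delta x = 0 only at critical x. Integrating by parts along Y_i / Delta, as in
   Malliavin calculus, gives E[d_i phi (X) W] = E[phi (X) W'] for every weight W supported where
   Delta is bounded below. Taking for phi products of truncated powers (X1 - s)_+^p (X2 - r)_+^q
   and raising p and q by repeated integration by parts, the measure E[1_E (X) W] has the density
   (s, r) |-> c E[(X1 - s)_+^k (X2 - r)_+^k W''], which is of class C^(k-1). A cutoff W = chi(X)
   near a regular value gives smoothness there; W = (Delta - c)_+^5 gives absolute continuity,
   since the polynomial Delta vanishes only on a null set unless the numerical range lies on a
   line. For Hermitian A one uses X1 alone, with Delta the sum of the (L_a X1)^2, which vanishes
   only at eigenvectors. *)
Require Import Defs.
From HB Require Import structures.
From mathcomp Require Import all_boot all_order all_algebra.
From mathcomp Require Import complex.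
From mathcomp Require Import all_classical all_reals all_analysis.
From mathcomp Require Import measurable_realfun.
From mathcomp Require Import ring lra.

Set Implicit Arguments.
Unset Strict Implicit.
Unset Printing Implicit Defensive.

Import Order.TTheory GRing.Theory Num.Theory.
Import numFieldNormedType.Exports.

Local Open Scope classical_set_scope.
Local Open Scope ring_scope.
Local Open Scope complex_scope.
Local Open Scope sesquilinear_scope.

(** * Truncated powers and functions of class C^k *)

(** Regularity is read off without Fourier transforms or distributions. Differentiating the
    truncated powers down to exponent 0 gives the indicator of an open quadrant, and the open
    quadrants generate the Borel sets and are closed under intersection. An identity between
    potentials thus becomes, after finitely many differentiations in [s] and [r], an equality of
    measures on a generating class. The weight left by integration by parts has no sign, so a
    density is kept as a difference of two nonnegative functions. Each order of smoothness uses its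
    own weight and yields its own density near a point; being continuous and equal almost
    everywhere, these coincide, and the pieces are glued along a countable base. Supports are
    encoded by a sign: a weight vanishes where an auxiliary function [u] is negative, a condition
    that derivatives along a flow inherit. Invariance of the surface measure is reduced to
    translations of the line, because each flow map used is a product of shears or a rotation of one
    complex coordinate, itself a product of shears. *)

Section truncated_power.
Variable R : realType.
Implicit Types (m : nat) (y : R).

(** At exponent 0 this is the indicator of the open half-line, with value 0 at 0. A potential with
    all exponents 0 is then exactly the mass of an open ray or quadrant. *)
Definition pospow m y : R := if 0 < y then y ^+ m else 0.

Lemma pospow_ge0 m y : 0 <= pospow m y.
Proof. by rewrite /pospow; case: ifPn => // /ltW y0; rewrite exprn_ge0. Qed.

Lemma pospowD m p y : pospow (m + p) y = pospow m y * pospow p y.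
Proof. by rewrite /pospow; case: ifP => _; rewrite ?mulr0 ?exprD. Qed.

Lemma pospowS m y : pospow m.+1 y = y * pospow m y.
Proof. by rewrite /pospow; case: ifP => _; rewrite ?mulr0 ?exprS. Qed.

Lemma pospow_gt0 m y : 0 < y -> 0 < pospow m y.
Proof. by move=> y0; rewrite /pospow y0 exprn_gt0. Qed.

Lemma pospow_le0 m y : y <= 0 -> pospow m y = 0.
Proof. by rewrite /pospow leNgt => /negbTE ->. Qed.

Lemma pospow1E y : pospow 1 y = Num.max 0 y.
Proof. by rewrite /pospow maxElt expr1. Qed.

(** Provides the dominating constants for difference quotients, down to exponent 1, where the
    function is not differentiable at 0. *)
Lemma pospow_lipschitz m (M : R) : exists C, forall a b,
  `|a| <= M -> `|b| <= M -> `|pospow m.+1 a - pospow m.+1 b| <= C * `|a - b|.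
Proof.
have norm1 a : `|a| <= M -> `|pospow 1 a| <= M.
  move=> aM; rewrite /pospow; case: ifP => _; rewrite ?expr1// normr0.
  exact: le_trans aM.
have lip1 a b : `|pospow 1 a - pospow 1 b| <= `|a - b|.
  rewrite /pospow !expr1; case: ltP => a0; case: ltP => b0 //; rewrite ?subr0 ?sub0r ?normrN.
  - by rewrite !ger0_norm ?(ltW a0)//; lra.
  - by rewrite distrC !ger0_norm ?(ltW b0)//; lra.
  - by rewrite normr0.
have [M0|M0] := ltP M 0.
  by exists 0 => a b /(le_trans (normr_ge0 a)); rewrite leNgt M0.
have bnd k : exists K, 0 <= K /\ forall a, `|a| <= M -> `|pospow k a| <= K.
  exists (M ^+ k); split; first exact: exprn_ge0.
  move=> a aM; rewrite /pospow; case: ifP => _; last by rewrite normr0 exprn_ge0.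
  by rewrite normrX lerXn2r// nnegrE.
elim: m => [|m [C IH]]; first by exists 1 => a b _ _; rewrite mul1r.
have [K [K0 HK]] := bnd m.+1.
exists (M * C + K) => a b aM bM.
rewrite -[in pospow m.+2 a]addn1 -[in pospow m.+2 b]addn1 !pospowD.
have -> : pospow m.+1 a * pospow 1 a - pospow m.+1 b * pospow 1 b =
   pospow 1 a * (pospow m.+1 a - pospow m.+1 b) +
   pospow m.+1 b * (pospow 1 a - pospow 1 b) by ring.
apply: le_trans (ler_normD _ _) _; rewrite !normrM mulrDl.
apply: lerD.
  by rewrite -mulrA; apply: ler_pM => //; [exact: norm1|exact: IH].
by apply: ler_pM => //; exact: HK.
Qed.

Lemma continuous_pospow m : continuous (pospow m.+1).
Proof.
have c1 : continuous (pospow 1).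
  rewrite (_ : pospow 1 = fun y => Num.max 0 y); last first.
    by apply/funext => y; rewrite pospow1E.
  by move=> y; apply: continuous_max => //; exact: cvg_cst.
elim: m => // m IH y.
rewrite (_ : pospow m.+2 = fun y => y * pospow m.+1 y); last first.
  by apply/funext => z; rewrite pospowS.
by apply: cvgM; [exact: cvg_id|exact: IH].
Qed.

(** Exponent 2 is the least one differentiable at 0, where the difference quotient in h is
    [pospow 1 h]; higher exponents follow from [pospowS] and the product rule. *)
Lemma is_derive_pospow m y :
  is_derive y 1 (pospow m.+2) (m.+2%:R * pospow m.+1 y).
Proof.
elim: m y => [|m IH] y.
  have [y0|y0|->] := ltgtP y 0.
  - rewrite pospow_le0 ?(ltW y0)// mulr0.
    apply: (near_eq_is_derive (f := cst 0)).
    near=> z; rewrite pospow_le0//; apply/ltW.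
    by near: z; exact: lt_nbhsl.
  - apply: (near_eq_is_derive (f := (@idfun R) ^+ 2)).
      near=> z; rewrite /pospow ifT//.
      by near: z; exact: lt_nbhsr.
    by apply: is_derive_eq; rewrite /pospow y0 /= expr1 /GRing.scale/= mulr1.
  - rewrite [pospow 1 0]pospow_le0// mulr0.
    have cv : h^-1 *: (pospow 2 (h *: 1 + 0) - pospow 2 0) @[h --> 0^'] --> (0 : R).
      apply: (@cvg_trans _ ((pospow 1 : R -> R) @ 0^')).
        apply: near_eq_cvg; near=> h.
        rewrite /GRing.scale/= mulr1 addr0 !pospowS mul0r subr0 mulKf//.
        by near: h; exact: nbhs_dnbhs_neq.
      have /continuous_withinNx/= := @continuous_pospow 0 0.
      by rewrite pospow_le0.
    apply: DeriveDef; first by apply/cvg_ex; exists 0.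
    exact/cvg_lim.
rewrite (_ : pospow m.+3 = (@idfun R) * pospow m.+2); last first.
  by apply/funext => z; rewrite pospowS.
have H := IH y.
apply: is_derive_eq; rewrite /GRing.scale/= mulr1 pospowS.
by rewrite -[m.+3]addn1 natrD !pospowS; ring.
Unshelve. all: by end_near. Qed.

Lemma measurable_pospow m : measurable_fun setT (pospow m).
Proof.
apply: measurable_fun_if => //.
by apply: measurable_fun_ltr => //; exact: measurable_cst.
Qed.

End truncated_power.

Section class_C.
Variables (R : realType) (V : normedModType R).
Implicit Types (U : set V) (f g : V -> R).

(** The derivatives in [of_class_C] are those of [f] on the whole of [V], and [U] only says where
    they are tested. Regularity is therefore a pointwise matter, and a singleton carries the germ of
    [f]. *)
Lemma of_class_C_pointwise k U f :
  of_class_C k U f <-> forall x, U x -> of_class_C k [set x] f.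
Proof.
elim: k U f => [|k IH] U f /=; split.
- by move=> [cf _] x Ux; split=> // y ->; exact: cf.
- by move=> H; split=> // x Ux; have [cf _] := H x Ux; exact: cf.
- move=> [cf H] x Ux; split; first by move=> y ->; exact: cf.
  move=> v; have [df Cf] := H v; split; first by move=> y ->; exact: df.
  by move/IH : Cf; exact.
- move=> H; split; first by move=> x Ux; have [cf _] := H x Ux; exact: cf.
  move=> v; split; first by move=> x Ux; have [_ /(_ v)[df _]] := H x Ux; exact: df.
  by apply/IH => x Ux; have [_ /(_ v)[_ Cf]] := H x Ux.
Qed.

Lemma of_class_C_sub k U U' f : U' `<=` U -> of_class_C k U f -> of_class_C k U' f.
Proof.
by move=> UU' /of_class_C_pointwise H; apply/of_class_C_pointwise => x /UU'/H.
Qed.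

Lemma near_of_class_C k f g (x : V) : (\near x, f x = g x) ->
  of_class_C k [set x] f -> of_class_C k [set x] g.
Proof.
elim: k f g => [|k IH] f g fg /= [cf Hf]; have fgx := nbhs_singleton fg.
  split=> // y ->; rewrite /prop_for /continuous_at -fgx.
  by apply: cvg_trans (cf _ erefl); apply: near_eq_cvg.
split.
  move=> y ->; rewrite /prop_for /continuous_at -fgx.
  by apply: cvg_trans (cf _ erefl); apply: near_eq_cvg.
move=> v; have [df Cf] := Hf v; split.
  by move=> y ->; apply: near_eq_derivable (df _ erefl).
apply: IH Cf; near=> y; apply: near_eq_derive.
by near: y; exact: near_join fg.
Unshelve. all: by end_near. Qed.

Lemma of_class_CD k U f g : open U ->
  of_class_C k U f -> of_class_C k U g -> of_class_C k U (f \+ g).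
Proof.
move=> oU; elim: k f g => [|k IH] f g /= [cf Hf] [cg Hg]; split => //.
- by move=> x Ux; apply: cvgD; [exact: cf|exact: cg].
- by move=> x Ux; apply: cvgD; [exact: cf|exact: cg].
- move=> v; have [df Cf] := Hf v; have [dg Cg] := Hg v; split.
    by move=> x Ux; apply: derivableD; [exact: df|exact: dg].
  apply/of_class_C_pointwise => x Ux.
  have /of_class_C_pointwise/(_ _ Ux) := IH _ _ Cf Cg.
  apply: near_of_class_C; near=> y; symmetry; apply: deriveD.
    by apply: df; near: y; exact: open_nbhs_nbhs.
  by apply: dg; near: y; exact: open_nbhs_nbhs.
Unshelve. all: by end_near. Qed.

Lemma of_class_CZ k U f (c : R) : open U ->
  of_class_C k U f -> of_class_C k U (fun x => c * f x).
Proof.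
move=> oU; elim: k f => [|k IH] f /= [cf Hf]; split => //.
- by move=> x Ux; apply: cvgM; [exact: cvg_cst|exact: cf].
- by move=> x Ux; apply: cvgM; [exact: cvg_cst|exact: cf].
- move=> v; have [df Cf] := Hf v; split.
    by move=> x Ux; apply: (derivableZ (df _ Ux)).
  apply/of_class_C_pointwise => x Ux.
  have /of_class_C_pointwise/(_ _ Ux) := IH _ Cf.
  apply: near_of_class_C; near=> y; symmetry; apply: deriveZ.
  by apply: df; near: y; exact: open_nbhs_nbhs.
Unshelve. all: by end_near. Qed.

End class_C.

(** Potentials on the line are treated as restrictions of potentials on the plane, so that
    differentiation under the integral is done only once. *)
Lemma of_class_C_axis (R : realType) k (f : R * R -> R) :
  of_class_C k setT f -> of_class_C k setT (fun s : R => f (s, 0)).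
Proof.
have ax (x : R) : (s, 0 : R) @[s --> x] --> nbhs (x, 0 : R).
  exact: (cvg_pair (@cvg_id _ (nbhs x)) (cvg_cst (0 : R))).
elim: k f => [|k IH] f /= [cf Hf]; split => //.
- by move=> x _; apply: (cvg_comp _ _ (ax x)); exact: cf.
- by move=> x _; apply: (cvg_comp _ _ (ax x)); exact: cf.
- move=> v; have [df Cf] := Hf (v, 0).
  have eqh x : (fun h => h^-1 *: (f ((h *: v + x : R), 0 : R) - f (x, 0))) =
    (fun h => h^-1 *: (f (h *: (v, 0) + (x, 0)) - f (x, 0))).
    apply/funext => h; rewrite (_ : h *: (v, 0) + (x, 0) = (h *: v + x, 0))//.
    by apply: injective_projections; rewrite //= scaler0 addr0.
  split; first by move=> x _; have := df (x, 0) I; rewrite /derivable /= -eqh.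
  rewrite (_ : (fun s => _) = fun s => 'D_(v, 0) f (s, 0)); first exact: (IH _ Cf).
  by apply/funext => s; rewrite /derive/= -eqh.
Qed.

(** * Bounded measurable functions and their expectations *)

Section bounded_measurable.
Context d (T : measurableType d) (R : realType).
Variables (P : {finite_measure set T -> \bar R}) (D : set T).
Hypothesis mD : measurable D.
Implicit Types (f g W X : T -> R).

(** The class is stable under sums, products and truncated powers, and its members are integrable
    for a finite measure, so this one predicate carries the integrability conditions below. *)
Definition bounded_mfun g :=
  measurable_fun D g /\ exists M, forall t, D t -> `|g t| <= M.

Lemma bounded_mfun_cst (c : R) : bounded_mfun (cst c).
Proof. by split; [exact: measurable_cst|exists `|c|]. Qed.

Lemma bounded_mfunD f g : bounded_mfun f -> bounded_mfun g -> bounded_mfun (f \+ g).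
Proof.
move=> [mf [M fM]] [mg [N gN]]; split; first exact: measurable_funD.
exists (M + N) => t Dt; apply: le_trans (ler_normD _ _) _.
by apply: lerD; [exact: fM|exact: gN].
Qed.

Lemma bounded_mfunM f g : bounded_mfun f -> bounded_mfun g -> bounded_mfun (f \* g).
Proof.
move=> [mf [M fM]] [mg [N gN]]; split; first exact: measurable_funM.
exists (M * N) => t Dt; rewrite normrM.
by apply: ler_pM => //; [exact: fM|exact: gN].
Qed.

Lemma bounded_mfunN f : bounded_mfun f -> bounded_mfun (\- f).
Proof.
move=> [mf [M fM]]; split; first exact: measurable_funN.
by exists M => t Dt; rewrite normrN; exact: fM.
Qed.

Lemma bounded_mfunB f g : bounded_mfun f -> bounded_mfun g -> bounded_mfun (f \- g).
Proof. by move=> bf bg; apply: bounded_mfunD => //; exact: bounded_mfunN. Qed.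

Lemma bounded_mfun_pospow m f : bounded_mfun f -> bounded_mfun (pospow m \o f).
Proof.
move=> [mf [M fM]]; split; first exact: measurableT_comp (measurable_pospow m) mf.
exists (`|M| ^+ m) => t Dt; rewrite ger0_norm ?pospow_ge0//= /pospow.
case: ifPn => [f0|_]; last by rewrite exprn_ge0.
rewrite lerXn2r// ?nnegrE ?(ltW f0)//.
by rewrite (le_trans (ler_norm _))// (le_trans (fM _ Dt))// ler_norm.
Qed.

Lemma eq_bounded_mfun f g : (forall t, D t -> f t = g t) ->
  bounded_mfun f -> bounded_mfun g.
Proof.
move=> fg [mf [M fM]]; split.
  by apply: eq_measurable_fun mf => t /set_mem; exact: fg.
by exists M => t Dt; rewrite -fg//; exact: fM.
Qed.

Lemma bounded_mfun_integrable f : bounded_mfun f -> P.-integrable D (EFin \o f).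
Proof.
move=> [mf [M fM]]; apply: measurable_bounded_integrable => //.
  by rewrite ltey_eq fin_num_measure.
exists M; split; first exact: num_real.
by move=> x Mx t Dt; rewrite /= (le_trans (fM _ Dt))// ltW.
Qed.

Definition expect g : R := (\int[P]_(t in D) g t)%R.

Lemma eq_expect f g : (forall t, D t -> f t = g t) -> expect f = expect g.
Proof. by move=> fg; apply: eq_Rintegral => t /set_mem; exact: fg. Qed.

Lemma expectD f g : bounded_mfun f -> bounded_mfun g ->
  expect (f \+ g) = expect f + expect g.
Proof. by move=> bf bg; apply: RintegralD => //; exact: bounded_mfun_integrable. Qed.

Lemma expectZ c f : bounded_mfun f -> expect (fun t => c * f t) = c * expect f.
Proof. by move=> bf; apply: RintegralZl => //; exact: bounded_mfun_integrable. Qed.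

Lemma expectB f g : bounded_mfun f -> bounded_mfun g ->
  expect (f \- g) = expect f - expect g.
Proof. by move=> bf bg; apply: RintegralB => //; exact: bounded_mfun_integrable. Qed.

Lemma bounded_mfun_sum (I : Type) (r : seq I) (f : I -> T -> R) :
  (forall i, bounded_mfun (f i)) -> bounded_mfun (fun t => \sum_(i <- r) f i t).
Proof.
move=> bf; elim: r => [|i r IH].
  by rewrite (_ : (fun t => _) = cst 0); [exact: bounded_mfun_cst|
    apply/funext => t; rewrite big_nil].
rewrite (_ : (fun t => _) = f i \+ fun t => \sum_(j <- r) f j t).
  exact: bounded_mfunD.
by apply/funext => t; rewrite big_cons.
Qed.

Lemma expect_sum (I : Type) (r : seq I) (f : I -> T -> R) :
  (forall i, bounded_mfun (f i)) ->
  expect (fun t => \sum_(i <- r) f i t) = \sum_(i <- r) expect (f i).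
Proof.
move=> bf; elim: r => [|i r IH].
  rewrite big_nil (@eq_expect _ (cst 0)) => [|t _]; last by rewrite big_nil.
  by rewrite /expect Rintegral_cst// mul0r.
rewrite big_cons -IH -expectD//; last exact: bounded_mfun_sum.
by apply: eq_expect => t _; rewrite big_cons.
Qed.

Lemma expect_le f M : bounded_mfun f -> (forall t, D t -> `|f t| <= M) ->
  `|expect f| <= M * fine (P D).
Proof.
move=> bf fM; have If := bounded_mfun_integrable bf.
apply: le_trans (le_normr_Rintegral mD If) _.
rewrite -[leRHS]Rintegral_cst//; apply: le_Rintegral => //.
  apply: (@bounded_mfun_integrable (fun t => `|f t|)).
  case: bf => mf [N fN]; split; first exact: measurableT_comp.
  by exists N => t Dt; rewrite normr_id; exact: fN.
exact: (bounded_mfun_integrable (bounded_mfun_cst M)).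
Qed.

Lemma expect_cvg (f_ : nat -> T -> R) f M :
  (forall n, measurable_fun D (f_ n)) ->
  (forall n t, D t -> `|f_ n t| <= M) ->
  (forall t, D t -> f_ n t @[n --> \oo] --> f t) ->
  expect (f_ n) @[n --> \oo] --> expect f.
Proof.
move=> mf fM ff.
have mf_ n : measurable_fun D (EFin \o f_ n) by exact/measurable_EFinP.
have fE t : D t -> (EFin \o f_ n) t @[n --> \oo] --> (EFin \o f) t.
  by move=> Dt; apply: cvg_EFin; [exact: nearW|exact: ff].
have mfl : measurable_fun D (EFin \o f).
  by apply: (emeasurable_fun_cvg (fun n => EFin \o f_ n)).
have fMe : {ae P, forall t n, D t -> (`|(EFin \o f_ n) t| <= (EFin \o cst M) t)%E}.
  by apply: aeW => t n Dt; rewrite /= lee_fin; exact: fM.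
have [If _ cf] := dominated_convergence mD mf_ mfl (aeW _ fE)
  (bounded_mfun_integrable (bounded_mfun_cst M)) fMe.
rewrite /expect /Rintegral; apply: fine_cvg.
by rewrite fineK//; exact: integrable_fin_num.
Qed.

End bounded_measurable.

(** * Smoothness of truncated power potentials *)

Section pospow_potential.
Context d (T : measurableType d) (R : realType).
Variables (P : {finite_measure set T -> \bar R}) (D : set T).
Hypothesis mD : measurable D.
Variables X1 X2 : T -> R.
Hypotheses (bX1 : bounded_mfun D X1) (bX2 : bounded_mfun D X2).
Implicit Types (W : T -> R) (z : R * R).

Definition pospow2 p q z t := pospow p (X1 t - z.1) * pospow q (X2 t - z.2).

Definition potential p q W z := expect P D (fun t => pospow2 p q z t * W t).

Lemma bounded_mfun_pospow2 p q z : bounded_mfun D (pospow2 p q z).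
Proof.
apply: bounded_mfunM.
  by apply: (bounded_mfun_pospow p); apply: bounded_mfunB => //; exact: bounded_mfun_cst.
by apply: (bounded_mfun_pospow q); apply: bounded_mfunB => //; exact: bounded_mfun_cst.
Qed.

Lemma bounded_mfun_potential p q z W : bounded_mfun D W ->
  bounded_mfun D (fun t => pospow2 p q z t * W t).
Proof. by move=> bW; apply: bounded_mfunM => //; exact: bounded_mfun_pospow2. Qed.

Let pospow_bound m (y K : R) : `|y| <= K -> `|pospow m y| <= K ^+ m.
Proof.
move=> yK; have K0 : 0 <= K by exact: le_trans yK.
rewrite /pospow; case: ifP => _; last by rewrite normr0 exprn_ge0.
by rewrite normrX lerXn2r// nnegrE.
Qed.

(** Uniform for [z] in a unit box around [z0]: this is the domination used in differentiating under
    the integral. *)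
Lemma pospow2_bound p q z0 : exists2 K, 0 <= K & forall z t, D t ->
  `|z.1 - z0.1| <= 1 -> `|z.2 - z0.2| <= 1 -> `|pospow2 p q z t| <= K.
Proof.
have [_ [M1 M1P]] := bX1; have [_ [M2 M2P]] := bX2.
pose K1 := `|M1| + `|z0.1| + 1; pose K2 := `|M2| + `|z0.2| + 1.
exists (K1 ^+ p * K2 ^+ q) => [|z t Dt z1 z2].
  by rewrite mulr_ge0// exprn_ge0// !addr_ge0.
rewrite normrM; apply: ler_pM => //; apply: pospow_bound.
  rewrite (_ : X1 t - z.1 = X1 t - z0.1 - (z.1 - z0.1)); last by ring.
  rewrite (le_trans (ler_normB _ _))// lerD// (le_trans (ler_normB _ _))// lerD//.
  by rewrite (le_trans (M1P _ Dt))// ler_norm.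
rewrite (_ : X2 t - z.2 = X2 t - z0.2 - (z.2 - z0.2)); last by ring.
rewrite (le_trans (ler_normB _ _))// lerD// (le_trans (ler_normB _ _))// lerD//.
by rewrite (le_trans (M2P _ Dt))// ler_norm.
Qed.

Lemma is_derive_pospow2 p q z (v : R * R) t (h : R) :
  is_derive h 1 (fun h : R => pospow2 p.+2 q.+2 (h *: v + z) t)
   (- v.1 * (p.+2%:R * pospow2 p.+1 q.+2 (h *: v + z) t) -
      v.2 * (q.+2%:R * pospow2 p.+2 q.+1 (h *: v + z) t)).
Proof.
have aff (x a b : R) : is_derive h 1 (fun h : R => x - (h * a + b)) (- a).
  rewrite (_ : (fun h => _) = cst (x - b) - a *: (@idfun R)); last first.
    by apply/funext => k; rewrite -[RHS]/(x - b - a * k); ring.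
  by apply: is_derive_eq; rewrite /GRing.scale/= mulr1 sub0r.
have d1 := is_derive1_comp (is_derive_pospow p _) (aff (X1 t) v.1 z.1).
have d2 := is_derive1_comp (is_derive_pospow q _) (aff (X2 t) v.2 z.2).
rewrite (_ : (fun h => _) = (pospow p.+2 \o (fun h : R => X1 t - (h * v.1 + z.1))) *
   (pospow q.+2 \o (fun h : R => X2 t - (h * v.2 + z.2)))); last by apply/funext.
by apply: is_derive_eq; rewrite /pospow2 /GRing.scale/=; ring.
Qed.

Lemma pospow2_lipschitz p q z0 : exists K, forall z t, D t ->
  `|z.1 - z0.1| <= 1 -> `|z.2 - z0.2| <= 1 ->
  `|pospow2 p.+1 q.+1 z t - pospow2 p.+1 q.+1 z0 t| <=
    K * (`|z.1 - z0.1| + `|z.2 - z0.2|).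
Proof.
have [_ [M1 M1P]] := bX1; have [_ [M2 M2P]] := bX2.
pose K1 := `|M1| + `|z0.1| + 1; pose K2 := `|M2| + `|z0.2| + 1.
have [C1 C1P] := pospow_lipschitz p K1; have [C2 C2P] := pospow_lipschitz q K2.
exists (`|C1| * K2 ^+ q.+1 + K1 ^+ p.+1 * `|C2|) => z t Dt z1 z2.
have a1 : `|X1 t - z0.1| <= K1.
  rewrite (le_trans (ler_normB _ _))// -[leLHS]addr0 lerD// lerD//.
  by rewrite (le_trans (M1P _ Dt))// ler_norm.
have a2 : `|X2 t - z0.2| <= K2.
  rewrite (le_trans (ler_normB _ _))// -[leLHS]addr0 lerD// lerD//.
  by rewrite (le_trans (M2P _ Dt))// ler_norm.
have b1 : `|X1 t - z.1| <= K1.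
  rewrite (_ : X1 t - z.1 = X1 t - z0.1 - (z.1 - z0.1)); last by ring.
  rewrite (le_trans (ler_normB _ _))// lerD// (le_trans (ler_normB _ _))// lerD//.
  by rewrite (le_trans (M1P _ Dt))// ler_norm.
have b2 : `|X2 t - z.2| <= K2.
  rewrite (_ : X2 t - z.2 = X2 t - z0.2 - (z.2 - z0.2)); last by ring.
  rewrite (le_trans (ler_normB _ _))// lerD// (le_trans (ler_normB _ _))// lerD//.
  by rewrite (le_trans (M2P _ Dt))// ler_norm.
have l1 : `|pospow p.+1 (X1 t - z.1) - pospow p.+1 (X1 t - z0.1)| <=
    `|C1| * `|z.1 - z0.1|.
  rewrite (le_trans (C1P _ _ b1 a1))//.
  rewrite (_ : X1 t - z.1 - (X1 t - z0.1) = - (z.1 - z0.1)); last by ring.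
  by rewrite normrN ler_wpM2r// ler_norm.
have l2 : `|pospow q.+1 (X2 t - z.2) - pospow q.+1 (X2 t - z0.2)| <=
    `|C2| * `|z.2 - z0.2|.
  rewrite (le_trans (C2P _ _ b2 a2))//.
  rewrite (_ : X2 t - z.2 - (X2 t - z0.2) = - (z.2 - z0.2)); last by ring.
  by rewrite normrN ler_wpM2r// ler_norm.
have K10 : 0 <= K1 by rewrite !addr_ge0.
have K20 : 0 <= K2 by rewrite !addr_ge0.
have -> : pospow2 p.+1 q.+1 z t - pospow2 p.+1 q.+1 z0 t =
  (pospow p.+1 (X1 t - z.1) - pospow p.+1 (X1 t - z0.1)) * pospow q.+1 (X2 t - z.2) +
  pospow p.+1 (X1 t - z0.1) *
    (pospow q.+1 (X2 t - z.2) - pospow q.+1 (X2 t - z0.2)).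
  by rewrite /pospow2; ring.
apply: (@le_trans _ _ (`|C1| * `|z.1 - z0.1| * K2 ^+ q.+1 +
   K1 ^+ p.+1 * (`|C2| * `|z.2 - z0.2|))).
  rewrite (le_trans (ler_normD _ _))// !normrM; apply: lerD; apply: ler_pM => //;
    exact: pospow_bound.
rewrite -subr_ge0 (_ : _ - _ = `|C1| * K2 ^+ q.+1 * `|z.2 - z0.2| +
  K1 ^+ p.+1 * `|C2| * `|z.1 - z0.1|); last by ring.
by rewrite addr_ge0// !mulr_ge0// exprn_ge0.
Qed.

Lemma continuous_potential p q W : bounded_mfun D W ->
  continuous (potential p.+1 q.+1 W).
Proof.
move=> bW z; have [mW [M MP]] := bW.
have [K KP] := pospow2_lipschitz p q z.
apply: cvg_zero; apply: norm_cvg0.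
pose L (y : R * R) := `|K| * (`|y.1 - z.1| + `|y.2 - z.2|) * `|M| * fine (P D).
have cL : L y @[y --> z] --> (0 : R).
  have c1 : (y.1 : R) @[y --> z] --> z.1 by exact: cvg_fst.
  have c2 : (y.2 : R) @[y --> z] --> z.2 by exact: cvg_snd.
  have <- : `|K| * (`|z.1 - z.1| + `|z.2 - z.2|) * `|M| * fine (P D) = 0.
    by rewrite !subrr normr0 addr0 mulr0 !mul0r.
  apply: cvgMr_tmp; apply: cvgMr_tmp; apply: cvgMl_tmp; apply: cvgD.
    by apply: cvg_norm; apply: cvgB => //; exact: cvg_cst.
  by apply: cvg_norm; apply: cvgB => //; exact: cvg_cst.
apply: (@squeeze_cvgr _ _ _ _ (cst 0) L) => //; last exact: cvg_cst.
near=> y; rewrite /= normr_ge0/=.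
have bp y' := bounded_mfun_potential p.+1 q.+1 y' bW.
rewrite -[X in `|X|]/(potential p.+1 q.+1 W y - potential p.+1 q.+1 W z).
rewrite -expectB//; apply: expect_le => //; first exact: bounded_mfunB.
move=> t Dt; rewrite /= -mulrBl normrM; apply: ler_pM => //.
  apply: (le_trans (KP y t Dt _ _)).
  - near: y.
    have : `|y.1 - z.1| @[y --> z] --> `|z.1 - z.1|.
      by apply: cvg_norm; apply: cvgB; [exact: cvg_fst|exact: cvg_cst].
    by rewrite subrr normr0 => /cvgr_le; apply.
  - near: y.
    have : `|y.2 - z.2| @[y --> z] --> `|z.2 - z.2|.
      by apply: cvg_norm; apply: cvgB; [exact: cvg_snd|exact: cvg_cst].
    by rewrite subrr normr0 => /cvgr_le; apply.
  - by rewrite ler_wpM2r ?addr_ge0// ler_norm.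
by rewrite (le_trans (MP _ Dt))// ler_norm.
Unshelve. all: by end_near. Qed.

Lemma is_derive_potential p q W z v : bounded_mfun D W ->
  is_derive z v (potential p.+2 q.+2 W)
   (- v.1 * (p.+2%:R * potential p.+1 q.+2 W z) -
      v.2 * (q.+2%:R * potential p.+2 q.+1 W z)).
Proof.
move=> bW.
pose f (h : R) t := pospow2 p.+2 q.+2 (h *: v + z) t * W t.
have df (h : R) (t : T) : is_derive h 1 (f ^~ t)
   ((- v.1 * (p.+2%:R * pospow2 p.+1 q.+2 (h *: v + z) t) -
      v.2 * (q.+2%:R * pospow2 p.+2 q.+1 (h *: v + z) t)) * W t).
  have H := is_derive_pospow2 p q z v t h.
  rewrite (_ : f ^~ t = (fun h : R => pospow2 p.+2 q.+2 (h *: v + z) t) * cst (W t))//.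
  by apply: is_derive_eq; rewrite scaler0 add0r /GRing.scale/= mulrC.
have [K1 K10 K1P] := pospow2_bound p.+1 q.+2 z.
have [K2 K20 K2P] := pospow2_bound p.+2 q.+1 z.
have [mW [M MP]] := bW.
(* For |h| < e both coordinates of h v are at most 1 in absolute value, which keeps the shifted
   point in the box of [pospow2_bound]. *)
pose e := (`|v.1| + `|v.2| + 1)^-1.
have e0 : 0 < e by rewrite invr_gt0 ltr_wpDl// addr_ge0.
have eI (h : R) : `]-e, e[%classic h -> `|h * v.1| <= 1 /\ `|h * v.2| <= 1.
  rewrite /= in_itv/= -ltr_norml => /ltW he; rewrite !normrM; split.
    rewrite (@le_trans _ _ (e * `|v.1|))// ?ler_wpM2r// mulrC ler_pdivrMr ?mul1r.
      by rewrite -addrA ler_wpDr// addr_ge0.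
    by rewrite -invr_gt0.
  rewrite (@le_trans _ _ (e * `|v.2|))// ?ler_wpM2r// mulrC ler_pdivrMr ?mul1r.
    by rewrite addrAC ler_wpDl// addr_ge0.
  by rewrite -invr_gt0.
pose K := (`|v.1| * (p.+2%:R * K1) + `|v.2| * (q.+2%:R * K2)) * `|M|.
have K0 : 0 <= K by rewrite mulr_ge0// addr_ge0// !mulr_ge0.
have bf y := bounded_mfun_potential p.+2 q.+2 y bW.
have cv := @cvg_differentiation_under_integral R _ T P f D mD 0 (- e) e.
have : h^-1 *: (potential p.+2 q.+2 W (h *: v + z) - potential p.+2 q.+2 W z)
    @[h --> 0^'] --> - v.1 * (p.+2%:R * potential p.+1 q.+2 W z) -
      v.2 * (q.+2%:R * potential p.+2 q.+1 W z).
  have -> : - v.1 * (p.+2%:R * potential p.+1 q.+2 W z) -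
      v.2 * (q.+2%:R * potential p.+2 q.+1 W z) =
      \int[P]_(t in D) (partial1of2 f 0 t).
    have bc (c : R) p' q' : bounded_mfun D (fun t => c * (pospow2 p' q' z t * W t)).
      by apply: (bounded_mfunM (bounded_mfun_cst _ _)); exact: bounded_mfun_potential.
    have bcc (c c' : R) p' q' :
        bounded_mfun D (fun t => c * (c' * (pospow2 p' q' z t * W t))).
      by apply: (bounded_mfunM (bounded_mfun_cst _ _)).
    rewrite /potential -!(expectZ P mD); do ?exact: bounded_mfun_potential; do ?exact: bc.
    rewrite -(expectB P mD); [|exact: bcc..].
    apply: eq_Rintegral => t _; rewrite partial1of2E.
    by rewrite (@derive_val _ _ _ _ _ _ _ (df 0 t)) scale0r add0r /=; ring.
  have -> : (fun h : R => h^-1 *: (potential p.+2 q.+2 W (h *: v + z) -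
      potential p.+2 q.+2 W z)) = (fun h => h^-1 *:
      ((\int[P]_(t in D) f (h + 0) t) - \int[P]_(t in D) f 0 t)).
    by apply/funext => h; rewrite /f addr0 scale0r add0r.
  apply: (cv _ _ _ (cst K)) => //.
  - by rewrite /= in_itv/= oppr_lt0 e0.
  - by move=> h _; exact: (bounded_mfun_integrable P mD (bf _)).
  - exact: (bounded_mfun_integrable P mD (bounded_mfun_cst _ K)).
  - move=> h t /eI [h1 h2] Dt; rewrite partial1of2E.
    rewrite (@derive_val _ _ _ _ _ _ _ (df h t)) normrM /K.
    apply: ler_pM => //; last by rewrite (le_trans (MP _ Dt))// ler_norm.
    rewrite (le_trans (ler_normB _ _))// !normrM normrN !normr_nat.
    by apply: lerD; rewrite ler_wpM2l// ler_wpM2l// -normrM; [apply: K1P|apply: K2P];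
      rewrite //= addrK.
move=> cvd; apply: DeriveDef; last exact: cvg_lim.
by apply/cvg_ex; eexists; exact: cvd.
Qed.

(** Each derivative lowers one of the two exponents by one, and continuity takes both exponents at
    least 1; hence the conditions on [p] and [q]. *)
Lemma of_class_C_potential k p q W : bounded_mfun D W -> (k < p)%N -> (k < q)%N ->
  of_class_C k setT (potential p q W).
Proof.
move=> bW; elim: k p q => [|k IH] [//|p] [//|q]; rewrite !ltnS.
  by move=> _ _; split => // z _; exact: continuous_potential.
move=> kp kq; split => [z _|v]; first exact: continuous_potential.
case: p kp => [//|p] kp; case: q kq => [//|q] kq; split.
  by move=> z _; have [] := is_derive_potential p q z v bW.
rewrite (_ : (fun x => _) = (fun z => - v.1 * p.+2%:R * potential p.+1 q.+2 W z) \+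
      (fun z => - v.2 * q.+2%:R * potential p.+2 q.+1 W z)); last first.
  apply/funext => z; rewrite (@derive_val _ _ _ _ _ _ _ (is_derive_potential p q z v bW)).
  by rewrite /=; ring.
by apply: of_class_CD; [exact: openT|apply: of_class_CZ; [exact: openT|apply: IH]..];
  rewrite // ltnW.
Qed.

End pospow_potential.

(** * Densities from truncated power potentials *)

Section pospow_limit.
Context d (T : measurableType d) (R : realType).
Variables (P : {finite_measure set T -> \bar R}) (D : set T).
Hypothesis mD : measurable D.
Implicit Types (X W : T -> R).

Let bounded_pospow_shift m X W s : bounded_mfun D X -> bounded_mfun D W ->
  bounded_mfun D (fun t => pospow m (X t - s) * W t).
Proof.
move=> bX bW; apply: bounded_mfunM => //.
by apply: (bounded_mfun_pospow m); apply: bounded_mfunB => //; exact: bounded_mfun_cst.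
Qed.

(** The quotient looks only to the left of [y]. For exponent 1 it converges at [y = 0] too, to the
    value 0 of [pospow 0] there, so exponents can be lowered all the way to an indicator. *)
Let pospow_quotient_cvg m (y : R) :
  n.+1%:R * (pospow m.+1 y - pospow m.+1 (y - n.+1%:R^-1)) @[n --> \oo] -->
    m.+1%:R * pospow m y.
Proof.
have [y0|y0] := leP y 0.
  rewrite (pospow_le0 m y0) mulr0.
  rewrite (_ : (fun n => _) = cst 0); first exact: cvg_cst.
  apply/funext => n; rewrite !pospow_le0 ?subrr ?mulr0//.
  by rewrite (le_trans _ y0)// lerBlDr lerDl.
have -> : m.+1%:R * pospow m y = 'D_1 (fun x : R => x ^+ m.+1) y.
  by rewrite exp_derive /pospow y0 /GRing.scale/= mulr1.
have df : derivable (fun x : R => x ^+ m.+1) y 1 by exact: exprn_derivable.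
have u0 : (forall n, - n.+1%:R^-1 != 0 :> R) /\ (- n.+1%:R^-1 : R) @[n --> \oo] --> 0.
  split=> [n|]; first by rewrite oppr_eq0 invr_eq0 pnatr_eq0.
  by rewrite -oppr0; apply: cvgN; exact: cvg_harmonic.
have /cvgr_dnbhsP/(_ _ u0) := df.
apply: cvg_trans; apply: near_eq_cvg.
have : \forall n \near \oo, (n.+1%:R^-1 : R) < y.
  exact: (cvgr_lt _ (@cvg_harmonic R)).
apply: filterS => n ny /=.
rewrite /GRing.scale/= mulr1 invrN invrK /pospow y0 subr_gt0 ny addrC.
by rewrite [- _ + y]addrC mulNr -mulrN opprD opprK.
Qed.

Lemma expect_pospow_quotient_cvg m X W s : bounded_mfun D X -> bounded_mfun D W ->
  n.+1%:R * (expect P D (fun t => pospow m.+1 (X t - s) * W t) -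
     expect P D (fun t => pospow m.+1 (X t - (s + n.+1%:R^-1)) * W t)) @[n --> \oo]
  --> m.+1%:R * expect P D (fun t => pospow m (X t - s) * W t).
Proof.
move=> bX bW; have bXs := bounded_pospow_shift _ _ bX bW.
have [_ [M MP]] := bX; have [_ [N NP]] := bW.
have [C CP] := pospow_lipschitz m (`|M| + `|s| + 1).
rewrite -(expectZ P mD)//.
rewrite (_ : (fun n : nat => _) = fun n : nat => expect P D (fun t =>
   n.+1%:R * ((pospow m.+1 (X t - s) * W t) -
     (pospow m.+1 (X t - (s + n.+1%:R^-1)) * W t)))); last first.
  by apply/funext => n; rewrite (expectZ P mD) ?(expectB P mD)//; exact: bounded_mfunB.
pose f_ n t := n.+1%:R * ((pospow m.+1 (X t - s) * W t) -
     (pospow m.+1 (X t - (s + n.+1%:R^-1)) * W t)).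
apply: (@expect_cvg _ _ _ P D mD f_ _ (`|C| * `|N|)); rewrite /f_.
- move=> n; apply: measurable_funM; first exact: measurable_cst.
  by apply: measurable_funB; [have [] := bXs m.+1 s|have [] := bXs m.+1 (s + n.+1%:R^-1)].
- move=> n t Dt; rewrite -mulrBl mulrA normrM; apply: ler_pM => //; last first.
    by rewrite (le_trans (NP _ Dt))// ler_norm.
  have XM : `|X t| <= `|M| by rewrite (le_trans (MP _ Dt))// ler_norm.
  rewrite normrM ger0_norm//.
  rewrite -[leRHS](mulKf (_ : n.+1%:R != 0 :> R)) ?pnatr_eq0//.
  rewrite mulrCA ler_wpM2l// (le_trans (CP _ _ _ _))//.
  + by rewrite (le_trans (ler_normB _ _))// -[leLHS]addr0 lerD// lerD.
  + rewrite opprD addrA (le_trans (ler_normB _ _))//.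
    rewrite lerD//; first by rewrite (le_trans (ler_normB _ _))// lerD.
    by rewrite ger0_norm ?invr_ge0// invf_le1// ler1n.
  + rewrite (_ : X t - s - (X t - (s + n.+1%:R^-1)) = n.+1%:R^-1); last by ring.
    by rewrite ger0_norm ?invr_ge0// mulrC ler_wpM2l ?invr_ge0// ler_norm.
- move=> t Dt.
  have := @pospow_quotient_cvg m (X t - s).
  move=> cv; rewrite mulrA.
  apply: cvg_trans (cvgM cv (cvg_cst (W t))); apply: near_eq_cvg; apply: nearW => n /=.
  by rewrite -mulrA mulrBl opprD addrA.
Qed.

(** An identity valid for all [s] passes to one-sided difference quotients in [s]. Repeated use
    brings exponent 2 down to 0, where the left side is the weighted mass of a ray. *)
Lemma expect_pospow_derive m k X W W' :
  bounded_mfun D X -> bounded_mfun D W -> bounded_mfun D W' ->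
  (forall s, expect P D (fun t => pospow m.+1 (X t - s) * W t) =
             expect P D (fun t => pospow k.+1 (X t - s) * W' t)) ->
  forall s, m.+1%:R * expect P D (fun t => pospow m (X t - s) * W t) =
            k.+1%:R * expect P D (fun t => pospow k (X t - s) * W' t).
Proof.
move=> bX bW bW' WW' s.
have /cvg_lim E1 := @expect_pospow_quotient_cvg m X W s bX bW.
have /cvg_lim E2 := @expect_pospow_quotient_cvg k X W' s bX bW'.
rewrite -E1// -E2//; congr (limn _).
by apply/funext => n; rewrite !WW'.
Qed.

End pospow_limit.

Section density_measure.
Local Open Scope ereal_scope.
Context d (T : measurableType d) (R : realType).
Variables (mu : {measure set T -> \bar R}) (f : T -> \bar R).

(** The two proofs are arguments of the definition so that the measure structure can be inferred
    from the term. *)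
Definition density_measure of measurable_fun setT f & (forall x, 0 <= f x) :=
  fun E => \int[mu]_(x in E) f x.

Hypotheses (mf : measurable_fun setT f) (f0 : forall x, 0 <= f x).

Let density_measure0 : density_measure mf f0 set0 = 0.
Proof. exact: integral_set0. Qed.

Let density_measure_ge0 E : 0 <= density_measure mf f0 E.
Proof. by apply: integral_ge0 => x _; exact: f0. Qed.

Let density_measure_sigma_additive : semi_sigma_additive (density_measure mf f0).
Proof. exact: semi_sigma_additive_nng_induced. Qed.

HB.instance Definition _ := isMeasure.Build _ _ _ (density_measure mf f0)
  density_measure0 density_measure_ge0 density_measure_sigma_additive.

End density_measure.

Section kernel_density.
Local Open Scope ereal_scope.
Context d (T : measurableType d) dV (V : measurableType dV) (R : realType).
Variables (P : {finite_measure set T -> \bar R}) (D : set T).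
Variable la : {sigma_finite_measure set V -> \bar R}.
Hypothesis mD : measurable D.
Variables (X : {mfun T >-> V}) (kap : T * V -> R) (W : T -> R).
Hypotheses (mkap : measurable_fun setT kap)
  (kap0 : forall p, (0 <= kap p)%R) (bW : bounded_mfun D W) (W0 : forall t, D t -> (0 <= W t)%R).
Variables (Q : set (set V)) (g : nat -> set V).
Hypotheses (QE : measurable = <<s Q >>) (QI : setI_closed Q) (Qg : forall i, Q (g i))
  (g_cover : \bigcup_k g k = setT).

Definition smear (U : T -> R) z := \int[P]_(t in D) (kap (t, z) * U t)%:E.

Let measurable_smear_kernel (U : T -> R) : measurable_fun D U ->
  measurable_fun setT (fun p : T * V => ((kap p * (U \_ D) p.1)%R)%:E).
Proof.
move=> mU; apply/measurable_EFinP; apply: measurable_funM => //.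
apply: (measurableT_comp (f := U \_ D)) => //.
exact/(measurable_restrictT _ mD).
Qed.

Let restrict_kernel (U : T -> R) z t :
  (kap (t, z) * (U \_ D) t)%:E = ((fun t => (kap (t, z) * U t)%:E) \_ D) t.
Proof. by rewrite /patch; case: ifP => //; rewrite mulr0. Qed.

Lemma measurable_smear (U : T -> R) : measurable_fun D U -> (forall t, D t -> (0 <= U t)%R) ->
  measurable_fun setT (smear U).
Proof.
move=> mU U0; have mk := measurable_smear_kernel mU.
have k0 p : 0 <= ((kap p * (U \_ D) p.1)%R)%:E.
  by rewrite lee_fin mulr_ge0// /patch; case: ifPn => // /set_mem; exact: U0.
have := measurable_fun_fubini_tonelli_G (m1 := P) _ mk k0; apply: eq_measurable_fun => z _.
rewrite /fubini_G /smear [RHS]integral_mkcond.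
by apply: eq_integral => t _; exact: restrict_kernel.
Qed.

Lemma smear_ge0 (U : T -> R) z : (forall t, D t -> (0 <= U t)%R) -> 0 <= smear U z.
Proof. by move=> U0; apply: integral_ge0 => t Dt; rewrite lee_fin mulr_ge0// U0. Qed.

Lemma integral_smear (U : T -> R) E : measurable E -> measurable_fun D U ->
  (forall t, D t -> (0 <= U t)%R) ->
  \int[la]_(z in E) smear U z =
  \int[P]_(t in D) ((U t)%:E * \int[la]_(z in E) (kap (t, z))%:E).
Proof.
move=> mE mU U0.
pose f (p : T * V) := ((kap p * (U \_ D) p.1 * \1_E p.2)%R)%:E.
have mf : measurable_fun setT f.
  rewrite /f; under eq_fun do rewrite EFinM; apply: emeasurable_funM.
    exact: measurable_smear_kernel.
  apply/measurable_EFinP.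
  exact: (measurableT_comp (measurable_indic (R := R) mE) measurable_snd).
have f0 p : 0 <= f p.
  rewrite lee_fin !mulr_ge0// /patch; case: ifPn => // /set_mem; exact: U0.
transitivity (\int[la]_z \int[P]_t f (t, z)).
  rewrite [LHS]integral_mkcond; apply: eq_integral => z _.
  rewrite /f [LHS]/patch; case: ifPn => zE /=.
    rewrite /smear [LHS]integral_mkcond; apply: eq_integral => t _.
    by rewrite indicE zE mulr1 restrict_kernel.
  by rewrite integral0_eq// => t _; rewrite indicE (negbTE zE) mulr0.
rewrite -(fubini_tonelli (m1 := P) (m2 := la) _ mf f0).
rewrite [RHS]integral_mkcond; apply: eq_integral => t _.
rewrite [RHS]/patch; case: ifPn => tD; last first.
  by rewrite integral0_eq// => z _; rewrite /f /patch /= (negbTE tD) mulr0 mul0r.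
have tD' := set_mem tD.
rewrite [in RHS]integral_mkcond -ge0_integralZl//; last 3 first.
- apply/(measurable_restrictT _ mE)/measurable_funTS/measurable_EFinP.
  exact: measurableT_comp mkap (measurable_pair1 _).
- by move=> z _; rewrite /patch; case: ifP => _ //; rewrite lee_fin.
- by rewrite lee_fin U0.
apply: eq_integral => z _; rewrite /f /patch /= tD indicE; case: ifP => zE.
  by rewrite mulr1 mulrC EFinM.
by rewrite mulr0 mule0.
Qed.

Let EFin_expect (U : T -> R) : bounded_mfun D U ->
  \int[P]_(t in D) (U t)%:E = (expect P D U)%:E.
Proof.
move=> bU; rewrite /expect /Rintegral fineK//.
exact: (integrable_fin_num mD (bounded_mfun_integrable P mD bU)).
Qed.

Let bounded_indic A : measurable A -> bounded_mfun D (fun t => \1_A (X t) * W t)%R.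
Proof.
move=> mA; apply: bounded_mfunM => //; split.
  apply: measurable_funTS.
  exact: (measurableT_comp (measurable_indic (R := R) mA) (measurable_funPT X)).
by exists 1%R => t _; rewrite indicE; case: (_ \in _); rewrite ?normr1 ?normr0.
Qed.

Lemma smear_expect U z : bounded_mfun D (fun t => kap (t, z) * U t)%R ->
  smear U z = (expect P D (fun t => kap (t, z) * U t)%R)%:E.
Proof. exact: EFin_expect. Qed.

(** As [W'] has no sign, its negative part is moved to the left. Both sides are then measures; by
    Tonelli and the hypothesis on [J] they agree on the generating class [Q], and they are finite on
    the cover [g], so they are equal. *)
Lemma kernel_density (W' : T -> R) (J : set V -> T -> R) :
  bounded_mfun D W' -> (forall A, Q A -> bounded_mfun D (J A)) ->
  (forall A t, Q A -> D t -> \int[la]_(z in A) (kap (t, z))%:E = (J A t)%:E) ->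
  (forall A, Q A -> expect P D (fun t => \1_A (X t) * W t)%R =
                    expect P D (fun t => J A t * W' t)%R) ->
  forall E, measurable E ->
    \int[P]_(t in D) (\1_E (X t) * W t)%:E +
      \int[la]_(z in E) smear (fun t => Num.max (- W' t) 0)%R z =
    \int[la]_(z in E) smear (fun t => Num.max (W' t) 0)%R z.
Proof.
move=> bW' bJ JE WW'.
pose Wn t := Num.max (- W' t)%R 0%R; pose Wp t := Num.max (W' t) 0%R.
have bmax U : bounded_mfun D U -> bounded_mfun D (fun t => Num.max (U t) 0%R).
  move=> [mU [M MU]]; split; first by apply: measurable_maxr => //; exact: measurable_cst.
  exists M => t Dt; rewrite (le_trans _ (MU _ Dt))// maxEle; case: ifP => // _.
  by rewrite normr0.
have bWn : bounded_mfun D Wn by apply: bmax; exact: bounded_mfunN.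
have bWp : bounded_mfun D Wp by exact: bmax.
have Wn0 t : D t -> (0 <= Wn t)%R by move=> _; rewrite le_max lexx orbT.
have Wp0 t : D t -> (0 <= Wp t)%R by move=> _; rewrite le_max lexx orbT.
have [mWn _] := bWn; have [mWp _] := bWp; have [mW _] := bW.
have mQ A : Q A -> measurable A by rewrite QE; exact: sub_sigma_algebra.
pose f := (EFin \o W) \_ D.
have mf : measurable_fun setT f.
  by apply/(measurable_restrictT _ mD); exact/measurable_EFinP.
have f0 t : 0 <= f t.
  by rewrite /f /patch; case: ifPn => // /set_mem Dt; rewrite lee_fin W0.
pose m1 := measure_add (pushforward (density_measure P mf f0) X)
  (density_measure la (measurable_smear mWn Wn0) (fun z => smear_ge0 z Wn0)).
pose m2 := density_measure la (measurable_smear mWp Wp0) (fun z => smear_ge0 z Wp0).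
have pushE A : measurable A -> pushforward (density_measure P mf f0) X A =
    \int[P]_(t in D) (\1_A (X t) * W t)%:E.
  move=> mA; rewrite /pushforward /density_measure /f.
  rewrite integral_mkcond [RHS]integral_mkcond; apply: eq_integral => t _.
  rewrite /patch indicE (_ : (t \in X @^-1` A) = (X t \in A)).
    by case: (X t \in A); case: (t \in D); rewrite ?mul1r ?mul0r.
  by apply/idP/idP => /set_mem h; apply/mem_set.
have smearQ U A : Q A -> bounded_mfun D U -> (forall t, D t -> (0 <= U t)%R) ->
    \int[la]_(z in A) smear U z = (expect P D (fun t => J A t * U t)%R)%:E.
  move=> QA bU U0; rewrite integral_smear//; [|exact: mQ|by case: bU].
  rewrite -EFin_expect; last by apply: bounded_mfunM => //; exact: bJ.
  by apply: eq_integral => t /set_mem Dt; rewrite JE// -EFinM mulrC.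
have mX : measurable_fun setT X by [].
have m1E A : measurable A -> m1 mX A =
    \int[P]_(t in D) (\1_A (X t) * W t)%:E + \int[la]_(z in A) smear Wn z.
  by move=> mA; rewrite /m1 measure_addE; congr (_ + _); exact: pushE.
have m12 A : Q A -> m1 mX A = m2 A.
  move=> QA; rewrite m1E; last exact: mQ.
  rewrite /m2 /density_measure !smearQ// EFin_expect; last exact/bounded_indic/mQ.
  rewrite WW'// -EFinD -(expectD P mD); last 2 first.
  - by apply: bounded_mfunM => //; exact: bJ.
  - by apply: bounded_mfunM => //; exact: bJ.
  congr (_%:E); apply: eq_expect => t Dt /=.
  rewrite -mulrDr /Wn /Wp; congr (_ * _)%R; rewrite !maxEle.
  by case: ltgtP => [w|w|w]; case: ltgtP => w'; lra.
have m1g k : m1 mX (g k) < +oo.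
  by rewrite m12// /m2 /density_measure smearQ// ltry.
move=> E mE; transitivity (m1 mX E); first by symmetry; exact: m1E.
exact: (measure_unique Q g QE QI Qg g_cover (m1 mX) m2 m12 m1g E mE).
Qed.

End kernel_density.

Section pospow_integral.
Variable R : realType.
Implicit Types (a x : R) (k : nat).

Lemma integral_pospow k a x :
  (\int[@lebesgue_measure R]_(z in `]a, +oo[) (pospow k (x - z))%:E =
    (pospow k.+1 (x - a) / k.+1%:R)%:E)%E.
Proof.
have [xa|ax] := leP x a.
  rewrite [in RHS]pospow_le0 ?subr_le0// mul0r integral0_eq// => z /=.
  rewrite in_itv/= andbT => az; rewrite pospow_le0// subr_le0.
  by rewrite (le_trans xa)// ltW.
pose f z := (x - z) ^+ k; pose F z := - (x - z) ^+ k.+1 / k.+1%:R.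
have dF (z : R) : is_derive z 1 F (f z).
  have H : is_derive z 1 (fun z => x - z) (- 1).
    rewrite (_ : (fun z => _) = cst x - (@idfun R))//.
    by apply: is_derive_eq; rewrite sub0r.
  rewrite (_ : F = (- k.+1%:R^-1) *: (fun z => x - z) ^+ k.+1); last first.
    apply/funext => y; rewrite /F.
    rewrite -[RHS]/(- k.+1%:R^-1 * (((fun z => x - z) : R -> R) ^+ k.+1) y) exprfctE.
    by rewrite !mulNr mulrC.
  apply: is_derive_eq; rewrite /f /GRing.scale/= ?fctE.
  by rewrite mulrN1 mulrNN mulKf// pnatr_eq0.
have cF : continuous F.
  by move=> z; apply/differentiable_continuous/derivable1_diffP; have [] := dF z.
have cf : continuous f.
  move=> z; apply: (@continuous_comp _ _ _ (fun z => x - z) (fun y => y ^+ k)).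
    by apply: cvgB => //; exact: cvg_cst.
  exact: exprn_continuous.
have FE : F x - F a = pospow k.+1 (x - a) / k.+1%:R.
  by rewrite /F subrr expr0n/= oppr0 mul0r sub0r /pospow subr_gt0 ax mulNr opprK.
rewrite -FE EFinB -(@continuous_FTC2 _ f F a x ax); last 3 first.
- exact: continuous_subspaceT.
- split; first by move=> z _; have [] := dF z.
  + exact: cvg_at_right_filter (cF a).
  + exact: cvg_at_left_filter (cF x).
- by move=> z _; rewrite derive1E; have [_ ->] := dF z.
have mf : measurable_fun setT (EFin \o f).
  by apply/measurable_EFinP; exact: continuous_measurable_fun.
rewrite -integral_itv_obnd_cbnd; last exact: measurable_funTS.
rewrite -integral_itv_bndo_bndc; last exact: measurable_funTS.
have E (z : R) : ((fun z => (pospow k (x - z))%:E) \_ `]a, +oo[) z =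
    ((EFin \o f) \_ `]a, x[) z.
  rewrite /patch !mem_setE !in_itv/= andbT /f /pospow subr_gt0.
  by case: (a < z); case: (z < x).
by rewrite integral_mkcond [RHS]integral_mkcond; apply: eq_integral => z _; exact: E.
Qed.

Lemma integral_pospow2 k a1 a2 x1 x2 :
  (\int[@lebesgue_plane R]_(z in `]a1, +oo[ `*` `]a2, +oo[)
     (pospow k (x1 - z.1) * pospow k (x2 - z.2))%:E =
    (pospow k.+1 (x1 - a1) / k.+1%:R * (pospow k.+1 (x2 - a2) / k.+1%:R))%:E)%E.
Proof.
pose u (a x z : R) : R := pospow k (x - z) * \1_(`]a, +oo[%classic) z.
have u0 a x z : 0 <= u a x z by rewrite mulr_ge0 ?pospow_ge0.
have mu a x : measurable_fun setT (u a x).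
  apply: measurable_funM; last exact: measurable_indic.
  apply: (measurableT_comp (measurable_pospow k)).
  by apply: measurable_funB => //; exact: measurable_cst.
have iu a x : (\int[@lebesgue_measure R]_z (u a x z)%:E =
    (pospow k.+1 (x - a) / k.+1%:R)%:E)%E.
  rewrite -integral_pospow [RHS]integral_mkcond; apply: eq_integral => z _.
  by rewrite /u /patch indicE; case: ifP => _; rewrite ?mulr1 ?mulr0.
pose h (z : R * R) := (u a1 x1 z.1 * u a2 x2 z.2)%:E.
transitivity (\int[(@lebesgue_measure R \x @lebesgue_measure R)%E]_z h z)%E.
  rewrite integral_mkcond; apply: eq_integral => z _.
  rewrite /h /u /patch !indicE in_setX.
  by case: (_ \in _); case: (_ \in _); rewrite /= ?mulr1 ?mulr0 ?mul0r.
rewrite fubini_tonelli1//; last 2 first.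
- apply/measurable_EFinP; apply: measurable_funM.
    exact: (measurableT_comp (mu a1 x1) measurable_fst).
  exact: (measurableT_comp (mu a2 x2) measurable_snd).
- by move=> z; rewrite lee_fin mulr_ge0.
rewrite /fubini_F /h /=.
under eq_integral => z _.
  under eq_integral => y _ do rewrite EFinM.
  rewrite ge0_integralZl//; last 3 first.
  - by apply/measurable_EFinP; exact: mu.
  - by move=> y _; rewrite lee_fin.
  - by rewrite lee_fin.
  rewrite iu.
  over.
rewrite ge0_integralZr//; last 3 first.
- by apply/measurable_EFinP; exact: mu.
- by move=> y _; rewrite lee_fin.
- by rewrite lee_fin divr_ge0// pospow_ge0.
by rewrite iu EFinM.
Qed.

End pospow_integral.

(** * Generating classes of rays and quadrants *)

Section rays.
Variable R : realType.

Definition rays : set (set R) := [set `]a, +oo[%classic | a in setT].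

Definition quadrants : set (set (R * R)) :=
  [set `]a.1, +oo[ `*` `]a.2, +oo[ | a in setT].

Lemma measurable_rays : @measurable _ (measurableTypeR R) = <<s rays >>.
Proof.
rewrite RGenOInfty.measurableE; congr (<<s _ >>); apply/seteqP; split => A.
  by move=> [a ->]; exists a.
by move=> [a _ <-]; exists a.
Qed.

Lemma setI_closed_rays : setI_closed rays.
Proof.
move=> _ _ [a _ <-] [b _ <-]; exists (Num.max a b) => //.
by apply/seteqP; split => z /=; rewrite !in_itv/= !andbT gt_max => /andP.
Qed.

Lemma bigcup_rays : \bigcup_n `](- n%:R : R), +oo[%classic = setT.
Proof.
rewrite -subTset => z _; exists (Num.trunc `|z|).+1 => //=.
rewrite in_itv/= andbT ltrNl (le_lt_trans (ler_norm _))// normrN.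
exact: truncnS_gt.
Qed.

Lemma setI_closed_quadrants : setI_closed quadrants.
Proof.
move=> _ _ [a _ <-] [b _ <-]; exists (Num.max a.1 b.1, Num.max a.2 b.2) => //.
by apply/seteqP; split => z /=; rewrite !in_itv/= !andbT !gt_max;
  [move=> [/andP[? ?] /andP[]]|move=> [[-> ->] [-> ->]]].
Qed.

Lemma bigcup_quadrants :
  \bigcup_n (`](- n%:R : R), +oo[ `*` `](- n%:R : R), +oo[)%classic = setT.
Proof.
rewrite -subTset => -[z1 z2] _.
have [n _ zn] : (\bigcup_n `](- n%:R : R), +oo[%classic) z1 by rewrite bigcup_rays.
have [m _ zm] : (\bigcup_n `](- n%:R : R), +oo[%classic) z2 by rewrite bigcup_rays.
exists (maxn n m) => //; move: zn zm; rewrite /= !in_itv/= !andbT => zn zm; split.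
  by rewrite (le_lt_trans _ zn)// lerN2 ler_nat leq_maxl.
by rewrite (le_lt_trans _ zm)// lerN2 ler_nat leq_maxr.
Qed.

(** Half-planes bounded by a vertical or horizontal line are countable unions of quadrants, so both
    coordinates are measurable for the sigma-algebra that quadrants generate, and with them all
    measurable rectangles. *)
Lemma measurable_quadrants : @measurable _ (plane R) = <<s quadrants >>.
Proof.
pose T := g_sigma_algebraType quadrants.
have mfst : measurable_fun setT (fst : T -> measurableTypeR R).
  apply: (measurability _ measurable_rays) => _ [_ [a _ <-] <-].
  rewrite setTI (_ : _ @^-1` _ =
      \bigcup_n (`]a, +oo[ `*` `](- n%:R : R), +oo[)%classic).
    by apply: bigcupT_measurable => n; apply: sub_sigma_algebra; exists (a, - n%:R).
  rewrite -setX_bigcupr bigcup_rays; apply/seteqP.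
  by split => z /=; [move=> ?; split|case].
have msnd : measurable_fun setT (snd : T -> measurableTypeR R).
  apply: (measurability _ measurable_rays) => _ [_ [a _ <-] <-].
  rewrite setTI (_ : _ @^-1` _ =
      \bigcup_n (`](- n%:R : R), +oo[ `*` `]a, +oo[)%classic).
    by apply: bigcupT_measurable => n; apply: sub_sigma_algebra; exists (- n%:R, a).
  rewrite -setX_bigcupl bigcup_rays; apply/seteqP.
  by split => z /=; [move=> ?; split|case].
apply/seteqP; split; last first.
  apply: smallest_sub; first exact: sigma_algebra_measurable.
  by move=> _ [a _ <-]; exact: measurableX.
rewrite measurable_prod_measurableType.
apply: smallest_sub; first exact: smallest_sigma_algebra.
move=> _ [A mA [B mB <-]].
rewrite (_ : A `*` B = (setT `&` fst @^-1` A) `&` (setT `&` snd @^-1` B)).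
  by apply: (@measurableI _ T); [exact: mfst|exact: msnd].
by rewrite !setTI.
Qed.

End rays.
Arguments rays {R}.
Arguments quadrants {R}.

(* T and V stand for one space, with its sigma-algebra and its norm. *)
Definition has_C_density (R : realType) (V : normedModType R) d (T : measurableType d)
    (psi : V -> T) (k : nat) (la : {measure set T -> \bar R}) (Q : set (set T))
    (nu : set T -> \bar R) : Prop :=
  exists Gp Gn : T -> R,
  [/\ measurable_fun setT Gp /\ measurable_fun setT Gn,
      forall z, 0 <= Gp z /\ 0 <= Gn z,
      of_class_C k setT ((Gp \- Gn) \o psi),
      forall A, Q A -> la.-integrable A (EFin \o Gp) /\ la.-integrable A (EFin \o Gn) &
      forall E, measurable E ->
        (nu E + \int[la]_(z in E) (Gn z)%:E = \int[la]_(z in E) (Gp z)%:E)%E].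

Section density_of_potential.
Context d (T : measurableType d) (R : realType).
Variables (P : {finite_measure set T -> \bar R}) (D : set T).
Hypothesis mD : measurable D.

Section kernel.
Context dV (V : normedModType R) (S : measurableType dV) (psi : V -> S).
Variable la : {sigma_finite_measure set S -> \bar R}.
Variables (X : {mfun T >-> S}) (kap : T * S -> R) (W W' : T -> R).
Hypotheses (mkap : measurable_fun setT kap) (kap0 : forall p, 0 <= kap p).
Hypotheses (bW : bounded_mfun D W) (W0 : forall t, D t -> 0 <= W t).
Hypothesis bW' : bounded_mfun D W'.
Variables (Q : set (set S)) (g : nat -> set S).
Hypotheses (QE : measurable = <<s Q >>) (QI : setI_closed Q) (Qg : forall i, Q (g i))
  (g_cover : \bigcup_k g k = setT).

(** Only [kernel_density] and the finiteness of the two parts on [Q] are behind this: over [A] in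
    [Q], either part integrates to the mean of a bounded function, [J A] times the positive or
    negative part of [W']. *)
Lemma has_C_density_kernel k (J : set S -> T -> R) :
  (forall z, bounded_mfun D (fun t => kap (t, z))) ->
  (forall A, Q A -> bounded_mfun D (J A)) ->
  (forall A t, Q A -> D t -> (\int[la]_(z in A) (kap (t, z))%:E = (J A t)%:E)%E) ->
  (forall A, Q A -> expect P D (fun t => \1_A (X t) * W t) =
                    expect P D (fun t => J A t * W' t)) ->
  of_class_C k setT (fun z => expect P D (fun t => kap (t, psi z) * W' t)) ->
  has_C_density psi k la Q (fun E => \int[P]_(t in D) (\1_E (X t) * W t)%:E)%E.
Proof.
move=> bkap bJ JE WW' CG.
pose Wn t := Num.max (- W' t) 0; pose Wp t := Num.max (W' t) 0.
have bmax (U : T -> R) : bounded_mfun D U -> bounded_mfun D (fun t => Num.max (U t) 0).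
  move=> [mU [M MU]]; split; first by apply: measurable_maxr => //; exact: measurable_cst.
  exists M => t Dt; rewrite (le_trans _ (MU _ Dt))// maxEle; case: ifP => // _.
  by rewrite normr0.
have bWn : bounded_mfun D Wn by apply: bmax; exact: bounded_mfunN.
have bWp : bounded_mfun D Wp by exact: bmax.
have Wn0 t : D t -> 0 <= Wn t by move=> _; rewrite le_max lexx orbT.
have Wp0 t : D t -> 0 <= Wp t by move=> _; rewrite le_max lexx orbT.
have bk U z : bounded_mfun D U -> bounded_mfun D (fun t => kap (t, z) * U t).
  by move=> bU; exact: bounded_mfunM.
pose G U z := expect P D (fun t => kap (t, z) * U t).
have GE U z : bounded_mfun D U -> smear P D kap U z = (G U z)%:E.
  by move=> bU; rewrite smear_expect//; exact: bk.
have mG U : bounded_mfun D U -> (forall t, D t -> 0 <= U t) -> measurable_fun setT (G U).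
  move=> bU U0; have [mU _] := bU; apply/measurable_EFinP.
  have := measurable_smear P mD mkap kap0 mU U0.
  by apply: eq_measurable_fun => z _; exact: GE.
have G0 U z : (forall t, D t -> 0 <= U t) -> 0 <= G U z.
  by move=> U0; apply: Rintegral_ge0 => t Dt; rewrite mulr_ge0// U0.
have mQ A : Q A -> measurable A by rewrite QE; exact: sub_sigma_algebra.
have iG U A : bounded_mfun D U -> (forall t, D t -> 0 <= U t) -> Q A ->
    la.-integrable A (EFin \o G U).
  move=> bU U0 QA; apply/integrableP; split.
    by apply/measurable_EFinP; apply: measurable_funTS; exact: mG.
  rewrite (_ : (\int[la]_(z in A) _)%E = \int[la]_(z in A) smear P D kap U z)%E; last first.
    by apply: eq_integral => z _; rewrite GE//= ger0_norm ?G0.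
  rewrite integral_smear//; [|exact: mQ|by case: bU].
  have bJU : bounded_mfun D (fun t => U t * J A t) by apply: bounded_mfunM => //; exact: bJ.
  have /integrableP[_] := bounded_mfun_integrable P mD bJU.
  apply: le_lt_trans; apply: ge0_le_integral => //.
  - move=> t Dt; apply: mule_ge0; first by rewrite lee_fin U0.
    by apply: integral_ge0 => z _; rewrite lee_fin.
  - apply: (eq_measurable_fun (fun t => (U t * J A t)%:E)) => [t /set_mem Dt|].
      by rewrite JE.
    by apply/measurable_EFinP; case: bJU.
  - by apply: measurableT_comp => //; apply/measurable_EFinP; case: bJU.
  - by move=> t Dt; rewrite JE//= lee_fin ler_norm.
exists (G Wp), (G Wn); split.
- by split; exact: mG.
- by move=> z; split; exact: G0.
- rewrite (_ : _ \o _ = fun z => expect P D (fun t => kap (t, psi z) * W' t))//.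
  apply/funext => z /=; rewrite -(expectB P mD); [|exact: bk..].
  apply: eq_expect => t _ /=; rewrite -mulrBr; congr (_ * _).
  by rewrite /Wp /Wn !maxEle; case: ltgtP => [w|w|w]; case: ltgtP => w'; lra.
- by move=> A QA; split; exact: iG.
- move=> E mE.
  have GI U : bounded_mfun D U ->
      (\int[la]_(z in E) (G U z)%:E = \int[la]_(z in E) smear P D kap U z)%E.
    by move=> bU; apply: eq_integral => z _; rewrite GE.
  rewrite !GI//.
  exact: (kernel_density mD mkap kap0 bW W0 QE QI Qg g_cover bW' bJ JE WW' mE).
Qed.

End kernel.

Section plane.
Variables (X : {mfun T >-> plane R}) (W W' : T -> R).
Let X1 t := (X t).1.
Let X2 t := (X t).2.
Hypotheses (bX1 : bounded_mfun D X1) (bX2 : bounded_mfun D X2).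
Hypotheses (bW : bounded_mfun D W) (bW' : bounded_mfun D W').
Local Notation pot := (potential P D X1 X2).

(** With the second coordinate of [z] frozen, the second truncated power is absorbed in the weight
    and the statement is [expect_pospow_derive] in the first coordinate. *)
Lemma potential_derive1 m k q q' c (U U' : T -> R) :
  bounded_mfun D U -> bounded_mfun D U' ->
  (forall z, pot m.+1 q U z = c * pot k.+1 q' U' z) ->
  forall z, pot m q U z = (k.+1%:R / m.+1%:R * c) * pot k q' U' z.
Proof.
move=> bU bU' UU' [s r].
pose Z t := pospow q (X2 t - r) * U t; pose Z' t := c * (pospow q' (X2 t - r) * U' t).
have bq j : bounded_mfun D (fun t => pospow j (X2 t - r)).
  by apply: (bounded_mfun_pospow j); apply: bounded_mfunB => //; exact: bounded_mfun_cst.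
have bZ : bounded_mfun D Z by exact: bounded_mfunM.
have bZ' : bounded_mfun D Z'.
  by apply: (bounded_mfunM (bounded_mfun_cst _ _)); exact: bounded_mfunM.
have EZ j s' : expect P D (fun t => pospow j (X1 t - s') * Z t) = pot j q U (s', r).
  by apply: eq_expect => t _; rewrite /Z mulrA.
have EZ' j s' : expect P D (fun t => pospow j (X1 t - s') * Z' t) =
    c * pot j q' U' (s', r).
  rewrite /potential -(expectZ P mD); last exact: bounded_mfun_potential.
  by apply: eq_expect => t _; rewrite /Z' mulrCA !mulrA.
have HZ s' : expect P D (fun t => pospow m.+1 (X1 t - s') * Z t) =
    expect P D (fun t => pospow k.+1 (X1 t - s') * Z' t) by rewrite EZ EZ' UU'.
have := expect_pospow_derive mD bX1 bZ bZ' HZ s; rewrite EZ EZ' => H.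
apply: (mulfI (_ : m.+1%:R != 0 :> R)); first by rewrite pnatr_eq0.
by rewrite H -!mulrA [RHS]mulrCA mulVKf// pnatr_eq0.
Qed.


Lemma potential_derive2 m k q q' c (U U' : T -> R) :
  bounded_mfun D U -> bounded_mfun D U' ->
  (forall z, pot q m.+1 U z = c * pot q' k.+1 U' z) ->
  forall z, pot q m U z = (k.+1%:R / m.+1%:R * c) * pot q' k U' z.
Proof.
move=> bU bU' UU' [s r].
pose Z t := pospow q (X1 t - s) * U t; pose Z' t := c * (pospow q' (X1 t - s) * U' t).
have bq j : bounded_mfun D (fun t => pospow j (X1 t - s)).
  by apply: (bounded_mfun_pospow j); apply: bounded_mfunB => //; exact: bounded_mfun_cst.
have bZ : bounded_mfun D Z by exact: bounded_mfunM.
have bZ' : bounded_mfun D Z'.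
  by apply: (bounded_mfunM (bounded_mfun_cst _ _)); exact: bounded_mfunM.
have EZ j r' : expect P D (fun t => pospow j (X2 t - r') * Z t) = pot q j U (s, r').
  by apply: eq_expect => t _; rewrite /Z mulrCA mulrA.
have EZ' j r' : expect P D (fun t => pospow j (X2 t - r') * Z' t) =
    c * pot q' j U' (s, r').
  rewrite /potential -(expectZ P mD); last exact: bounded_mfun_potential.
  by apply: eq_expect => t _; rewrite /Z' mulrCA; congr (_ * _); rewrite mulrCA mulrA.
have HZ s' : expect P D (fun t => pospow m.+1 (X2 t - s') * Z t) =
    expect P D (fun t => pospow k.+1 (X2 t - s') * Z' t) by rewrite EZ EZ' UU'.
have := expect_pospow_derive mD bX2 bZ bZ' HZ r; rewrite EZ EZ' => H.
apply: (mulfI (_ : m.+1%:R != 0 :> R)); first by rewrite pnatr_eq0.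
by rewrite H -!mulrA [RHS]mulrCA mulVKf// pnatr_eq0.
Qed.

(** Two differentiations in each variable lower 2 to 0 and k+4 to k+2. The left side is then the
    weighted mass of a quadrant, and on the right exponent k+2 is, up to a constant, the integral
    over that quadrant of the kernel with exponent k+1, whose potential is of class C^k. *)
Lemma has_C_density_plane k : (forall t, D t -> 0 <= W t) ->
  (forall z, pot 2 2 W z = pot k.+4 k.+4 W' z) ->
  has_C_density (idfun : R * R -> plane R) k lebesgue_plane quadrants
    (fun E => \int[P]_(t in D) (\1_E (X t) * W t)%:E)%E.
Proof.
move=> W0 WW'.
have H0 z : pot 2 2 W z = 1 * pot k.+4 k.+4 W' z by rewrite mul1r.
have := potential_derive1 bW bW' H0 => /(potential_derive1 bW bW')
  /(potential_derive2 bW bW') /(potential_derive2 bW bW').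
set C := (X in forall z, _ = X * _) => HC.
pose kap (p : T * plane R) := pospow2 X1 X2 k.+1 k.+1 p.2 p.1.
pose W'' t := C * k.+2%:R ^+ 2 * W' t.
have bW'' : bounded_mfun D W'' by apply: (bounded_mfunM (bounded_mfun_cst _ _)).
have mX1 : measurable_fun setT X1 by apply: (measurableT_comp measurable_fst).
have mX2 : measurable_fun setT X2 by apply: (measurableT_comp measurable_snd).
have mkap : measurable_fun setT kap.
  apply: measurable_funM; apply: (measurableT_comp (measurable_pospow k.+1)).
    apply: measurable_funB; first exact: (measurableT_comp mX1 measurable_fst).
    exact: (measurableT_comp measurable_fst measurable_snd).
  apply: measurable_funB; first exact: (measurableT_comp mX2 measurable_fst).
  exact: (measurableT_comp measurable_snd measurable_snd).
have kap0 p : 0 <= kap p by rewrite mulr_ge0 ?pospow_ge0.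
pose J (A : set (plane R)) t := fine (\int[lebesgue_plane]_(z in A) (kap (t, z))%:E)%E.
have JE a t : (\int[lebesgue_plane]_(z in `]a.1, +oo[ `*` `]a.2, +oo[) (kap (t, z))%:E =
    (pospow2 X1 X2 k.+2 k.+2 a t / k.+2%:R ^+ 2)%:E)%E.
  refine (eq_trans (integral_pospow2 k.+1 a.1 a.2 (X1 t) (X2 t)) _).
  congr (_%:E); rewrite /pospow2.
  by move: (k.+2%:R : R) (pnatr_eq0 R k.+2) => x /negbT x0; field.
have Qg n : quadrants (`](- n%:R : R), +oo[ `*` `](- n%:R : R), +oo[)%classic.
  by exists (- n%:R, - n%:R).
apply: (has_C_density_kernel mkap kap0 bW W0 bW'' (@measurable_quadrants R)
  (@setI_closed_quadrants R) Qg (@bigcup_quadrants R) (J := J)).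
- by move=> z; exact: bounded_mfun_pospow2.
- move=> _ [a _ <-]; apply: (eq_bounded_mfun (f := fun t =>
    pospow2 X1 X2 k.+2 k.+2 a t * (k.+2%:R ^+ 2)^-1)).
    by move=> t _; rewrite /J JE.
  by apply: (bounded_mfunM _ (bounded_mfun_cst _ _)); exact: bounded_mfun_pospow2.
- by move=> _ t [a _ <-] _; rewrite /J JE.
- move=> _ [a _ <-]; transitivity (pot 0 0 W a).
    apply: eq_expect => t _; rewrite /pospow2 /pospow !expr0 !subr_gt0 indicE in_setX.
    rewrite !mem_setE !in_itv/= !andbT.
    by case: ifP => _; case: ifP => _; rewrite ?mul1r ?mul0r.
  rewrite HC -(expectZ P mD); last exact: bounded_mfun_potential.
  apply: eq_expect => t _; rewrite /J JE /W'' /=.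
  by move: (k.+2%:R : R) (pnatr_eq0 R k.+2) => x /negbT x0; field.
- exact: of_class_C_potential.
Qed.

End plane.

Section line.
Variables (X : {mfun T >-> measurableTypeR R}) (W W' : T -> R).
Hypotheses (bX : bounded_mfun D X).
Hypotheses (bW : bounded_mfun D W) (bW' : bounded_mfun D W').

Lemma has_C_density_line k : (forall t, D t -> 0 <= W t) ->
  (forall s, expect P D (fun t => pospow 2 (X t - s) * W t) =
             expect P D (fun t => pospow k.+4 (X t - s) * W' t)) ->
  has_C_density (idfun : R -> measurableTypeR R) k lebesgue_measure (@rays R)
    (fun E => \int[P]_(t in D) (\1_E (X t) * W t)%:E)%E.
Proof.
move=> W0 WW'.
have HC s : expect P D (fun t => pospow 0 (X t - s) * W t) =
    expect P D (fun t => pospow k.+2 (X t - s) * (k.+4%:R * k.+3%:R / 2 * W' t)).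
  have H1 := expect_pospow_derive mD bX bW bW' WW'.
  have bc c U : bounded_mfun D U -> bounded_mfun D (fun t => c * U t).
    by apply: bounded_mfunM; exact: bounded_mfun_cst.
  have bp j s' U : bounded_mfun D U -> bounded_mfun D (fun t => pospow j (X t - s') * U t).
    move=> bU; apply: bounded_mfunM => //; apply: (bounded_mfun_pospow j).
    by apply: bounded_mfunB => //; exact: bounded_mfun_cst.
  have H2 s' : expect P D (fun t => pospow 1 (X t - s') * W t) =
      expect P D (fun t => pospow k.+3 (X t - s') * (k.+4%:R / 2 * W' t)).
    apply: (mulfI (_ : 2 != 0 :> R)); first by rewrite pnatr_eq0.
    rewrite H1 -!(expectZ P mD); [|by apply: bp; exact: bc|exact: bp].
    by apply: eq_expect => t _; field.
  have := expect_pospow_derive mD bX bW (bc _ _ _ bW') H2 s; rewrite mul1r => ->.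
  rewrite -(expectZ P mD); last by apply: bp; exact: bc.
  by apply: eq_expect => t _; field.
pose kap (p : T * measurableTypeR R) := pospow k.+1 (X p.1 - p.2).
pose W1 t := k.+4%:R * k.+3%:R / 2 * W' t.
pose W'' t := k.+2%:R * W1 t.
have bW1 : bounded_mfun D W1 by apply: (bounded_mfunM (bounded_mfun_cst _ _)).
have bW'' : bounded_mfun D W'' by apply: (bounded_mfunM (bounded_mfun_cst _ _)).
have mX : measurable_fun setT X by [].
have mkap : measurable_fun setT kap.
  apply: (measurableT_comp (measurable_pospow k.+1)).
  apply: measurable_funB; first exact: (measurableT_comp mX measurable_fst).
  exact: measurable_snd.
have kap0 p : 0 <= kap p by exact: pospow_ge0.
have bk j s : bounded_mfun D (fun t => pospow j (X t - s)).
  by apply: (bounded_mfun_pospow j); apply: bounded_mfunB => //; exact: bounded_mfun_cst.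
pose J (A : set (measurableTypeR R)) t :=
  fine (\int[lebesgue_measure]_(z in A) (kap (t, z))%:E)%E.
have JE (a : R) t : (\int[lebesgue_measure]_(z in `]a, +oo[) (kap (t, z))%:E =
    (pospow k.+2 (X t - a) / k.+2%:R)%:E)%E.
  exact: (integral_pospow k.+1 a (X t)).
have Qg n : rays `](- n%:R : R), +oo[%classic by exists (- n%:R).
apply: (has_C_density_kernel mkap kap0 bW W0 bW'' (@measurable_rays R)
  (@setI_closed_rays R) Qg (@bigcup_rays R) (J := J)).
- by move=> z; exact: bk.
- move=> _ [a _ <-]; apply: (eq_bounded_mfun (f := fun t =>
    pospow k.+2 (X t - a) * k.+2%:R^-1)).
    by move=> t _; rewrite /J JE.
  by apply: (bounded_mfunM _ (bounded_mfun_cst _ _)).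
- by move=> _ t [a _ <-] _; rewrite /J JE.
- move=> _ [a _ <-].
  transitivity (expect P D (fun t => pospow 0 (X t - a) * W t)).
    apply: eq_expect => t _; rewrite /pospow expr0 subr_gt0 indicE.
    rewrite !mem_setE !in_itv/= !andbT.
    by case: ifP => _; rewrite ?mul1r ?mul0r.
  rewrite HC; apply: eq_expect => t _; rewrite /J JE /W'' /W1 /=.
  by move: (k.+2%:R : R) (pnatr_eq0 R k.+2) => x /negbT x0; field.
(* The second variable is the constant 1: on the axis its factor (1 - 0)_+^(k+1) is 1, and what
   remains is the potential of the line. *)
- have := of_class_C_axis (of_class_C_potential P mD bX (bounded_mfun_cst D 1) bW''
    (leqnn k.+1) (leqnn k.+1)).
  rewrite (_ : (fun s : R => _) = fun z => expect P D (fun t => kap (t, idfun z) * W'' t))//.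
  apply/funext => s; apply: eq_expect => t _.
  by rewrite /pospow2 /= [X in _ * X * _]/pospow subr0 ltr01 expr1n mulr1.
Qed.

End line.
End density_of_potential.

(** * Measure preserving maps of the sphere *)

Section measure_preserving.
Local Open Scope ereal_scope.
Context d (T : measurableType d) (R : realType).
Implicit Types (mu : {measure set T -> \bar R}) (f g : T -> T).

Definition measure_preserving (mu : set T -> \bar R) f :=
  measurable_fun setT f /\ forall A, measurable A -> mu (f @^-1` A) = mu A.

Lemma measure_preserving_comp mu f g :
  measure_preserving mu f -> measure_preserving mu g -> measure_preserving mu (f \o g).
Proof.
move=> [mf pf] [mg pg]; split; first exact: measurableT_comp.
move=> A mA; rewrite comp_preimage pg ?pf//.
by rewrite -[X in measurable X]setTI; exact: mf.
Qed.

Lemma integral_measure_preserving mu f (D : set T) (h : T -> R) :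
  measure_preserving mu f -> measurable D -> f @^-1` D = D ->
  measurable_fun D h ->
  \int[mu]_(t in D) (h (f t))%:E = \int[mu]_(t in D) (h t)%:E.
Proof.
move=> [mf pf] mD fD mh.
pose m : {measure set T -> \bar R} :=
  measure_function_pushforward__canonical__measure_function_Measure mu mf.
have ge0 (k : T -> \bar R) : measurable_fun D k -> (forall t, 0 <= k t) ->
    \int[mu]_(t in D) k (f t) = \int[mu]_(t in D) k t.
  move=> mk k0; transitivity (\int[m]_(t in D) k t).
    by rewrite (ge0_integral_pushforward mf)// fD.
  by apply: eq_measure_integral => A mA _; exact: pf.
have mEh : measurable_fun D (EFin \o h) by exact/measurable_EFinP.
rewrite [LHS]integralE [RHS]integralE; congr (_ - _).
  rewrite -(ge0 (fun t => ((EFin \o h)^\+ t)%E)) => [||t]; last by rewrite funeposE le_max lexx orbT.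
    by apply: eq_integral => t _; rewrite !funeposE.
  exact: measurable_funepos.
rewrite -(ge0 (fun t => ((EFin \o h)^\- t)%E)) => [||t]; last by rewrite funenegE le_max lexx orbT.
  by apply: eq_integral => t _; rewrite !funenegE.
exact: measurable_funeneg.
Qed.

End measure_preserving.

Section product_measure_preserving.
Local Open Scope ereal_scope.
Context d1 d2 (T1 : measurableType d1) (T2 : measurableType d2) (R : realType).
Variables (m1 : {sigma_finite_measure set T1 -> \bar R}).
Variables (m2 : {sigma_finite_measure set T2 -> \bar R}).

Lemma product_measure12 A : measurable A -> (m1 \x m2) A = (m1 \x^ m2) A.
Proof.
move=> mA; apply: product_measure_unique => // B C mB mC.
exact: product_measure2E.
Qed.

Lemma measure_preserving_fiber2 (f : T1 -> T2 -> T2) :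
  measurable_fun setT (fun p : T1 * T2 => (p.1, f p.1 p.2)) ->
  (forall x, measure_preserving m2 (f x)) ->
  measure_preserving (m1 \x m2) (fun p => (p.1, f p.1 p.2)).
Proof.
move=> mf pf; split => // A mA; apply: eq_integral => x _ /=.
transitivity (m2 (f x @^-1` xsection A x)).
  by congr (m2 _); apply/seteqP; split => y; rewrite /xsection /= !inE.
by have [_] := pf x; apply; exact: measurable_xsection.
Qed.

Lemma measure_preserving_fiber1 (f : T2 -> T1 -> T1) :
  measurable_fun setT (fun p : T1 * T2 => (f p.2 p.1, p.2)) ->
  (forall y, measure_preserving m1 (f y)) ->
  measure_preserving (m1 \x m2) (fun p => (f p.2 p.1, p.2)).
Proof.
move=> mf pf; split => // A mA.
rewrite !product_measure12//; last first.
  by rewrite -[X in measurable X]setTI; exact: mf.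
apply: eq_integral => y _ /=.
transitivity (m1 (f y @^-1` ysection A y)).
  by congr (m1 _); apply/seteqP; split => x; rewrite /ysection /= !inE.
by have [_] := pf y; apply; exact: measurable_ysection.
Qed.

End product_measure_preserving.

Section translation.
Variable R : realType.

Lemma measure_preserving_translation (a : R) :
  measure_preserving (@lebesgue_measure R) (fun x => x + a).
Proof.
have mt : measurable_fun setT ((fun x => x + a) : measurableTypeR R -> measurableTypeR R).
  by apply: measurable_funD => //; exact: measurable_cst.
split => // A mA.
pose m : {measure set (measurableTypeR R) -> \bar R} :=
  measure_function_pushforward__canonical__measure_function_Measure
    (@lebesgue_measure R) mt.
rewrite -[LHS]/(m A); symmetry; apply: lebesgue_measure_unique => // X [[u v] _ <-].
rewrite /m /= /pushforward (_ : _ @^-1` _ = `]u - a, v - a]%classic); last first.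
  by apply/seteqP; split => z /=; rewrite !in_itv/= ltrBlDr lerBrDr.
rewrite /= !lebesgue_measure_itv/= !lte_fin ltrD2r -!EFinB.
by rewrite (_ : v - a - (u - a) = v - u)//; ring.
Qed.

Lemma measure_preserving_shear1 (c : R) :
  measure_preserving (@lebesgue_plane R) (fun z => (z.1 + c * z.2, z.2)).
Proof.
apply: (@measure_preserving_fiber1 _ _ (measurableTypeR R) (measurableTypeR R) R
    lebesgue_measure lebesgue_measure (fun y x => x + c * y)).
  apply/measurable_fun_pairP; split; last exact: measurable_snd.
  apply: measurable_funD; first exact: measurable_fst.
  by apply: measurable_funM; [exact: measurable_cst|exact: measurable_snd].
by move=> y; exact: measure_preserving_translation.
Qed.

Lemma measure_preserving_shear2 (c : R) :
  measure_preserving (@lebesgue_plane R) (fun z => (z.1, z.2 + c * z.1)).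
Proof.
apply: (@measure_preserving_fiber2 _ _ (measurableTypeR R) (measurableTypeR R) R
    lebesgue_measure lebesgue_measure (fun x y => y + c * x)).
  apply/measurable_fun_pairP; split; first exact: measurable_fst.
  apply: measurable_funD; first exact: measurable_snd.
  by apply: measurable_funM; [exact: measurable_cst|exact: measurable_fst].
by move=> x; exact: measure_preserving_translation.
Qed.

Lemma measure_preserving_plane_translation (a b : R) :
  measure_preserving (@lebesgue_plane R) (fun z => (z.1 + a, z.2 + b)).
Proof.
apply: (@measure_preserving_comp _ _ _ lebesgue_plane
  (fun z : plane R => (z.1 + a, z.2)) (fun z : plane R => (z.1, z.2 + b))).
  apply: (@measure_preserving_fiber1 _ _ (measurableTypeR R) (measurableTypeR R) R
    lebesgue_measure lebesgue_measure (fun y x => x + a)).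
    apply/measurable_fun_pairP; split; last exact: measurable_snd.
    by apply: measurable_funD; [exact: measurable_fst|exact: measurable_cst].
  by move=> y; exact: measure_preserving_translation.
apply: (@measure_preserving_fiber2 _ _ (measurableTypeR R) (measurableTypeR R) R
    lebesgue_measure lebesgue_measure (fun x y => y + b)).
  apply/measurable_fun_pairP; split; first exact: measurable_fst.
  by apply: measurable_funD; [exact: measurable_snd|exact: measurable_cst].
by move=> y; exact: measure_preserving_translation.
Qed.

(* A rotation is a product of three shears. *)
Lemma measure_preserving_rotation (t : R) : sin t != 0 ->
  measure_preserving (@lebesgue_plane R)
    (fun z => (cos t * z.1 - sin t * z.2, sin t * z.1 + cos t * z.2)).
Proof.
move=> s0; pose c := (cos t - 1) / sin t.
have cs : cos t ^+ 2 + sin t ^+ 2 = 1 by exact: cos2Dsin2.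
rewrite (_ : (fun z => _) = (fun z : plane R => (z.1 + c * z.2, z.2)) \o
  ((fun z : plane R => (z.1, z.2 + sin t * z.1)) \o
   (fun z : plane R => (z.1 + c * z.2, z.2)))).
  apply: measure_preserving_comp; first exact: measure_preserving_shear1.
  apply: measure_preserving_comp; [exact: measure_preserving_shear2|].
  exact: measure_preserving_shear1.
have cE : c * sin t = cos t - 1 by rewrite /c mulfVK.
have cE2 : c * (cos t + 1) = - sin t.
  apply: (mulIf s0); rewrite mulrAC cE mulNr -expr2.
  by rewrite mulrC; lra.
apply/funext => -[x y] /=; congr pair.
  rewrite mulrDr [c * (_ * (_ + _))]mulrA cE mulrDr.
  have -> : x + c * y + (c * y + ((cos t - 1) * x + (cos t - 1) * (c * y))) =
    cos t * x + c * (cos t + 1) * y by ring.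
  by rewrite cE2; ring.
rewrite mulrDr mulrA [sin t * c]mulrC cE; ring.
Qed.

End translation.

Section tuple_measure_preserving.
Context d (T : measurableType d) (R : realType).
Variable m : {sigma_finite_measure set T -> \bar R}.

Definition tset n (t : n.-tuple T) (i : 'I_n) (z : T) : n.-tuple T :=
  [tuple if j == i then z else tnth t j | j < n].

Lemma measurable_tuple_cons n :
  measurable_fun setT (fun p : T * n.-tuple T => [tuple of p.1 :: p.2]).
Proof. exact: measurable_cons. Qed.

(** By induction on [n], splitting off the first coordinate. If [i] lies in the tail, [g] acts on
    the tail with the head as a parameter; if [i] is the head, it acts on the head with the tail as
    a parameter. Either way Tonelli reduces to fibers. *)
Lemma measure_preserving_tuple n (i : 'I_n) (g : n.-tuple T -> n.-tuple T) :
  measurable_fun setT g ->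
  (forall t j, j != i -> tnth (g t) j = tnth t j) ->
  (forall t, measure_preserving m (fun z => tnth (g (tset t i z)) i)) ->
  measure_preserving (tuple_measure m n) g.
Proof.
elim: n i g => [[]//|n IH] i g mg gj gi; split => // A mA.
rewrite /= /cons_measure /pushforward.
have mA' : measurable ((fun p : T * n.-tuple T => [tuple of p.1 :: p.2]) @^-1` A).
  by rewrite -[X in measurable X]setTI; exact: measurable_tuple_cons.
have tcons0 x (t : n.-tuple T) : tnth [tuple of x :: t] ord0 = x by [].
have tconsS x (t : n.-tuple T) j : tnth [tuple of x :: t] (lift ord0 j) = tnth t j.
  by rewrite (tnth_nth x) [RHS](tnth_nth x).
have consP (t : n.+1.-tuple T) : t = [tuple of tnth t ord0 :: [tuple tnth t (lift ord0 j) | j < n]].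
  apply: eq_from_tnth => j; have [j' ->|->] := unliftP ord0 j => //.
  by rewrite tconsS tnth_mktuple.
have [i' ii'|i0] := unliftP ord0 i.
  pose f x (t : n.-tuple T) := [tuple tnth (g [tuple of x :: t]) (lift ord0 j) | j < n].
  have gE x (t : n.-tuple T) : g [tuple of x :: t] = [tuple of x :: f x t].
    apply: eq_from_tnth => j; have [j' ->|->] := unliftP ord0 j.
      by rewrite !tconsS tnth_mktuple.
    by rewrite gj ?ii'.
  have mf : measurable_fun setT (fun p : T * n.-tuple T => (p.1, f p.1 p.2)).
    apply/measurable_fun_pairP; split; first exact: measurable_fst.
    apply/measurable_fun_tnthP => j.
    rewrite (_ : _ \o _ = fun p : T * n.-tuple T =>
        tnth (g [tuple of p.1 :: p.2]) (lift ord0 j)); last first.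
      by apply/funext => p /=; rewrite tnth_mktuple.
    apply: (measurableT_comp (measurable_tnth (lift ord0 j))).
    exact: (measurableT_comp mg (@measurable_tuple_cons n)).
  rewrite (_ : _ @^-1` (g @^-1` A) = (fun p : T * n.-tuple T => (p.1, f p.1 p.2)) @^-1`
      ((fun p : T * n.-tuple T => [tuple of p.1 :: p.2]) @^-1` A)).
    suff pf x : measure_preserving (tuple_measure m n) (f x).
      by have [_] := measure_preserving_fiber2 m mf pf; apply.
    apply: (IH i').
    - apply/measurable_fun_tnthP => j.
      rewrite (_ : _ \o _ = fun t : n.-tuple T => tnth (g [tuple of x :: t]) (lift ord0 j)); last first.
        by apply/funext => p /=; rewrite tnth_mktuple.
      apply: (measurableT_comp (measurable_tnth (lift ord0 j))).
      apply: (measurableT_comp mg).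
      exact: (measurableT_comp (@measurable_tuple_cons n) (measurable_pair1 x)).
    - move=> t j ji; rewrite tnth_mktuple gj ?tconsS// ii'.
      by rewrite (inj_eq lift_inj).
    - move=> t; have := gi [tuple of x :: t].
      suff -> : (fun z : T => tnth (g (tset [tuple of x :: t] i z)) i) =
        (fun z : T => tnth (f x (tset t i' z)) i') by [].
      apply/funext => z; rewrite tnth_mktuple -ii'; congr (tnth (g _) i).
      apply: eq_from_tnth => j; rewrite tnth_mktuple.
      have [j' ->|->] := unliftP ord0 j; last by rewrite ii'.
      by rewrite !tconsS tnth_mktuple ii' (inj_eq lift_inj).
  by apply/funext => -[x t]; rewrite /preimage/= -gE.
pose f (t : n.-tuple T) x := tnth (g [tuple of x :: t]) ord0.
have gE x (t : n.-tuple T) : g [tuple of x :: t] = [tuple of f t x :: t].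
  apply: eq_from_tnth => j; have [j' ->|->] := unliftP ord0 j => //.
  by rewrite gj ?tconsS// i0.
have mf : measurable_fun setT (fun p : T * n.-tuple T => (f p.2 p.1, p.2)).
  apply/measurable_fun_pairP; split; last exact: measurable_snd.
  apply: (measurableT_comp (measurable_tnth ord0)).
  exact: (measurableT_comp mg (@measurable_tuple_cons n)).
rewrite (_ : _ @^-1` (g @^-1` A) = (fun p : T * n.-tuple T => (f p.2 p.1, p.2)) @^-1`
    ((fun p : T * n.-tuple T => [tuple of p.1 :: p.2]) @^-1` A)).
  suff pf t : measure_preserving m (f t).
    by have [_] := measure_preserving_fiber1 (tuple_measure m n) mf pf; apply.
  have := gi [tuple of point :: t].
  suff -> : (fun z : T => tnth (g (tset [tuple of point :: t] i z)) i) = f t by [].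
  apply/funext => z; rewrite /f i0; congr (tnth (g _) _).
  apply: eq_from_tnth => j; rewrite tnth_mktuple.
  have [j' ->|->] := unliftP ord0 j; last by rewrite eqxx.
  by rewrite !tconsS.
by apply/funext => -[x t]; rewrite /preimage/= -gE.
Qed.

End tuple_measure_preserving.

Section linear_action.
Variables (R : realType) (n : nat).
Local Notation C := R[i].
Implicit Types (M N B : 'M[C]_n) (x y u v : 'cV[C]_n) (t : n.-tuple (plane R)).

Definition to_planes x : n.-tuple (plane R) := [tuple to_plane (x i 0) | i < n].

Lemma of_planesK t : to_planes (of_planes t) = t.
Proof.
apply: eq_from_tnth => i; rewrite tnth_mktuple mxE /to_plane /=.
by case: (tnth t i).
Qed.

Lemma to_planesK x : of_planes (to_planes x) = x.
Proof.
by apply/colP => i; rewrite mxE tnth_mktuple /to_plane /=; case: (x i 0).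
Qed.

Definition act M t := to_planes (M *m of_planes t).

Lemma of_planes_act M t : of_planes (act M t) = M *m of_planes t.
Proof. exact: to_planesK. Qed.

Lemma act_mul M N t : act (M *m N) t = act M (act N t).
Proof. by rewrite /act to_planesK mulmxA. Qed.

Lemma act1 t : act 1%:M t = t.
Proof. by rewrite /act mul1mx of_planesK. Qed.

Lemma Re_mul (a b : C) :
  complex.Re (a * b) = complex.Re a * complex.Re b - complex.Im a * complex.Im b.
Proof. by case: a b => [a1 a2] [b1 b2]. Qed.

Lemma Im_mul (a b : C) :
  complex.Im (a * b) = complex.Re a * complex.Im b + complex.Im a * complex.Re b.
Proof. by case: a b => [a1 a2] [b1 b2]. Qed.

Lemma Re_sum (I : Type) (r : seq I) (F : I -> C) :
  complex.Re (\sum_(i <- r) F i) = \sum_(i <- r) complex.Re (F i).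
Proof. exact: (raddf_sum (@complex.Re R : Rcomplex R -> R)). Qed.

Lemma Im_sum (I : Type) (r : seq I) (F : I -> C) :
  complex.Im (\sum_(i <- r) F i) = \sum_(i <- r) complex.Im (F i).
Proof. exact: (raddf_sum (@complex.Im R : Rcomplex R -> R)). Qed.

Lemma measurable_Re_coord i :
  measurable_fun setT (fun t => complex.Re (of_planes t i 0) : measurableTypeR R).
Proof.
under eq_fun do rewrite mxE /=.
exact: (measurableT_comp measurable_fst (measurable_tnth i)).
Qed.

Lemma measurable_Im_coord i :
  measurable_fun setT (fun t => complex.Im (of_planes t i 0) : measurableTypeR R).
Proof.
under eq_fun do rewrite mxE /=.
exact: (measurableT_comp measurable_snd (measurable_tnth i)).
Qed.

Lemma measurable_act M : measurable_fun setT (act M).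
Proof.
apply/measurable_fun_tnthP => i.
rewrite (_ : _ \o _ = fun t => to_plane ((M *m of_planes t) i 0)); last first.
  by apply/funext => t; rewrite /= tnth_mktuple.
apply/measurable_fun_pairP; split.
  rewrite (_ : _ \o _ = fun t => \sum_j (complex.Re (M i j) * complex.Re (of_planes t j 0)
      - complex.Im (M i j) * complex.Im (of_planes t j 0))); last first.
    apply/funext => t; rewrite /= mxE Re_sum.
    by apply: eq_bigr => j _; rewrite Re_mul.
  apply: measurable_sum => j; apply: measurable_funB; apply: measurable_funM;
    by [exact: measurable_cst|exact: measurable_Re_coord|exact: measurable_Im_coord].
rewrite (_ : _ \o _ = fun t => \sum_j (complex.Re (M i j) * complex.Im (of_planes t j 0)
    + complex.Im (M i j) * complex.Re (of_planes t j 0))); last first.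
  apply/funext => t; rewrite /= mxE Im_sum.
  by apply: eq_bigr => j _; rewrite Im_mul.
apply: measurable_sum => j; apply: measurable_funD; apply: measurable_funM;
  by [exact: measurable_cst|exact: measurable_Re_coord|exact: measurable_Im_coord].
Qed.

Lemma innerDl x y u : inner (x + y) u = inner x u + inner y u.
Proof. by rewrite /inner mulmxDr mxE. Qed.

Lemma innerDr x y u : inner u (x + y) = inner u x + inner u y.
Proof. by rewrite /inner linearD/= map_mxD mulmxDl mxE. Qed.

Lemma innerZl a x u : inner (a *: x) u = a * inner x u.
Proof. by rewrite /inner -scalemxAr mxE. Qed.

Lemma innerZr a x u : inner u (a *: x) = a^* * inner u x.
Proof. by rewrite /inner linearZ/= map_mxZ -scalemxAl mxE. Qed.

Lemma inner_adj M x y : inner (M *m x) y = inner x (M^t* *m y).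
Proof.
have adjM : (M^t* *m y)^t* = y^t* *m M.
  rewrite trmx_mul map_mxM; congr (_ *m _).
  by apply/matrixP => i j; rewrite !mxE; exact: conjCK.
by rewrite /inner adjM mulmxA.
Qed.

Lemma inner_conj x y : inner y x = (inner x y)^*.
Proof.
rewrite /inner !mxE rmorph_sum; apply: eq_bigr => i _.
rewrite !mxE; case: (x i 0) (y i 0) => [a b] [c e] /=.
by apply/eqP; rewrite eq_complex/=; apply/andP; split; apply/eqP; ring.
Qed.

Lemma cnorm_unitary M x : M^t* *m M = 1%:M -> cnorm (M *m x) = cnorm x.
Proof. by move=> MM; rewrite /cnorm inner_adj mulmxA MM mul1mx. Qed.

Lemma planes_norm_act M t : M^t* *m M = 1%:M -> planes_norm (act M t) = planes_norm t.
Proof. by move=> MM; rewrite /planes_norm of_planes_act cnorm_unitary. Qed.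

Lemma of_planes_direction t : of_planes (direction t) = (planes_norm t)^-1%:C *: of_planes t.
Proof.
apply/colP => i; rewrite !mxE tnth_mktuple /=; apply/eqP; rewrite eq_complex/= !mul0r subr0 addr0.
by rewrite ![_^-1 * _]mulrC !eqxx.
Qed.

Lemma act_direction M t : M^t* *m M = 1%:M -> direction (act M t) = act M (direction t).
Proof.
move=> MM; rewrite -[LHS]of_planesK of_planes_direction planes_norm_act// of_planes_act.
by rewrite /act of_planes_direction -scalemxAr.
Qed.

Definition preserves M := measure_preserving (tuple_measure (@lebesgue_plane R) n) (act M).

Lemma preserves_mul M N : preserves M -> preserves N -> preserves (M *m N).
Proof.
move=> pM pN; rewrite /preserves (_ : act (M *m N) = act M \o act N).
  exact: measure_preserving_comp.
by apply/funext => t; exact: act_mul.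
Qed.

(** The map adds c x_j to coordinate [i], which is a translation once the other coordinates are
    fixed. *)
Lemma preserves_shear (i j : 'I_n) (c : C) : i != j -> preserves (1%:M + c *: delta_mx i j).
Proof.
move=> ij.
have E t k : tnth (act (1%:M + c *: delta_mx i j) t) k =
    to_plane (of_planes t k 0 + if k == i then c * of_planes t j 0 else 0).
  rewrite tnth_mktuple mulmxDl mul1mx mxE; congr (to_plane (_ + _)).
  rewrite -scalemxAl mxE mxE (bigD1 j)//= !mxE eqxx andbT big1 ?addr0 => [|l lj].
    by case: eqP; rewrite ?mul1r// mul0r mulr0.
  by rewrite mxE (negbTE lj) andbF mul0r.
apply: (@measure_preserving_tuple _ _ _ _ _ i); first exact: measurable_act.
  move=> t k ki; rewrite E (negbTE ki) addr0 mxE /to_plane/=.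
  by case: (tnth t k).
move=> t; pose w := c * of_planes t j 0.
rewrite (_ : (fun z => _) = fun z : plane R => (z.1 + complex.Re w, z.2 + complex.Im w)).
  exact: measure_preserving_plane_translation.
apply/funext => z; rewrite E eqxx !mxE !tnth_mktuple eqxx eq_sym (negbTE ij).
by rewrite /w mxE /to_plane/= !raddfD.
Qed.

(** The added entry is exp (i h) - 1, so coordinate [j] is multiplied by exp (i h): a rotation of
    the plane. *)
Lemma preserves_phase (j : 'I_n) (h : R) : sin h != 0 ->
  preserves (1%:M + ((cos h - 1) +i* sin h) *: delta_mx j j).
Proof.
move=> s0; pose c := (cos h - 1) +i* sin h.
have E t k : tnth (act (1%:M + c *: delta_mx j j) t) k =
    to_plane (of_planes t k 0 + if k == j then c * of_planes t j 0 else 0).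
  rewrite tnth_mktuple mulmxDl mul1mx mxE; congr (to_plane (_ + _)).
  rewrite -scalemxAl mxE mxE (bigD1 j)//= !mxE eqxx andbT big1 ?addr0 => [|l lj].
    by case: eqP; rewrite ?mul1r// mul0r mulr0.
  by rewrite mxE (negbTE lj) andbF mul0r.
apply: (@measure_preserving_tuple _ _ _ _ _ j); first exact: measurable_act.
  move=> t k kj; rewrite E (negbTE kj) addr0 mxE /to_plane/=.
  by case: (tnth t k).
move=> t.
rewrite (_ : (fun z => _) = fun z : plane R =>
  (cos h * z.1 - sin h * z.2, sin h * z.1 + cos h * z.2)).
  exact: measure_preserving_rotation.
apply/funext => z; rewrite E eqxx !mxE !tnth_mktuple eqxx /to_plane/=.
by congr pair; ring.
Qed.

End linear_action.

Section tuple_box.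
Local Open Scope ereal_scope.
Context d (T : measurableType d) (R : realType).
Variable m : {sigma_finite_measure set T -> \bar R}.

Definition tuple_box n (B : set T) : set (n.-tuple T) := [set t | forall i, B (tnth t i)].

Lemma measurable_tuple_box n B : measurable B -> measurable (@tuple_box n B).
Proof.
move=> mB; rewrite (_ : tuple_box B = \bigcap_(i in [set: 'I_n]) ((fun t => tnth t i) @^-1` B)).
  apply: fin_bigcap_measurable => // i _; rewrite -[X in measurable X]setTI.
  exact: measurable_tnth.
by apply/seteqP; split => t /= Bt i => [_|]; exact: Bt.
Qed.

Lemma tuple_measure_boxS n B : measurable B ->
  tuple_measure m n.+1 (tuple_box B) = m B * tuple_measure m n (tuple_box B).
Proof.
move=> mB; rewrite -product_measure1E//; last exact: measurable_tuple_box.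
rewrite /= /cons_measure /pushforward; congr ((_ \x _) _).
apply/seteqP; split => -[x t] /=.
  move=> Bxt; split; first exact: (Bxt ord0).
  move=> i; have := Bxt (lift ord0 i).
  by rewrite (tnth_nth x) /= -tnth_nth.
move=> [Bx Bt] i; have [j ->|->//] := unliftP ord0 i.
by rewrite (tnth_nth x) /= -tnth_nth; exact: Bt.
Qed.

Lemma tuple_measure_box0 B : tuple_measure m 0 (tuple_box B) = 1.
Proof. by rewrite /= diracE mem_set// => -[]. Qed.

Lemma tuple_measure_box_gt0 n B : measurable B -> 0 < m B ->
  0 < tuple_measure m n (tuple_box B).
Proof.
move=> mB B0; elim: n => [|n IH]; first by rewrite tuple_measure_box0.
by rewrite tuple_measure_boxS// mule_gt0.
Qed.

Lemma tuple_measure_box_lty n B : measurable B -> m B < +oo ->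
  tuple_measure m n (tuple_box B) < +oo.
Proof.
move=> mB By; elim: n => [|n IH]; first by rewrite tuple_measure_box0 ltry.
by rewrite tuple_measure_boxS// lte_mul_pinfty// ge0_fin_numE.
Qed.

End tuple_box.

Lemma lebesgue_planeX (R : realType) (A B : set (measurableTypeR R)) :
  measurable A -> measurable B ->
  (lebesgue_plane (A `*` B) = lebesgue_measure A * lebesgue_measure B)%E.
Proof. exact: product_measure1E. Qed.

(** * The normalized surface measure *)

Section sphere.
Variables (R : realType) (n : nat).
Implicit Types (t : n.-tuple (plane R)).

Definition plane_sphere : set (n.-tuple (plane R)) := [set t | planes_norm t = 1].

Lemma measurable_plane_sphere : measurable plane_sphere.
Proof.
rewrite (_ : plane_sphere = (@planes_norm R n) @^-1` [set 1]) //.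
by rewrite -[X in measurable X]setTI; exact: measurable_planes_norm.
Qed.

Lemma planes_norm_ge0 t : 0 <= planes_norm t.
Proof. by rewrite planes_normE sqrtr_ge0. Qed.

Lemma sqr_planes_norm t : planes_norm t ^+ 2 =
  \sum_(i < n) ((tnth t i).1 ^+ 2 + (tnth t i).2 ^+ 2).
Proof.
rewrite planes_normE sqr_sqrtr//; apply: sumr_ge0 => i _.
by rewrite addr_ge0 ?sqr_ge0.
Qed.

Lemma planes_norm_direction t : 0 < planes_norm t -> planes_norm (direction t) = 1.
Proof.
move=> t0; have n1 : planes_norm (direction t) ^+ 2 = 1.
  rewrite sqr_planes_norm.
  under eq_bigr do rewrite tnth_mktuple /= !expr_div_n -mulrDl.
  by rewrite -mulr_suml -sqr_planes_norm divff// sqrf_eq0 gt_eqF.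
by rewrite -[LHS](ger0_norm (planes_norm_ge0 _)) -sqrtr_sqr n1 sqrtr1.
Qed.

Hypothesis n0 : (0 < n)%N.
Local Notation mu := (tuple_measure (@lebesgue_plane R) n).

Lemma cone_measureE E : cone_measure E = mu ((@direction R n) @^-1` E `&` @punctured_ball R n).
Proof. by []. Qed.

Lemma punctured_ball_lty : (mu (@punctured_ball R n) < +oo)%E.
Proof.
pose J : set R := `[-1, 1]%classic; pose B : set (plane R) := J `*` J.
have mJ : measurable (J : set (measurableTypeR R)) by exact: measurable_itv.
have mB : measurable B by exact: measurableX.
apply: (@le_lt_trans _ _ (mu (tuple_box B))); last first.
  apply: tuple_measure_box_lty => //.
  rewrite [X in (X < _)%E](lebesgue_planeX mJ mJ).
  by rewrite /J lebesgue_measure_itv /= ifT -?EFinB -?EFinM ?ltry// lte_fin; lra.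
apply: le_measure; rewrite ?inE; [exact: measurable_punctured_ball|exact: measurable_tuple_box|].
move=> t /andP[_ t1] i.
have : planes_norm t ^+ 2 <= 1 by rewrite expr_le1// planes_norm_ge0.
rewrite sqr_planes_norm (bigD1 i)//= => H.
have H' : 0 <= \sum_(j < n | j != i) ((tnth t j).1 ^+ 2 + (tnth t j).2 ^+ 2).
  by apply: sumr_ge0 => j _; rewrite addr_ge0 ?sqr_ge0.
have le1 (a b : R) : a ^+ 2 + b ^+ 2 <= 1 -> -1 <= a <= 1.
  by move=> ab; apply/andP; split; nra.
have ab1 : (tnth t i).1 ^+ 2 + (tnth t i).2 ^+ 2 <= 1 by rewrite (le_trans _ H)// lerDl.
rewrite /B; split; rewrite /J /= in_itv/=; first exact: le1 ab1.
by apply: (le1 _ (tnth t i).1); rewrite addrC.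
Qed.

Lemma punctured_ball_gt0 : (0 < mu (@punctured_ball R n))%E.
Proof.
(* On the cube of side e the squared norm is at most 2 n e^2 = 2 n / (n + 1)^2 < 1. The sides are
   open at 0, which keeps the norm positive. *)
pose e : R := (n.+1%:R)^-1.
have e0 : 0 < e by rewrite invr_gt0.
pose J : set R := `]0, e]%classic; pose B : set (plane R) := J `*` J.
have mJ : measurable (J : set (measurableTypeR R)) by exact: measurable_itv.
have mB : measurable B by exact: measurableX.
apply: (@lt_le_trans _ _ (mu (tuple_box B))).
  apply: tuple_measure_box_gt0 => //.
  rewrite [X in (_ < X)%E](lebesgue_planeX mJ mJ).
  rewrite /J !lebesgue_measure_itv /= lte_fin e0.
  by rewrite -EFinB -EFinM lte_fin subr0 mulr_gt0.
apply: le_measure; rewrite ?inE; [exact: measurable_tuple_box|exact: measurable_punctured_ball|].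
move=> t Bt; rewrite /punctured_ball /=.
have Bi i : 0 < (tnth t i).1 <= e /\ 0 < (tnth t i).2 <= e.
  by have [] := Bt i; rewrite /J /= !in_itv.
have s0 : 0 < planes_norm t ^+ 2.
  rewrite sqr_planes_norm (bigD1 (Ordinal n0))//= ltr_wpDr//.
    by apply: sumr_ge0 => j _; rewrite addr_ge0 ?sqr_ge0.
  have [/andP[h _] _] := Bi (Ordinal n0).
  by rewrite ltr_wpDr ?sqr_ge0// exprn_gt0.
apply/andP; split.
  by rewrite lt_neqAle planes_norm_ge0 andbT eq_sym -sqrf_eq0 gt_eqF.
rewrite -(@expr_le1 _ 2)// ?planes_norm_ge0// sqr_planes_norm.
apply: (@le_trans _ _ (\sum_(i < n) (2 * e ^+ 2))).
  apply: ler_sum => i _; have [/andP[a1 a2] /andP[b1 b2]] := Bi i.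
  by rewrite mulr_natl mulr2n lerD// lerXn2r// nnegrE ltW.
rewrite sumr_const card_ord -[leLHS]mulr_natr.
have em : e * (n%:R + 1) = 1 by rewrite natr1 mulVf// pnatr_eq0.
have -> : 2 * e ^+ 2 * n%:R = (e * (n%:R + 1)) ^+ 2 - e ^+ 2 * (n%:R ^+ 2 + 1) by ring.
by rewrite em expr1n lerBlDr lerDl mulr_ge0 ?addr_ge0 ?sqr_ge0.
Qed.

Let cone_setT : (@cone_measure R n setT = mu (@punctured_ball R n))%E.
Proof. by rewrite cone_measureE preimage_setT setTI. Qed.

(** The total mass is positive and finite, so the default branch of [mnormalize] is not taken, and
    the factor 2 n cancels. *)
Lemma surface_probabilityE E : surface_probability R n E =
  (cone_measure E * (fine (mu (@punctured_ball R n)))^-1%:E)%E.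
Proof.
have b0 := punctured_ball_gt0; have boo := punctured_ball_lty.
have n2 : 0 < (2 * n)%:R :> R by rewrite ltr0n muln_gt0.
have bfin : mu (@punctured_ball R n) \is a fin_num by rewrite ge0_fin_numE// ltW.
have f0 : 0 < fine (mu (@punctured_ball R n)) by rewrite fine_gt0// b0.
have evE : (surface_measure R n setT = (2 * n)%:R%:E * mu (@punctured_ball R n))%E.
  by rewrite -cone_setT.
have ev0 : (surface_measure R n setT == 0%E) || (surface_measure R n setT == +oo%E) = false.
  rewrite evE -(fineK bfin) -EFinM; apply/negP => /orP[/eqP[]|/eqP//] /eqP.
  by rewrite mulf_eq0 !gt_eqF.
have -> : (surface_probability R n E =
    surface_measure R n E * (fine (surface_measure R n setT))^-1%:E)%E.
  by rewrite /surface_probability /= /mnormalize ev0.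
have -> : (surface_measure R n E = (2 * n)%:R%:E * cone_measure E)%E by [].
rewrite evE fineM//= invfM EFinM.
rewrite muleA [X in (X * _)%E]muleAC -[X in (X * _ * _)%E]EFinM divff ?mul1e//.
by rewrite gt_eqF.
Qed.

Lemma surface_probability_sphere : surface_probability R n plane_sphere = 1%E.
Proof.
have := probability_setT (surface_probability R n).
rewrite !surface_probabilityE => <-; congr (_ * _)%E.
rewrite !cone_measureE preimage_setT setTI; congr (mu _).
apply/seteqP; split => t; first by case.
by move=> tb; split => //; apply: planes_norm_direction; case/andP: tb.
Qed.

(** A unitary map commutes with [direction] and maps the punctured ball to itself, so invariance
    passes from Lebesgue measure to cones. *)
Lemma measure_preserving_act (M : 'M[R[i]]_n) : M^t* *m M = 1%:M -> preserves M ->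
  measure_preserving (surface_probability R n) (act M).
Proof.
move=> MM [mM pM]; split => // E mE.
have setE : (@direction R n) @^-1` (act M @^-1` E) `&` @punctured_ball R n =
    act M @^-1` ((@direction R n) @^-1` E `&` @punctured_ball R n).
  apply/seteqP; split => t []; rewrite /preimage /punctured_ball /= => Et t1; split => /=.
  - by rewrite act_direction.
  - by rewrite planes_norm_act.
  - by rewrite -act_direction.
  - by rewrite -(planes_norm_act t MM).
have mE' : measurable ((@direction R n) @^-1` E `&` @punctured_ball R n).
  apply: measurableI; last exact: measurable_punctured_ball.
  by rewrite -[X in measurable X]setTI; exact: measurable_direction.
rewrite (surface_probabilityE E) (surface_probabilityE (act M @^-1` E)).
rewrite !cone_measureE setE.
by apply: (congr1 (fun x => (x * _)%E)); apply: pM.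
Qed.

Lemma preimage_sphere (M : 'M[R[i]]_n) : M^t* *m M = 1%:M ->
  act M @^-1` plane_sphere = plane_sphere.
Proof.
by move=> MM; apply/seteqP; split => t; rewrite /preimage /plane_sphere/= planes_norm_act.
Qed.

(** The scaling hypothesis makes [E] contain the cone over its directions, so a Lebesgue null set of
    this kind has a null trace on the sphere. *)
Lemma surface_probability_null E :
  measurable E -> (forall t c, 0 < c -> E [tuple ((tnth t i).1 / c, (tnth t i).2 / c) | i < n] -> E t) ->
  mu E = 0%E -> surface_probability R n E = 0%E.
Proof.
move=> mE homE E0; rewrite surface_probabilityE cone_measureE.
rewrite (_ : mu _ = 0%E) ?mul0e//; apply/eqP; rewrite eq_le measure_ge0 andbT -E0.
apply: le_measure; rewrite ?inE//.
  apply: measurableI; last exact: measurable_punctured_ball.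
  by rewrite -[X in measurable X]setTI; exact: measurable_direction.
by move=> t [Et /andP[t0 _]]; exact: (homE _ _ t0).
Qed.

End sphere.

(** * Integration by parts along flows *)

Section flow_calculus.
Context d (T : measurableType d) (R : realType).
Variables (P : {finite_measure set T -> \bar R}) (D : set T).
Hypothesis mD : measurable D.
Variables (I : finType) (phi : I -> R -> T -> T).
Hypothesis phi0 : forall i t, phi i 0 t = t.
Hypothesis phiD : forall i h k t, phi i (h + k) t = phi i h (phi i k t).
Hypothesis phi_dom : forall i h, phi i h @^-1` D = D.
Hypothesis phi_preserving : forall i m, measure_preserving P (phi i m.+1%:R^-1).
Implicit Types (f g u W : T -> R) (i : I) (t : T).

Definition lie i g t : R := 'D_1 (fun h : R => g (phi i h t)) 0.

Definition lie_derivable i g := forall t, D t -> derivable (fun h : R => g (phi i h t)) 0 1.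

Let phi_in i h t : D t -> D (phi i h t).
Proof. by move=> Dt; rewrite -[D _]/((phi i h @^-1` D) t) phi_dom. Qed.

Lemma lie_is_derive i g t : lie_derivable i g -> D t ->
  is_derive (0 : R) 1 (fun h : R => g (phi i h t)) (lie i g t).
Proof. by move=> dg Dt; apply: DeriveDef => //; exact: dg. Qed.

Lemma lieP i g g' :
  (forall t, D t -> is_derive (0 : R) 1 (fun h : R => g (phi i h t)) (g' t)) ->
  lie_derivable i g /\ forall t, D t -> lie i g t = g' t.
Proof. by move=> H; split => t Dt; have [] := H _ Dt. Qed.

(** The group law carries the derivative at time 0 to every time, as the mean value theorem in
    [expect_lie] requires. *)
Lemma lie_is_derive_at i g t (h : R) : lie_derivable i g -> D t ->
  is_derive h 1 (fun h : R => g (phi i h t)) (lie i g (phi i h t)).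
Proof.
move=> dg Dt.
have d0 := lie_is_derive dg (phi_in i h Dt).
have s : is_derive h 1 (fun x : R => x - h) 1.
  by apply: is_derive_eq; rewrite subr0.
rewrite -(subrr h) in d0.
have := @is_derive1_comp _ (fun k : R => g (phi i k (phi i h t))) (fun x => x - h) h _ _ d0 s.
rewrite mulr1.
rewrite (_ : _ \o _ = fun x : R => g (phi i x t))//.
by apply/funext => x /=; rewrite -phiD subrK.
Qed.

Lemma eq_lie i f g t : (forall t, D t -> f t = g t) -> D t -> lie i f t = lie i g t.
Proof.
move=> fg Dt; rewrite /lie.
rewrite (_ : (fun h : R => f (phi i h t)) = fun h => g (phi i h t))//.
by apply/funext => h; apply: fg; exact: phi_in.
Qed.

Lemma eq_lie_derivable i f g : (forall t, D t -> f t = g t) ->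
  lie_derivable i f -> lie_derivable i g.
Proof.
move=> fg df t Dt; have := df _ Dt.
rewrite (_ : (fun h : R => f (phi i h t)) = fun h => g (phi i h t))//.
by apply/funext => h; apply: fg; exact: phi_in.
Qed.

Local Notation bounded_mfun := (bounded_mfun D).
Local Notation expect := (expect P D).

(** By invariance each difference quotient has mean zero. The mean value theorem bounds the
    quotients by the bound of [lie i g], so dominated convergence applies along the times 1 / (m +
    1), at which invariance is assumed. *)
Lemma expect_lie i g : bounded_mfun g -> bounded_mfun (lie i g) -> lie_derivable i g ->
  expect (lie i g) = 0.
Proof.
move=> bg bg' dg; have [_ [M MP]] := bg'; have [mg _] := bg.
pose h_ (m : nat) : R := m.+1%:R^-1.
have h0 m : 0 < h_ m by rewrite invr_gt0.
have mgh m : measurable_fun D (fun t => g (phi i (h_ m) t)).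
  apply: (measurable_comp mD _ mg) => [_ [t Dt <-]|]; first exact: phi_in.
  by apply: measurable_funTS; have [] := phi_preserving i m.
have bgh m : bounded_mfun (fun t => g (phi i (h_ m) t)).
  split=> //; have [_ [K KP]] := bg; exists K => t Dt; apply: KP; exact: phi_in.
pose f_ m t := (h_ m)^-1 * (g (phi i (h_ m) t) - g t).
have Ef m : expect (f_ m) = 0.
  rewrite /f_ expectZ//; last exact: bounded_mfunB.
  rewrite (expectB P mD)// (_ : expect _ = expect g) ?subrr ?mulr0//.
  rewrite /expect /Rintegral (integral_measure_preserving (phi_preserving i m))//.
have cv : expect (f_ m) @[m --> \oo] --> expect (lie i g).
  apply: (@expect_cvg _ _ _ P _ mD f_ (lie i g) `|M|).
  - move=> m; apply: measurable_funM; first exact: measurable_cst.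
    exact: measurable_funB.
  - move=> m t Dt.
    have [c _ cE] : exists2 c, c \in `](0:R), (h_ m)[ & g (phi i (h_ m) t) - g (phi i 0 t) =
        lie i g (phi i c t) * (h_ m - 0).
      apply: (@MVT _ (fun h => g (phi i h t)) (fun h => lie i g (phi i h t))) => //.
        by move=> x _; exact: lie_is_derive_at.
      apply: derivable_within_continuous => x _.
      by have [] := lie_is_derive_at x dg Dt.
    rewrite phi0 subr0 in cE.
    rewrite /f_ cE mulrCA mulVf ?mulr1; last by rewrite gt_eqF.
    by rewrite (le_trans _ (ler_norm M))// MP//; exact: phi_in.
  - move=> t Dt; have [] := lie_is_derive dg Dt.
    rewrite /derivable => /cvg_ex[l cl] <-.
    have -> : 'D_1 (fun h : R => g (phi i h t)) 0 = l by exact: cvg_lim.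
    have /cvgr_dnbhsP/(_ h_) := cl.
    have hn m : h_ m != 0 by rewrite gt_eqF.
    move=> /(_ (conj hn (@cvg_harmonic R))); apply: cvg_trans; apply: near_eq_cvg; near=> m.
    by rewrite /f_ /= addr0 phi0 /GRing.scale/= mulr1.
by move: cv; under eq_fun do rewrite Ef; move=> /(cvg_lim (@Rhausdorff R)) <-; rewrite lim_cst.
Unshelve. all: by end_near. Qed.


(** The counterpart of [of_class_C] for the flows, with boundedness and measurability of the
    iterated derivatives in place of continuity; this is what integration by parts consumes. *)
Fixpoint flow_C k g : Prop := bounded_mfun g /\
  match k with
  | 0 => True
  | k'.+1 => forall i, lie_derivable i g /\ flow_C k' (lie i g)
  end.

Lemma flow_C_bounded k g : flow_C k g -> bounded_mfun g.
Proof. by case: k => [|k] []. Qed.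

Lemma flow_C_lie_derivable k g i : flow_C k.+1 g -> lie_derivable i g.
Proof. by case=> _ /(_ i)[]. Qed.

Lemma flow_C_lie k g i : flow_C k.+1 g -> flow_C k (lie i g).
Proof. by case=> _ /(_ i)[]. Qed.

Lemma flow_CW k m g : (k <= m)%N -> flow_C m g -> flow_C k g.
Proof.
elim: k m g => [|k IH] [|m] g //=; first by move=> _ [].
by rewrite ltnS => km [bg Hg]; split => // i; have [dg Cg] := Hg i; split => //; exact: IH Cg.
Qed.

Lemma eq_flow_C k f g : (forall t, D t -> f t = g t) -> flow_C k f -> flow_C k g.
Proof.
elim: k f g => [|k IH] f g fg /= [bf Hf]; have bg := eq_bounded_mfun fg bf; split => // i.
have [df Cf] := Hf i; split; first exact: eq_lie_derivable df.
by apply: IH Cf => t Dt; exact: eq_lie.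
Qed.

Lemma lie_cst i (c : R) : lie_derivable i (cst c) /\ forall t, D t -> lie i (cst c) t = 0.
Proof. by apply: lieP => t _; exact: is_derive_cst. Qed.

Lemma lieD i f g : lie_derivable i f -> lie_derivable i g ->
  lie_derivable i (f \+ g) /\ forall t, D t -> lie i (f \+ g) t = lie i f t + lie i g t.
Proof.
move=> df dg; apply: lieP => t Dt.
exact: is_deriveD (lie_is_derive df Dt) (lie_is_derive dg Dt).
Qed.

Lemma lieM i f g : lie_derivable i f -> lie_derivable i g ->
  lie_derivable i (f \* g) /\
  forall t, D t -> lie i (f \* g) t = f t * lie i g t + g t * lie i f t.
Proof.
move=> df dg; apply: lieP => t Dt.
have := is_deriveM (lie_is_derive df Dt) (lie_is_derive dg Dt).
by rewrite !phi0.
Qed.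

Lemma lie_pospow i m g : lie_derivable i g ->
  lie_derivable i (pospow m.+2 \o g) /\
  forall t, D t -> lie i (pospow m.+2 \o g) t = m.+2%:R * pospow m.+1 (g t) * lie i g t.
Proof.
move=> dg; apply: lieP => t Dt.
have := @is_derive1_comp _ (pospow m.+2) (fun h : R => g (phi i h t)) 0 _ _
  (is_derive_pospow m _) (lie_is_derive dg Dt).
by rewrite phi0.
Qed.

Lemma lieV i g : lie_derivable i g -> (forall t, D t -> g t != 0) ->
  lie_derivable i (fun t => (g t)^-1) /\
  forall t, D t -> lie i (fun t => (g t)^-1) t = - (g t)^-1 ^+ 2 * lie i g t.
Proof.
move=> dg g0; apply: lieP => t Dt.
have g0' : g (phi i 0 t) != 0 by rewrite phi0 g0.
have := is_deriveV g0' (lie_is_derive dg Dt).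
by rewrite phi0 exprVn.
Qed.

Lemma flow_C_cst k c : flow_C k (cst c).
Proof.
elim: k c => [|k IH] c /=; split => //; try exact: bounded_mfun_cst.
move=> i; have [d0 e0] := lie_cst i c; split => //.
by apply: eq_flow_C (IH 0) => t Dt; rewrite e0.
Qed.

Lemma flow_CD k f g : flow_C k f -> flow_C k g -> flow_C k (f \+ g).
Proof.
elim: k f g => [|k IH] f g /= [bf Hf] [bg Hg]; split=> //; try exact: bounded_mfunD.
move=> i; have [df Cf] := Hf i; have [dg Cg] := Hg i.
have [dfg efg] := lieD df dg; split => //.
by apply: eq_flow_C (IH _ _ Cf Cg) => t Dt; rewrite efg.
Qed.

Lemma flow_CM k f g : flow_C k f -> flow_C k g -> flow_C k (f \* g).
Proof.
elim: k f g => [|k IH] f g; first by move=> [bf _] [bg _]; split => //; exact: bounded_mfunM.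
move=> Cf Cg; have [bf Hf] := Cf; have [bg Hg] := Cg.
split; first exact: bounded_mfunM.
move=> i; have [df Cf'] := Hf i; have [dg Cg'] := Hg i.
have [dfg efg] := lieM df dg; split => //.
have C1 := IH _ _ (flow_CW (leqnSn k) Cf) Cg'.
have C2 := IH _ _ (flow_CW (leqnSn k) Cg) Cf'.
by apply: eq_flow_C (flow_CD C1 C2) => t Dt; rewrite efg.
Qed.

Lemma flow_CZ k (c : R) g : flow_C k g -> flow_C k (fun t => c * g t).
Proof. exact: (flow_CM (flow_C_cst k c)). Qed.

Lemma flow_CB k f g : flow_C k f -> flow_C k g -> flow_C k (f \- g).
Proof.
move=> Cf /(flow_CZ (-1)) /(flow_CD Cf).
by apply: eq_flow_C => t _ /=; rewrite mulN1r.
Qed.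

Lemma flow_C_sum k (J : Type) (r : seq J) (f : J -> T -> R) :
  (forall j, flow_C k (f j)) -> flow_C k (fun t => \sum_(j <- r) f j t).
Proof.
move=> Cf; elim: r => [|j r IH].
  by apply: eq_flow_C (flow_C_cst k 0) => t _; rewrite big_nil.
by apply: eq_flow_C (flow_CD (Cf j) IH) => t _; rewrite big_cons.
Qed.

Lemma flow_C_pospow k m g : (k < m)%N -> flow_C k g -> flow_C k (pospow m \o g).
Proof.
elim: k m g => [|k IH] m g km Cg; have bg := flow_C_bounded Cg; split;
  try exact: bounded_mfun_pospow; first by [].
case: m km => [|[|m]]// km i; have [_ /(_ i)[dg Cg']] := Cg.
have [dp ep] := lie_pospow m dg; split => //.
have C1 := flow_CZ m.+2%:R (IH m.+1 _ km (flow_CW (leqnSn k) Cg)).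
by apply: eq_flow_C (flow_CM C1 Cg') => t Dt; rewrite ep.
Qed.

Lemma flow_CV k g e : 0 < e -> (forall t, D t -> e <= g t) -> flow_C k g ->
  flow_C k (fun t => (g t)^-1).
Proof.
move=> e0 ge.
have g0 t : D t -> 0 < g t by move=> /ge; exact: lt_le_trans.
have bV : bounded_mfun g -> bounded_mfun (fun t => (g t)^-1).
  move=> [mg _]; split; last first.
    exists e^-1 => t Dt; rewrite ger0_norm ?invr_ge0 ?(ltW (g0 _ Dt))//.
    by rewrite lef_pV2 ?posrE ?g0// ge.
  apply: (@eq_measurable_fun _ _ _ _ D (fun t => g t `^ (-1))).
    by move=> t /set_mem Dt; rewrite powR_inv1// ltW// g0.
  exact: measurableT_comp (measurable_powR (-1)) mg.
elim: k => [|k IH] Cg; have bg := flow_C_bounded Cg; split => //; try exact: bV.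
move=> i; have [_ /(_ i)[dg Cg']] := Cg.
have [dp ep] := lieV dg (fun t Dt => lt0r_neq0 (g0 t Dt)); split => //.
have CV := IH (flow_CW (leqnSn k) Cg).
by apply: eq_flow_C (flow_CM (flow_CZ (-1) (flow_CM CV CV)) Cg') => t Dt; rewrite ep//= mulN1r.
Qed.

(** Negativity of [u] is an open condition along a flow line, so [g] vanishes for small times and
    its derivative at 0 is 0. This is why supports are described by the sign of a differentiable
    function. *)
Lemma lie_support i u g : lie_derivable i u -> lie_derivable i g ->
  (forall t, D t -> u t < 0 -> g t = 0) -> forall t, D t -> u t < 0 -> lie i g t = 0.
Proof.
move=> du dg ug t Dt ut.
have cu : {for 0, continuous (fun h : R => u (phi i h t))}.
  by apply: differentiable_continuous; apply/derivable1_diffP; exact: du.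
have H : is_derive (0 : R) 1 (fun h : R => g (phi i h t)) 0.
  apply: (near_eq_is_derive (f := cst 0)).
  near=> h; rewrite /cst ug//; first exact: phi_in.
  near: h; move/cvgr_lt : cu; rewrite phi0; exact.
by have [_ <-] := H.
Unshelve. all: by end_near. Qed.

Lemma expect_lieM i f g : flow_C 1 f -> flow_C 1 g ->
  expect (fun t => lie i f t * g t) = - expect (fun t => f t * lie i g t).
Proof.
move=> Cf Cg; apply/eqP; rewrite -addr_eq0; apply/eqP.
have [bf /(_ i)[df [bdf _]]] := Cf; have [bg /(_ i)[dg [bdg _]]] := Cg.
have [dfg efg] := lieM df dg.
rewrite -(expectD P mD); [|exact: bounded_mfunM..].
have /(_ i)[_ [bfg _]] := (flow_CM Cf Cg).2.
rewrite -(expect_lie (bounded_mfunM bf bg) bfg dfg); apply: eq_expect => t Dt.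
by rewrite efg//= addrC (mulrC (g t)).
Qed.

Definition lie_field (c : I -> T -> R) g t := \sum_i c i t * lie i g t.

(** The formal adjoint of [lie_field c]: since the flows preserve the measure, each [lie i] is
    antisymmetric. *)
Definition lie_adjoint (c : I -> T -> R) W t := - \sum_i lie i (W \* c i) t.

Lemma expect_lie_field c f W : flow_C 1 f -> flow_C 1 W -> (forall i, flow_C 1 (c i)) ->
  expect (fun t => lie_field c f t * W t) = expect (fun t => f t * lie_adjoint c W t).
Proof.
move=> Cf CW Cc.
have CWc i : flow_C 1 (W \* c i) by exact: flow_CM.
have bl g i : flow_C 1 g -> bounded_mfun (lie i g) by case=> _ /(_ i)[_ []].
have bf := flow_C_bounded Cf.
rewrite (@eq_expect _ _ _ _ _ _ (fun t => \sum_i lie i f t * (W \* c i) t)); last first.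
  move=> t _; rewrite mulr_suml; apply: eq_bigr => i _ /=.
  by rewrite mulrAC -mulrA (mulrC (lie _ _ _)) mulrCA mulrA mulrC.
rewrite (expect_sum P mD); last first.
  by move=> i; apply: bounded_mfunM; [exact: bl|exact: flow_C_bounded (CWc i)].
under eq_bigr do rewrite expect_lieM//.
rewrite [RHS](@eq_expect _ _ _ _ _ _ (fun t => -1 * \sum_i f t * lie i (W \* c i) t)); last first.
  by move=> t _; rewrite /lie_adjoint mulN1r mulrN mulr_sumr.
have bfl i : bounded_mfun (fun t => f t * lie i (W \* c i) t).
  by apply: bounded_mfunM => //; exact: bl.
rewrite (expectZ P mD)//; last exact: bounded_mfun_sum.
by rewrite (expect_sum P mD)// mulN1r sumrN.
Qed.

Lemma flow_C_adjoint k c W : flow_C k.+1 W -> (forall i, flow_C k.+1 (c i)) ->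
  flow_C k (lie_adjoint c W).
Proof.
move=> CW Cc.
have C1 := @flow_C_sum k I (index_enum I) (fun i => lie i (W \* c i))
  (fun i => flow_C_lie i (flow_CM CW (Cc i))).
by apply: eq_flow_C (flow_CZ (-1) C1) => t _; rewrite mulN1r.
Qed.

Lemma lie_adjoint_support k u c W : flow_C k.+1 u -> flow_C k.+1 W -> (forall i, flow_C k.+1 (c i)) ->
  (forall t, D t -> u t < 0 -> W t = 0) -> forall t, D t -> u t < 0 -> lie_adjoint c W t = 0.
Proof.
move=> Cu CW Cc uW t Dt ut; rewrite /lie_adjoint big1 ?oppr0// => i _.
apply: (@lie_support i u) => //; first exact: flow_C_lie_derivable Cu.
  by apply: flow_C_lie_derivable (flow_CM CW (Cc i)).
by move=> s Ds us /=; rewrite uW// mul0r.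
Qed.

Definition supported u W := forall t, D t -> u t < 0 -> W t = 0.

(* Where u >= 0 the field V c maps F z p.+2 to p.+2 times F z p.+1, and W vanishes
   elsewhere: integration by parts trades one power against one derivative of W. *)
Lemma expect_raise (Z : Type) (F : Z -> nat -> T -> R) c u V G N :
  (forall z p, flow_C 1 (F z p.+2)) ->
  (forall z p t, D t -> lie_field c (F z p.+2) t = p.+2%:R * F z p.+1 t * G t) ->
  (forall t, D t -> 0 <= u t -> G t * V t = 1) ->
  flow_C N u -> flow_C N V -> (forall i, flow_C N (c i)) ->
  forall m k p W, (m + k <= N)%N -> flow_C (m + k) W -> supported u W ->
  exists W', [/\ flow_C k W', supported u W' &
    forall z, expect (fun t => F z p.+1 t * W t) = expect (fun t => F z (m + p.+1)%N t * W' t)].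
Proof.
move=> CF FG GV Cu CV Cc; elim=> [|m IH] k p W; first by move=> _ CW uW; exists W.
rewrite !addSn => mN CW uW.
pose W0 t := p.+2%:R^-1 * W t.
have CW0 : flow_C (m + k).+1 W0 by exact: flow_CZ.
have uW0 : supported u W0 by move=> t Dt ut; rewrite /W0 uW// mulr0.
pose c' i := V \* c i.
have Cc' i : flow_C (m + k).+1 (c' i) by apply: flow_CM; [exact: flow_CW CV|exact: flow_CW (Cc i)].
have Cu' : flow_C (m + k).+1 u by exact: flow_CW Cu.
have [W' [CW' uW' W'E]] := IH k p.+1 (lie_adjoint c' W0) (ltnW mN)
  (flow_C_adjoint CW0 Cc') (lie_adjoint_support Cu' CW0 Cc' uW0).
exists W'; split => // z; rewrite -[in RHS]addnS -W'E.
rewrite -expect_lie_field//; last 2 first.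
- by apply: flow_CW CW0.
- by move=> i; apply: flow_CW (Cc' i).
apply: eq_expect => t Dt.
have -> : lie_field c' (F z p.+2) t = V t * lie_field c (F z p.+2) t.
  by rewrite /lie_field mulr_sumr; apply: eq_bigr => i _; rewrite mulrA.
have [u0|u0] := ltP (u t) 0; first by rewrite uW0// uW// !mulr0.
rewrite FG//.
have -> : V t * (p.+2%:R * F z p.+1 t * G t) * W0 t =
  (p.+2%:R * p.+2%:R^-1) * (G t * V t) * (F z p.+1 t * W t) by rewrite /W0; ring.
by rewrite GV// divff ?pnatr_eq0// !mul1r.
Qed.

(** [G] may vanish where [u] is negative, yet [V] must be regular everywhere. Adding (-u)_+^(N+1)
    leaves [G] unchanged where [u] is nonnegative and makes the sum bounded below on all of [D], so
    it can be inverted. *)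
Lemma flow_C_inverse u G e N : 0 < e -> flow_C N u -> flow_C N G -> (forall t, D t -> 0 <= G t) ->
  (forall t, D t -> e <= G t \/ e <= - u t) ->
  exists2 V, flow_C N V & forall t, D t -> 0 <= u t -> G t * V t = 1.
Proof.
move=> e0 Cu CG G0 Ge.
pose H := G \+ (pospow N.+1 \o (fun t => -1 * u t)).
have CH : flow_C N H by apply: flow_CD => //; apply: flow_C_pospow => //; exact: flow_CZ.
have m0 : 0 < Num.min e (e ^+ N.+1) by rewrite lt_min e0 exprn_gt0.
have mH t : D t -> Num.min e (e ^+ N.+1) <= H t.
  move=> Dt; rewrite ge_min; case: (Ge t Dt) => h.
    by rewrite (le_trans h)// lerDl pospow_ge0.
  apply/orP; right; rewrite /H /= mulN1r -[leLHS]add0r lerD ?G0//.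
  by rewrite /pospow (lt_le_trans e0 h) lerXn2r// nnegrE (le_trans (ltW e0)).
exists (fun t => (H t)^-1); first exact: flow_CV m0 mH CH.
move=> t Dt ut; rewrite /H /= pospow_le0 ?addr0; last by rewrite mulN1r oppr_le0.
rewrite divff// gt_eqF//; case: (Ge t Dt); first exact: lt_le_trans.
by move=> h; have := lt_le_trans e0 h; rewrite oppr_gt0 ltNge ut.
Qed.

Section line.
Variable X : {mfun T >-> measurableTypeR R}.
Hypothesis CX : forall k, flow_C k X.

Definition lie_norm2 t := \sum_i lie i X t ^+ 2.

Lemma flow_C_lie_norm2 k : flow_C k lie_norm2.
Proof.
by apply: flow_C_sum => i; apply: (flow_CM (f := lie i X)); exact: flow_C_lie (CX k.+1).
Qed.

Lemma lie_pospow_shift p i s : lie_derivable i X ->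
  forall t, D t -> lie i (fun t => pospow p.+2 (X t - s)) t = p.+2%:R * pospow p.+1 (X t - s) * lie i X t.
Proof.
move=> dX t Dt; have [dc ec] := lie_cst i (- s).
have [dXs eXs] := lieD dX dc.
by have [_ ->] := lie_pospow p dXs; rewrite //= eXs// ec// addr0.
Qed.

(** The field with coefficients [lie i X] sends [X] to [lie_norm2]. Raising the exponent from 2, the
    least one that is regular for integration by parts, to the k+4 of [has_C_density_line] costs k+2
    derivatives of [W]. *)
Lemma has_C_density_flow_line u e W k : 0 < e -> (forall k, flow_C k u) ->
  (forall t, D t -> e <= lie_norm2 t \/ e <= - u t) ->
  flow_C k.+2 W -> supported u W -> (forall t, D t -> 0 <= W t) ->
  has_C_density (idfun : R -> measurableTypeR R) k lebesgue_measure (@rays R)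
    (fun E => \int[P]_(t in D) (\1_E (X t) * W t)%:E)%E.
Proof.
move=> e0 Cu Ge CW uW W0.
have G0 t : D t -> 0 <= lie_norm2 t by move=> _; apply: sumr_ge0 => i _; rewrite sqr_ge0.
have [V CV GV] := flow_C_inverse e0 (Cu k.+2) (flow_C_lie_norm2 k.+2) G0 Ge.
pose F (s : R) p t := pospow p (X t - s).
have CXs m s : flow_C m (fun t => X t - s).
  by apply: (flow_CB (CX m)); exact: flow_C_cst.
have CF s p : flow_C 1 (F s p.+2) by apply: (@flow_C_pospow 1 p.+2 (fun t => X t - s)).
have FG s p t : D t ->
    lie_field (fun i => lie i X) (F s p.+2) t = p.+2%:R * F s p.+1 t * lie_norm2 t.
  move=> Dt; rewrite /lie_field /lie_norm2 /F mulr_sumr; apply: eq_bigr => i _.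
  rewrite lie_pospow_shift//; last exact: flow_C_lie_derivable (CX 1).
  by rewrite expr2; ring.
have Cc i : flow_C k.+2 (lie i X) by exact: flow_C_lie (CX k.+3).
have CW' : flow_C (k.+2 + 0) W by rewrite addn0.
have kk : (k.+2 + 0 <= k.+2)%N by rewrite addn0.
have [W' [CW1 _ W'E]] := expect_raise CF FG GV (Cu _) CV Cc 1%N kk CW' uW.
apply: (has_C_density_line mD _ _ (flow_C_bounded CW1) W0) => //.
- exact: flow_C_bounded (CX 0).
- exact: flow_C_bounded CW.
- by move=> s; have := W'E s; rewrite /F addn2.
Qed.

End line.

Section plane.
Variable X : {mfun T >-> plane R}.
Let X1 t := (X t).1.
Let X2 t := (X t).2.
Hypotheses (CX1 : forall k, flow_C k X1) (CX2 : forall k, flow_C k X2).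

Definition lie_minor i j t := lie i X1 t * lie j X2 t - lie j X1 t * lie i X2 t.

Definition lie_minor2 t := \sum_i \sum_j lie_minor i j t ^+ 2.

(** Cramer's rule for each pair of flows, weighted by the minor of the pair and summed. The minors
    are antisymmetric, which makes the cross terms cancel and produces the factor 2 when the double
    sum is antisymmetrized. *)
Let c1 i t := 2 * \sum_j lie_minor i j t * lie j X2 t.
Let c2 i t := 2 * \sum_j lie_minor i j t * (- lie j X1 t).

Lemma flow_C_lie_minor k i j : flow_C k (lie_minor i j).
Proof.
apply: flow_CB; apply: (flow_CM (f := lie _ _)); apply: flow_C_lie;
  by [exact: CX1|exact: CX2].
Qed.

Lemma flow_C_lie_minor2 k : flow_C k lie_minor2.
Proof.
apply: flow_C_sum => i; apply: flow_C_sum => j.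
by apply: flow_CM; exact: flow_C_lie_minor.
Qed.

Let Cc1 k i : flow_C k (c1 i).
Proof.
apply: flow_CZ; apply: flow_C_sum => j; apply: flow_CM; first exact: flow_C_lie_minor.
exact: flow_C_lie (CX2 k.+1).
Qed.

Let Cc2 k i : flow_C k (c2 i).
Proof.
apply: flow_CZ; apply: flow_C_sum => j; apply: flow_CM; first exact: flow_C_lie_minor.
apply: (@eq_flow_C _ (fun t => -1 * lie j X1 t)); first by move=> t _; rewrite mulN1r.
by apply: flow_CZ; exact: flow_C_lie (CX1 k.+1).
Qed.

Lemma antisymmetric_sum (m : I -> I -> R) (x y : I -> R) : (forall i j, m j i = - m i j) ->
  \sum_i (2 * \sum_j m i j * y j) * x i = \sum_i \sum_j m i j * (x i * y j - x j * y i).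
Proof.
move=> mA; pose S := \sum_i \sum_j m i j * y j * x i.
have -> : \sum_i (2 * \sum_j m i j * y j) * x i = 2 * S.
  rewrite /S mulr_sumr; apply: eq_bigr => i _; rewrite -mulrA; congr (_ * _).
  by rewrite mulr_suml.
have -> : \sum_i \sum_j m i j * (x i * y j - x j * y i) =
    S - \sum_i \sum_j m i j * y i * x j.
  rewrite /S -sumrB; apply: eq_bigr => i _; rewrite -sumrB; apply: eq_bigr => j _; ring.
rewrite exchange_big/= (_ : \sum_j \sum_i _ = - S); first by ring.
rewrite /S -sumrN; apply: eq_bigr => i _; rewrite -sumrN; apply: eq_bigr => j _.
by rewrite mA; ring.
Qed.

Let minorA t i j : lie_minor j i t = - lie_minor i j t.
Proof. by rewrite /lie_minor; ring. Qed.

Let c1X1 t : \sum_i c1 i t * lie i X1 t = lie_minor2 t.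
Proof. by rewrite (antisymmetric_sum (m := fun i j => lie_minor i j t)). Qed.

Let c1X2 t : \sum_i c1 i t * lie i X2 t = 0.
Proof.
rewrite (antisymmetric_sum (m := fun i j => lie_minor i j t))// big1// => i _.
by rewrite big1// => j _; ring.
Qed.

Let c2X1 t : \sum_i c2 i t * lie i X1 t = 0.
Proof.
rewrite (antisymmetric_sum (m := fun i j => lie_minor i j t))// big1// => i _.
by rewrite big1// => j _; ring.
Qed.

Let c2X2 t : \sum_i c2 i t * lie i X2 t = lie_minor2 t.
Proof.
rewrite (antisymmetric_sum (m := fun i j => lie_minor i j t))//.
by apply: eq_bigr => i _; apply: eq_bigr => j _; rewrite /lie_minor; ring.
Qed.

Let F (z : R * R) p q t := pospow2 X1 X2 p q z t.

Let CF z p q : flow_C 1 (F z p.+2 q.+2).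
Proof.
apply: flow_CM.
  apply: (@flow_C_pospow 1 p.+2 (fun t => X1 t - z.1)) => //.
  by apply: (flow_CB (CX1 1)); exact: flow_C_cst.
apply: (@flow_C_pospow 1 q.+2 (fun t => X2 t - z.2)) => //.
by apply: (flow_CB (CX2 1)); exact: flow_C_cst.
Qed.

Let lieF z p q i t : D t -> lie i (F z p.+2 q.+2) t =
  p.+2%:R * F z p.+1 q.+2 t * lie i X1 t + q.+2%:R * F z p.+2 q.+1 t * lie i X2 t.
Proof.
move=> Dt.
have d1 : lie_derivable i (fun t => X1 t - z.1).
  by have [] := lieD (flow_C_lie_derivable (CX1 1)) (lie_cst i (- z.1)).1.
have d2 : lie_derivable i (fun t => X2 t - z.2).
  by have [] := lieD (flow_C_lie_derivable (CX2 1)) (lie_cst i (- z.2)).1.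
have [dp1 ep1] := lie_pospow p d1; have [dp2 ep2] := lie_pospow q d2.
have [_ ->//] := lieM dp1 dp2; rewrite ep1// ep2//=.
have [_ ->//] := lieD (flow_C_lie_derivable (CX1 1)) (lie_cst i (- z.1)).1.
have [_ ->//] := lieD (flow_C_lie_derivable (CX2 1)) (lie_cst i (- z.2)).1.
rewrite !(lie_cst _ _).2// /F /pospow2; ring.
Qed.

Let lie_fieldF c z p q t : D t -> lie_field c (F z p.+2 q.+2) t =
  p.+2%:R * F z p.+1 q.+2 t * (\sum_i c i t * lie i X1 t) +
  q.+2%:R * F z p.+2 q.+1 t * (\sum_i c i t * lie i X2 t).
Proof.
move=> Dt; rewrite /lie_field !mulr_sumr -big_split/=; apply: eq_bigr => i _.
by rewrite lieF// mulrDr !(mulrCA (c i t)).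
Qed.

(** The exponents are raised one after the other: [c1] takes the first from 2 to k+4 while the
    second stays at 2, then [c2] raises the second. Each costs k+2 derivatives of the weight, hence
    the order assumed of [W]. *)
Lemma has_C_density_flow_plane u e W k : 0 < e -> (forall k, flow_C k u) ->
  (forall t, D t -> e <= lie_minor2 t \/ e <= - u t) ->
  flow_C (k.+2 + k.+2)%N W -> supported u W -> (forall t, D t -> 0 <= W t) ->
  has_C_density (idfun : R * R -> plane R) k lebesgue_plane (@quadrants R)
    (fun E => \int[P]_(t in D) (\1_E (X t) * W t)%:E)%E.
Proof.
move=> e0 Cu Ge CW uW W0.
have G0 t : D t -> 0 <= lie_minor2 t.
  by move=> _; apply: sumr_ge0 => i _; apply: sumr_ge0 => j _; rewrite sqr_ge0.
have [V CV GV] := flow_C_inverse e0 (Cu (k.+2 + k.+2)%N) (flow_C_lie_minor2 _) G0 Ge.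
have F1 (z : R * R) p t : D t ->
    lie_field c1 (F z p.+2 2) t = p.+2%:R * F z p.+1 2 t * lie_minor2 t.
  by move=> Dt; rewrite lie_fieldF// c1X1 c1X2 mulr0 addr0.
have F2 (z : R * R) p t : D t ->
    lie_field c2 (F z k.+4 p.+2) t = p.+2%:R * F z k.+4 p.+1 t * lie_minor2 t.
  by move=> Dt; rewrite lie_fieldF// c2X1 c2X2 mulr0 add0r.
(* The argument [1] is the [p] of [expect_raise], whose starting exponent is [p.+1], that is 2;
   adding k+2 gives k+4. *)
have [W1 [CW1 uW1 W1E]] := @expect_raise (R * R) (fun z p => F z p 2) c1 u V lie_minor2
  (k.+2 + k.+2) (fun z p => CF z p 0) F1 GV (Cu _) CV (Cc1 _) k.+2 k.+2
  1 W (leqnn _) CW uW.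
have CW1' : flow_C (k.+2 + 0) W1 by rewrite addn0.
have kk : (k.+2 + 0 <= k.+2 + k.+2)%N by rewrite addn0 leq_addl.
have [W2 [CW2 uW2 W2E]] := @expect_raise (R * R) (fun z q => F z k.+4 q) c2 u V lie_minor2
  (k.+2 + k.+2) (fun z p => CF z k.+2 p) F2 GV (Cu _) CV (Cc2 _) k.+2 0
  1 W1 kk CW1' uW1.
apply: (has_C_density_plane mD _ _ _ (flow_C_bounded CW2) W0) => //.
- exact: flow_C_bounded (CX1 0).
- exact: flow_C_bounded (CX2 0).
- exact: flow_C_bounded CW.
- by move=> z; have := W1E z; have := W2E z; rewrite /F !addn2 /potential => <- <-.
Qed.

End plane.

End flow_calculus.

(** * Unitary flows and quadratic forms *)

Section flow.
Variables (R : realType) (n : nat).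
Local Notation C := R[i].
Let imag : C := 0 +i* 1.
Implicit Types (S B : 'M[C]_n) (h k : R) (t : n.-tuple (plane R)).

(* For a generator S with S^3 = - S this is the exponential of h S. *)
Definition flow S h : 'M[C]_n :=
  1%:M + (sin h)%:C *: S + (1 - cos h)%:C *: (S *m S).

(** A skew-Hermitian matrix with eigenvalues among 0, i and -i. The cubic relation reduces all
    powers of [S] to [S] and its square, so [flowD] is the addition formulas for sine and cosine. *)
Definition generator S := S^t* = - S /\ S *m S *m S = - S.

Lemma flow0 S : flow S 0 = 1%:M.
Proof. by rewrite /flow sin0 cos0 subrr !scale0r !addr0. Qed.

Lemma flowD S h k : generator S -> flow S (h + k) = flow S h *m flow S k.
Proof.
move=> [_ S3]; rewrite /flow.
have S4 : S *m S *m (S *m S) = - (S *m S) by rewrite mulmxA S3 mulNmx.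
have S3' : S *m (S *m S) = - S by rewrite mulmxA.
set a := (sin h)%:C; set b := (1 - cos h)%:C; set c := (sin k)%:C; set e := (1 - cos k)%:C.
rewrite !mulmxDl !mulmxDr !mul1mx !mulmx1 -!scalemxAl -!scalemxAr !scalerA S3 S3' S4.
have -> : (sin (h + k))%:C = a + c - a * e - b * c.
  by rewrite /a /b /c /e -!rmorphM -rmorphD -!rmorphB/=; congr (_%:C); rewrite sinD; ring.
have -> : (1 - cos (h + k))%:C = b + e + a * c - b * e.
  by rewrite /a /b /c /e -!rmorphM -!rmorphD -!rmorphB/=; congr (_%:C); rewrite cosD; ring.
move: a b c e (S *m S) (1%:M) {S3 S3' S4} => a b c e S2 I1.
by apply/matrixP => i j; rewrite !mxE; ring.
Qed.

Lemma flow_adj S h : generator S -> (flow S h)^t* = flow S (- h).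
Proof.
move=> [SN _]; rewrite /flow sinN cosN.
have adjM (M N : 'M[C]_n) : (M *m N)^t* = N^t* *m M^t* by rewrite trmx_mul map_mxM.
have adjZ (c : R) (M : 'M[C]_n) : (c%:C *: M)^t* = c%:C *: M^t*.
  rewrite linearZ/= map_mxZ; congr (_ *: _).
  by apply/eqP; rewrite eq_complex/= oppr0 !eqxx.
rewrite !linearD/= !map_mxD !adjZ adjM SN trmx1 map_mx1 mulNmx mulmxN opprK.
by rewrite rmorphN/= scaleNr scalerN.
Qed.

Lemma flow_unitary S h : generator S -> (flow S h)^t* *m flow S h = 1%:M.
Proof. by move=> gS; rewrite flow_adj// -flowD// addNr flow0. Qed.

Definition quad B t : R := (plane_numerical_map B t).1.

Lemma quadE B t : quad B t = complex.Re (inner (B *m of_planes t) (of_planes t)).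
Proof. by []. Qed.

Lemma quadD B B' t : quad (B + B') t = quad B t + quad B' t.
Proof. by rewrite !quadE mulmxDl innerDl raddfD. Qed.

Lemma quadZ (c : R) B t : quad (c%:C *: B) t = c * quad B t.
Proof. by rewrite !quadE -scalemxAl innerZl Re_mul/= mul0r subr0. Qed.

(** Im z = Re (- i z): both coordinates of the numerical map are forms [quad], a family that is
    stable under the flow derivatives. *)
Lemma plane_numerical_map2 B t : (plane_numerical_map B t).2 = quad ((0 -i* 1) *: B) t.
Proof.
rewrite quadE -scalemxAl innerZl Re_mul /= mul0r sub0r mulN1r opprK.
by [].
Qed.

Lemma inner_adjr (M : 'M[C]_n) (x y : 'cV[C]_n) : inner (M^t* *m x) y = inner x (M *m y).
Proof.
by rewrite (inner_conj y) (inner_conj (M *m y)) inner_adj.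
Qed.

Lemma quad_act B (U : 'M[C]_n) t : quad B (act U t) = quad (U^t* *m B *m U) t.
Proof.
have := inner_adjr U; move: (U^t*) => V adj.
by rewrite !quadE of_planes_act -!mulmxA adj.
Qed.

(** The derivative at 0 of U^t* B U along U = [flow S h], as the adjoint of [S] is - [S]. *)
Definition lie_bracket B S := B *m S - S *m B.

Lemma flow_conjugate (a b : C) S S2 B :
  (1%:M - a *: S + b *: S2) *m B *m (1%:M + a *: S + b *: S2) =
  B + a *: lie_bracket B S + b *: (S2 *m B + B *m S2) + (a * a) *: - (S *m B *m S)
    + (b * a) *: (S2 *m B *m S - S *m B *m S2) + (b * b) *: (S2 *m B *m S2).
Proof.
rewrite /lie_bracket mulmxDl mulmxBl mul1mx mulmxDl mulmxBl !mulmxDr !mulmx1.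
rewrite -!scalemxAl -!scalemxAr -?scalemxAl.
move: (S2 *m B *m S2) (S2 *m B *m S) (S *m B *m S2) (S *m B *m S) => M1 M2 M3 M4.
move: (S *m B) (B *m S) (S2 *m B) (B *m S2) => M5 M6 M7 M8.
by apply/matrixP => i j; rewrite !mxE; ring.
Qed.

(** Conjugation by the flow gives a polynomial in sin h and 1 - cos h; only the term linear in sin
    h, the commutator, has a nonzero derivative at 0. *)
Lemma is_derive_quad B S t : generator S ->
  is_derive (0 : R) 1 (fun h : R => quad B (act (flow S h) t)) (quad (lie_bracket B S) t).
Proof.
move=> gS.
pose c1 := quad (lie_bracket B S) t.
pose c2 := quad (S *m S *m B + B *m (S *m S)) t.
pose c3 := quad (- (S *m B *m S)) t.
pose c4 := quad (S *m S *m B *m S - S *m B *m (S *m S)) t.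
pose c5 := quad (S *m S *m B *m (S *m S)) t.
have E h : quad B (act (flow S h) t) = quad B t + sin h * c1 + (1 - cos h) * c2 +
    sin h * sin h * c3 + (1 - cos h) * sin h * c4 + (1 - cos h) * (1 - cos h) * c5.
  rewrite quad_act flow_adj// /flow sinN cosN rmorphN scaleNr flow_conjugate.
  by rewrite !quadD -!rmorphM !quadZ.
under eq_fun do rewrite E.
apply: is_derive_eq.
rewrite /GRing.scale/= sin0 cos0 -/c1.
by move: c1 c2 c3 c4 c5 {E} => c1 c2 c3 c4 c5; ring.
Qed.


Lemma coord_le1 t i : plane_sphere t ->
  `|complex.Re (of_planes t i 0)| <= 1 /\ `|complex.Im (of_planes t i 0)| <= 1.
Proof.
move=> t1; have := sqr_planes_norm t; rewrite t1 expr1n (bigD1 i)//= mxE/= => H.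
have H' : 0 <= \sum_(j < n | j != i) ((tnth t j).1 ^+ 2 + (tnth t j).2 ^+ 2).
  by apply: sumr_ge0 => j _; rewrite addr_ge0 ?sqr_ge0.
have le1 (a b : R) : a ^+ 2 + b ^+ 2 <= 1 -> `|a| <= 1.
  by move=> ab; rewrite ler_norml; apply/andP; split; nra.
have ab : (tnth t i).1 ^+ 2 + (tnth t i).2 ^+ 2 <= 1 by rewrite [leRHS]H lerDl.
by split; [exact: le1 ab|apply: (le1 _ (tnth t i).1); rewrite addrC].
Qed.

Lemma bounded_mfun_quad B : bounded_mfun (@plane_sphere R n) (quad B).
Proof.
split.
  apply: measurable_funTS; apply: (measurableT_comp measurable_fst).
  exact: (measurable_funPT (plane_numerical_map B)).
(* Real and imaginary parts are bounded separately, which costs a factor 2 at each product; [K i j]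
   below collects these factors. *)
pose cle (z : C) (K : R) := `|complex.Re z| <= K /\ `|complex.Im z| <= K.
have cleM z w K L : cle z K -> cle w L -> cle (z * w) (2 * K * L).
  move=> [z1 z2] [w1 w2]; have E : 2 * K * L = K * L + K * L by ring.
  split; rewrite ?Re_mul ?Im_mul E.
    by rewrite (le_trans (ler_normB _ _))// !normrM lerD// ler_pM.
  by rewrite (le_trans (ler_normD _ _))// !normrM lerD// ler_pM.
pose K i j : R := 2 * 1 * (2 * Num.max `|complex.Re (B i j)| `|complex.Im (B i j)| * 1).
exists (\sum_i \sum_j K i j) => t t1.
have -> : quad B t = \sum_i \sum_j
    complex.Re ((of_planes t i 0)^* * (B i j * of_planes t j 0)).
  rewrite quadE /inner mxE Re_sum; apply: eq_bigr => i _.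
  by rewrite -Re_sum -mulr_sumr !mxE.
rewrite (le_trans (ler_norm_sum _ _ _))//; apply: ler_sum => i _.
rewrite (le_trans (ler_norm_sum _ _ _))//; apply: ler_sum => j _.
have xi := coord_le1 i t1; have xj := coord_le1 j t1.
have [] // : cle ((of_planes t i 0)^* * (B i j * of_planes t j 0)) (K i j).
apply: (cleM _ _); last first.
  by apply: (cleM _ _) => //; split; rewrite le_max lexx ?orbT.
by case: (of_planes t i 0) xi => a b /= [xa xb]; split; rewrite //= normrN.
Qed.

(** Over the reals these matrices span the skew-Hermitian ones, so the velocities S x at a unit
    vector x fill the tangent space of the sphere; [real_collinear] is the form in which this is
    used. *)
Definition elementary_generator (p : 'I_n * 'I_n * bool) : 'M[C]_n :=
  let: (i, j, b) := p in
  if i == j then imag *: delta_mx i i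
  else let s : C := if b then imag else 1 in s *: delta_mx i j - Num.conj s *: delta_mx j i.

Let delta_adj i j : (delta_mx i j : 'M[C]_n)^t* = delta_mx j i.
Proof. by rewrite trmx_delta; apply/matrixP => k l; rewrite !mxE rmorph_nat. Qed.

Let adjZ (c : C) (M : 'M[C]_n) : (c *: M)^t* = Num.conj c *: M^t*.
Proof. by rewrite linearZ/= map_mxZ. Qed.

Let conj_i : Num.conj imag = - imag.
Proof. by apply/eqP; rewrite eq_complex/= oppr0 !eqxx. Qed.

Let conj_1 : Num.conj (1 : C) = 1.
Proof. by apply/eqP; rewrite eq_complex/= oppr0 !eqxx. Qed.

Let sqr_i : imag * imag = -1.
Proof. by apply/eqP; rewrite eq_complex/= !mulr0 !mul0r !mul1r sub0r addr0 oppr0 !eqxx. Qed.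

Let pair_square (s : C) i j : i != j -> s * Num.conj s = 1 ->
  (s *: delta_mx i j - Num.conj s *: delta_mx j i) *m (s *: delta_mx i j - Num.conj s *: delta_mx j i) =
  - (delta_mx i i + delta_mx j j) :> 'M[C]_n.
Proof.
move=> ij s1; have ji : j != i by rewrite eq_sym.
rewrite mulmxBl !mulmxBr -!scalemxAl -!scalemxAr !scalerA.
rewrite !mul_delta_mx !mul_delta_mx_0// !scaler0 s1 (mulrC (Num.conj s)) s1 !scale1r.
by rewrite sub0r subr0 opprD.
Qed.

Lemma elementary_generatorP p : generator (elementary_generator p).
Proof.
case: p => -[i j] b; rewrite /elementary_generator; case: eqVneq => [_|ij].
  split; first by rewrite adjZ delta_adj conj_i scaleNr.
  rewrite -!scalemxAl -!scalemxAr -!scalemxAl !scalerA !mul_delta_mx.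
  by rewrite mulrA sqr_i mulN1r scaleNr.
set s : C := if b then imag else 1.
have s1 : s * Num.conj s = 1.
  by rewrite /s; case: (b); rewrite ?conj_i ?conj_1 ?mulr1// mulrN sqr_i opprK.
split.
  rewrite linearB/= map_mxB !adjZ !delta_adj opprB.
  have -> : Num.conj (Num.conj s) = s by exact: conjCK.
  by [].
rewrite pair_square// mulNmx mulmxDl !mulmxBr -!scalemxAr.
have ji : j != i by rewrite eq_sym.
by rewrite !mul_delta_mx !mul_delta_mx_0// !scaler0 subr0 sub0r.
Qed.

Let shear_product (a c : C) i j : i != j ->
  (1%:M + a *: delta_mx i j) *m (1%:M + c *: delta_mx j i) *m (1%:M + a *: delta_mx i j) =
  1%:M + (2 * a + a * (a * c)) *: delta_mx i j + c *: delta_mx j i +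
  (a * c) *: (delta_mx i i + delta_mx j j) :> 'M[C]_n.
Proof.
move=> ij; have ji : j != i by rewrite eq_sym.
have -> : (1%:M + a *: delta_mx i j) *m (1%:M + c *: delta_mx j i) =
    1%:M + c *: delta_mx j i + a *: delta_mx i j + (a * c) *: delta_mx i i :> 'M[C]_n.
  rewrite mulmxDl mul1mx mulmxDr mulmx1 -scalemxAl -scalemxAr mul_delta_mx scalerA.
  by rewrite !addrA.
rewrite mulmxDr mulmx1 -scalemxAr !mulmxDl mul1mx -!scalemxAl !mul_delta_mx.
rewrite mul_delta_mx_0// scaler0 addr0.
move: (delta_mx i j) (delta_mx j i) (delta_mx i i) (delta_mx j j) (1%:M) => E F G H I1.
by apply/matrixP => k l; rewrite !mxE; ring.
Qed.

(** Off the diagonal this is the factorization of a rotation into three shears, mixing two complex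
    coordinates: a = tan (h / 2) s in the outer factors and c = - sin h conj(s) in the middle one.
    On the diagonal the flow multiplies one coordinate by exp (i h). *)
Lemma preserves_flow p h : sin h != 0 -> preserves (flow (elementary_generator p) h).
Proof.
case: p => -[i j] b h0; rewrite /elementary_generator; case: eqVneq => [_|ij].
  have -> : flow (imag *: delta_mx i i) h = 1%:M + ((cos h - 1) +i* sin h) *: delta_mx i i.
    rewrite /flow -!scalemxAl -!scalemxAr !scalerA mul_delta_mx -mulrA sqr_i.
    rewrite -addrA -scalerDl; congr (_ + _ *: _).
    by apply/eqP; rewrite eq_complex/=; apply/andP; split; apply/eqP; ring.
  exact: preserves_phase.
set s : C := if b then imag else 1.
have s1 : s * Num.conj s = 1.
  by rewrite /s; case: (b); rewrite ?conj_i ?conj_1 ?mulr1// mulrN sqr_i opprK.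
have ji : j != i by rewrite eq_sym.
pose a := ((1 - cos h) / sin h)%:C * s; pose c := - (sin h)%:C * Num.conj s.
have -> : flow (s *: delta_mx i j - Num.conj s *: delta_mx j i) h =
    (1%:M + a *: delta_mx i j) *m (1%:M + c *: delta_mx j i) *m (1%:M + a *: delta_mx i j).
  rewrite shear_product// /flow pair_square//.
  have -> : a * c = - (1 - cos h)%:C.
    by rewrite /a /c mulrACA s1 mulr1 mulrN -rmorphM/= divfK.
  have -> : 2 * a + a * - (1 - cos h)%:C = (sin h)%:C * s.
    rewrite mulrC -mulrDr mulrAC /a; congr (_ * _).
    rewrite -(rmorph_nat (real_complex R)) -rmorphB -rmorphM/=; congr (_%:C).
    apply: (mulIf h0); rewrite mulrAC divfK// -expr2 sin2cos2; ring.
  rewrite /c scalerBr !scalerA mulNr scaleNr scalerN scaleNr.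
  by move: (1 - cos h)%:C => e; rewrite !addrA.
apply: preserves_mul; last exact: preserves_shear.
by apply: preserves_mul; exact: preserves_shear.
Qed.

End flow.

Lemma has_C_density_null (R : realType) (V : normedModType R) d (T : measurableType d)
    (psi : V -> T) (k : nat) (la : {measure set T -> \bar R}) (Q : set (set T))
    (nu : set T -> \bar R) E :
  has_C_density psi k la Q nu -> measurable E -> la E = 0%E -> nu E = 0%E.
Proof.
move=> [Gp [Gn [[mGp mGn] _ _ _ nuE]]] mE E0; have := nuE E mE.
by rewrite !null_set_integral ?adde0//; apply/measurable_EFinP; exact: measurable_funTS.
Qed.

Lemma probability_setI1 d (T : measurableType d) (R : realType) (P : probability T R) E D :
  measurable E -> measurable D -> P D = 1%E -> P (E `&` D) = P E.
Proof.
move=> mE mD D1; have E0 : P (E `\` D) = 0%E.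
  apply: (@subset_measure0 _ _ _ P _ (~` D)) => //.
  - exact: measurableD.
  - exact: measurableC.
  - have D0 : (1 - P D)%E = 0%E by rewrite D1 subee.
    exact: etrans (probability_setC P mD) D0.
have EE : (P (E `\` D) + P (E `&` D))%E = P (E `&` D) by rewrite E0 add0e.
exact: esym (etrans (measureDI P mE mD) EE).
Qed.

(** The sets where [g] exceeds 1 / (m + 1) exhaust the set where it is positive, and the m-th weight
    is positive on the m-th set. *)
Lemma negligible_weight d (T : measurableType d) (R : realType)
    (P : {finite_measure set T -> \bar R}) (D : set T) dS (S : measurableType dS)
    (X : {mfun T >-> S}) (g : T -> R) (q : nat) (E : set S) :
  measurable D -> measurable_fun D g -> measurable E ->
  (forall m, \int[P]_(t in D) (\1_E (X t) * pospow q (g t - m.+1%:R^-1))%:E = 0)%E ->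
  P.-negligible (D `&` X @^-1` E `&` [set t | 0 < g t]).
Proof.
move=> mD mg mE W0.
pose w m t := \1_E (X t) * pospow q (g t - m.+1%:R^-1).
have w0 m t : 0 <= w m t by rewrite /w mulr_ge0// pospow_ge0.
have mw m : measurable_fun D (EFin \o w m).
  apply/measurable_EFinP; apply: measurable_funM.
    apply: measurable_funTS; apply: (measurableT_comp (measurable_indic mE)) => //.
  apply: (measurableT_comp (measurable_pospow _)).
  by apply: measurable_funB => //; exact: measurable_cst.
have wn m : P.-negligible (D `&` [set t | w m t != 0]).
  have /(ae_eq_integral_abs P mD (mw m))[N [mN N0 DN]] : (\int[P]_(t in D) `|(EFin \o w m) t| = 0)%E.
    by rewrite -[RHS](W0 m); apply: eq_integral => t _; rewrite gee0_abs// lee_fin w0.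
  exists N; split => // t [Dt wt]; apply: DN => /= /(_ Dt) [w_0].
  by move: wt; rewrite /= w_0 eqxx.
apply: negligibleS (negligible_bigcup wn) => t [[Dt Et] gt].
have [m _ mgt] := near_infty_natSinv_lt (PosNum gt).
exists m => //; split => //=; rewrite gt_eqF// /w indicE mem_set// mul1r.
by apply: pospow_gt0; rewrite subr_gt0; exact: mgt m (leqnn m).
Qed.

(** * The numerical map along the unitary flows *)

Section numerical_flow.
Variables (R : realType) (n : nat).
Hypothesis n0 : (0 < n)%N.
Local Notation C := R[i].
Local Notation index := ('I_n * 'I_n * bool)%type.
Local Notation P := (surface_probability R n).
Local Notation D := (@plane_sphere R n).
Implicit Types (B : 'M[C]_n) (t : n.-tuple (plane R)) (p : index).

Definition numerical_flow p (h : R) t := act (flow (elementary_generator R p) h) t.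

Lemma numerical_flow0 p t : numerical_flow p 0 t = t.
Proof. by rewrite /numerical_flow flow0 act1. Qed.

Lemma numerical_flowD p h k t :
  numerical_flow p (h + k) t = numerical_flow p h (numerical_flow p k t).
Proof. by rewrite /numerical_flow flowD ?act_mul//; exact: elementary_generatorP. Qed.

Lemma preimage_numerical_flow p h : numerical_flow p h @^-1` D = D.
Proof. by apply: preimage_sphere; apply: flow_unitary; exact: elementary_generatorP. Qed.

Lemma numerical_flow_preserving p m : measure_preserving P (numerical_flow p m.+1%:R^-1).
Proof.
apply: measure_preserving_act => //.
  by apply: flow_unitary; exact: elementary_generatorP.
(* The time lies in ]0, 1], and 1 < 2 <= pi, so its sine is positive. *)
apply: preserves_flow; rewrite gt_eqF// sin_gt0_pi// invr_gt0 ltr0n/=.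
by rewrite (@le_lt_trans _ _ 1)// ?invf_le1 ?ler1n// (lt_le_trans _ (pi_ge2 _))// ltr1n.
Qed.

Local Notation fC := (flow_C D numerical_flow).

Lemma lie_quad B p t : D t ->
  lie numerical_flow p (quad B) t = quad (lie_bracket B (elementary_generator R p)) t.
Proof.
move=> Dt; have [|_ ->//] := @lieP _ _ R D _ numerical_flow p (quad B)
  (quad (lie_bracket B (elementary_generator R p))).
by move=> s _; apply: is_derive_quad; exact: elementary_generatorP.
Qed.

(** A flow derivative of a form is the form of a commutator, so boundedness of forms on the sphere
    gives all orders by induction. *)
Lemma flow_C_quad k B : fC k (quad B).
Proof.
elim: k B => [|k IH] B; split => //; try exact: bounded_mfun_quad.
move=> p; split.
  by move=> t _; have [] := is_derive_quad B t (elementary_generatorP R p).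
apply: (eq_flow_C preimage_numerical_flow _ (IH (lie_bracket B (elementary_generator R p)))).
by move=> t Dt; rewrite lie_quad.
Qed.

(** A cutoff of finite order made of two truncated powers: [v] is 0 where [r >= c] and at least 1
    where [r <= c / 2], and 1 - (1 - v)_+^(N+1) sends 0 to 0 and everything from 1 on to 1. *)
Lemma flow_C_cutoff N (r : n.-tuple (plane R) -> R) (c : R) : 0 < c -> fC N r ->
  exists W, [/\ fC N W, supported D (fun t => c - r t) W,
    forall t, D t -> 0 <= W t & forall t, r t <= c / 2 -> W t = 1].
Proof.
move=> c0 Cr.
have CB := flow_CB numerical_flow0 preimage_numerical_flow.
have CM := flow_CM numerical_flow0 preimage_numerical_flow.
have CP := flow_C_pospow numerical_flow0 preimage_numerical_flow.
have Ccst k e := flow_C_cst preimage_numerical_flow k e.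
pose v t := pospow N.+1 (2 / c * (c - r t)).
have Cv : fC N v.
  apply: (CP _ _ (fun t => 2 / c * (c - r t))) => //.
  by apply: (CM _ (cst (2 / c))) => //; apply: (CB _ (cst c)).
have v0 t : 0 <= v t by exact: pospow_ge0.
pose w t := pospow N.+1 (1 - v t).
have Cw : fC N w.
  by apply: (CP _ _ (fun t => 1 - v t)) => //; apply: (CB _ (cst 1)).
exists (fun t => 1 - w t); split.
- by apply: (CB _ (cst 1)).
- move=> t _ rt; rewrite /w (_ : v t = 0).
    by rewrite subr0 /pospow ltr01 expr1n subrr.
  by apply: pospow_le0; rewrite mulr_ge0_le0 ?divr_ge0// ltW.
- move=> t _; rewrite subr_ge0 /w /pospow; case: ifP => // vt.
  by rewrite exprn_ile1 ?(ltW vt)// gerBl.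
- move=> t rt; rewrite /w pospow_le0 ?subr0// subr_le0 /v /pospow.
  have h : 1 <= 2 / c * (c - r t).
    rewrite mulrAC ler_pdivlMr// mul1r; lra.
  by rewrite (lt_le_trans ltr01 h) exprn_ege1.
Qed.

Section plane.
Variable A : 'M[C]_n.
Local Notation X := (plane_numerical_map A).

Let mD : measurable D := @measurable_plane_sphere R n.

Let CX1 k : fC k (fun t => (X t).1).
Proof. exact: flow_C_quad. Qed.

Let CX2 k : fC k (fun t => (X t).2).
Proof.
apply: (eq_flow_C preimage_numerical_flow _ (flow_C_quad k ((0 -i* 1) *: A))) => t _.
by rewrite plane_numerical_map2.
Qed.

Definition plane_minor2 := lie_minor2 numerical_flow X.

Let C2 k : fC k plane_minor2.
Proof. exact: (flow_C_lie_minor2 numerical_flow0 preimage_numerical_flow CX1 CX2). Qed.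

Let density := has_C_density_flow_plane mD numerical_flow0 numerical_flowD
  preimage_numerical_flow numerical_flow_preserving CX1 CX2.

Lemma numerical_null E : measurable E -> lebesgue_plane E = 0%E ->
  P.-negligible (D `&` X @^-1` E `&` [set t | 0 < plane_minor2 t]).
Proof.
(* A continuous density, the case k = 0, asks for a weight in [flow_C] 4, and a truncated power of
   exponent 5 has four bounded derivatives. *)
move=> mE E0; apply: (negligible_weight (q := 5)) => // [|m].
  by have [] := flow_C_bounded (C2 0).
pose a : R := m.+1%:R^-1; have a0 : 0 < a by rewrite invr_gt0.
have Cu k : fC k (plane_minor2 \- cst a).
  apply: (flow_CB numerical_flow0 preimage_numerical_flow); first exact: C2.
  exact: (flow_C_cst preimage_numerical_flow).
(* With [u] = Delta - a and margin a / 2, either Delta is at least a / 2 or - u is. *)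
have d := @density (plane_minor2 \- cst a) (a / 2) (pospow 5 \o (plane_minor2 \- cst a)) 0.
apply: (has_C_density_null (d _ _ _ _ _ _) mE E0).
- by rewrite divr_gt0.
- exact: Cu.
- by move=> t _ /=; case: (leP (a / 2) (plane_minor2 t)) => h; [left|right; lra].
- by apply: (flow_C_pospow numerical_flow0 preimage_numerical_flow) => //; exact: Cu.
- by move=> t _ ut; rewrite /= pospow_le0// ltW.
- by move=> t _; exact: pospow_ge0.
Qed.

(** The cutoff equals 1 where |X - z|^2 <= c / 2, so over that disc the weighted law is the
    numerical measure itself; on its support |X - z|^2 <= c, where the hypothesis forces Delta >=
    c. *)
Lemma local_numerical_density (z : R * R) (c : R) k : 0 < c ->
  (forall t, D t -> 2 * c <= plane_minor2 t + (((X t).1 - z.1) ^+ 2 + ((X t).2 - z.2) ^+ 2)) ->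
  exists nu, has_C_density (idfun : R * R -> plane R) k lebesgue_plane (@quadrants R) nu /\
    forall E : set (plane R), measurable E -> E `<=` [set y | (y.1 - z.1) ^+ 2 + (y.2 - z.2) ^+ 2 <= c / 2] ->
      nu E = numerical_measure A E.
Proof.
move=> c0 Hc; pose r t := ((X t).1 - z.1) ^+ 2 + ((X t).2 - z.2) ^+ 2.
have Cr j : fC j r.
  have CB := flow_CB numerical_flow0 preimage_numerical_flow.
  have CM := flow_CM numerical_flow0 preimage_numerical_flow.
  have Ccst e := flow_C_cst preimage_numerical_flow j e.
  have C1 := CB _ _ _ (CX1 j) (Ccst z.1); have C2' := CB _ _ _ (CX2 j) (Ccst z.2).
  have C11 := CM _ _ _ C1 C1.
  have C22 := CM _ _ _ C2' C2'.
  have C12 := flow_CD preimage_numerical_flow C11 C22.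
  by apply: (eq_flow_C preimage_numerical_flow _ C12).
have Cu j : fC j (fun t => c - r t).
  apply: (flow_CB numerical_flow0 preimage_numerical_flow (f := cst c)); last exact: Cr.
  exact: (flow_C_cst preimage_numerical_flow).
have [W [CW uW W0 W1]] := flow_C_cutoff c0 (Cr (k.+2 + k.+2)%N).
exists (fun E => \int[P]_(t in D) (\1_E (X t) * W t)%:E)%E; split.
  apply: (density (u := fun t => c - r t) (e := c / 2)) => //.
    by rewrite divr_gt0.
  (* If Delta < c / 2, then r > 3 c / 2, so that r - c exceeds c / 2. *)
  move=> t Dt; have := Hc t Dt; rewrite -/(r t) -/(plane_minor2 t) => h.
  by case: (leP (c / 2) (plane_minor2 t)) => h'; [left|right; lra].
move=> E mE Ez.
rewrite (eq_integral (fun t => (\1_(X @^-1` E) t)%:E)); last first.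
  move=> t _; congr EFin; rewrite !indicE; case: (boolP (X t \in E)) => XE.
    rewrite mem_set ?mul1r//; last exact: set_mem.
    by rewrite W1//; apply: (Ez (X t)); exact: set_mem.
  rewrite mul0r (_ : (t \in _) = false)//; apply/negbTE/negP => /set_mem h.
  by move/negP : XE; apply; exact: mem_set.
have mXE : measurable (X @^-1` E) by rewrite -[X in measurable X]setTI; exact: measurable_funPT.
rewrite integral_indic//.
have -> : numerical_measure A E = P (X @^-1` E) by [].
by apply: probability_setI1 => //; exact: surface_probability_sphere n0.
Qed.

End plane.

Section line.
Variable A : 'M[C]_n.

Definition real_numerical_map (t : n.-tuple (plane R)) : measurableTypeR R := quad A t.

Let measurable_real_numerical_map : measurable_fun setT real_numerical_map.
Proof.
apply: (measurableT_comp measurable_fst).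
exact: (measurable_funPT (plane_numerical_map A)).
Qed.

HB.instance Definition _ := isMeasurableFun.Build _ _ _ _ real_numerical_map
  measurable_real_numerical_map.

Local Notation X := real_numerical_map.

Let mD : measurable D := @measurable_plane_sphere R n.

Let CX k : fC k X.
Proof. exact: flow_C_quad. Qed.

Definition real_norm2 := lie_norm2 numerical_flow X.

Let C2 k : fC k real_norm2.
Proof. exact: (flow_C_lie_norm2 numerical_flow0 preimage_numerical_flow CX). Qed.

Let density := has_C_density_flow_line mD numerical_flow0 numerical_flowD
  preimage_numerical_flow numerical_flow_preserving CX.

Lemma real_numerical_null E : measurable E -> lebesgue_measure E = 0%E ->
  P.-negligible (D `&` X @^-1` E `&` [set t | 0 < real_norm2 t]).
Proof.
move=> mE E0; apply: (negligible_weight (q := 5)) => // [|m].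
  by have [] := flow_C_bounded (C2 0).
pose a : R := m.+1%:R^-1; have a0 : 0 < a by rewrite invr_gt0.
have Cu k : fC k (real_norm2 \- cst a).
  apply: (flow_CB numerical_flow0 preimage_numerical_flow); first exact: C2.
  exact: (flow_C_cst preimage_numerical_flow).
have d := @density (real_norm2 \- cst a) (a / 2) (pospow 5 \o (real_norm2 \- cst a)) 0.
apply: (has_C_density_null (d _ _ _ _ _ _) mE E0).
- by rewrite divr_gt0.
- exact: Cu.
- by move=> t _ /=; case: (leP (a / 2) (real_norm2 t)) => h; [left|right; lra].
- by apply: (flow_C_pospow numerical_flow0 preimage_numerical_flow) => //; exact: Cu.
- by move=> t _ ut; rewrite /= pospow_le0// ltW.
- by move=> t _; exact: pospow_ge0.
Qed.

Lemma local_real_numerical_density (z : R) (c : R) k : 0 < c ->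
  (forall t, D t -> 2 * c <= real_norm2 t + (X t - z) ^+ 2) ->
  exists nu, has_C_density (idfun : R -> measurableTypeR R) k lebesgue_measure (@rays R) nu /\
    forall E : set (measurableTypeR R), measurable E -> E `<=` [set y | (y - z) ^+ 2 <= c / 2] ->
      nu E = real_numerical_measure A E.
Proof.
move=> c0 Hc; pose r t := (X t - z) ^+ 2.
have Cr j : fC j r.
  have CB := flow_CB numerical_flow0 preimage_numerical_flow.
  have CM := flow_CM numerical_flow0 preimage_numerical_flow.
  have Ccst e := flow_C_cst preimage_numerical_flow j e.
  have C1 := CB _ _ _ (CX j) (Ccst z).
  by apply: (eq_flow_C preimage_numerical_flow _ (CM _ _ _ C1 C1)).
have Cu j : fC j (fun t => c - r t).
  apply: (flow_CB numerical_flow0 preimage_numerical_flow (f := cst c)); last exact: Cr.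
  exact: (flow_C_cst preimage_numerical_flow).
have [W [CW uW W0 W1]] := flow_C_cutoff c0 (Cr k.+2).
exists (fun E => \int[P]_(t in D) (\1_E (X t) * W t)%:E)%E; split.
  apply: (density (u := fun t => c - r t) (e := c / 2)) => //.
    by rewrite divr_gt0.
  move=> t Dt; have := Hc t Dt; rewrite -/(r t) -/(real_norm2 t) => h.
  by case: (leP (c / 2) (real_norm2 t)) => h'; [left|right; lra].
move=> E mE Ez.
rewrite (eq_integral (fun t => (\1_(X @^-1` E) t)%:E)); last first.
  move=> t _; congr EFin; rewrite !indicE; case: (boolP (X t \in E)) => XE.
    rewrite mem_set ?mul1r//; last exact: set_mem.
    by rewrite W1//; apply: (Ez (X t)); exact: set_mem.
  rewrite mul0r (_ : (t \in _) = false)//; apply/negbTE/negP => /set_mem h.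
  by move/negP : XE; apply; exact: mem_set.
have mXE : measurable (X @^-1` E) by rewrite -[X in measurable X]setTI; exact: measurable_funPT.
rewrite integral_indic//.
have -> : real_numerical_measure A E = P (X @^-1` E) by [].
by apply: probability_setI1 => //; exact: surface_probability_sphere n0.
Qed.

End line.

End numerical_flow.

(** * Degenerate points *)

Lemma minors_dependent (R : realType) (I : Type) (u v : I -> R) :
  (forall p q, u p * v q - u q * v p = 0) ->
  exists a b : R, (a != 0) || (b != 0) /\ forall p, a * u p + b * v p = 0.
Proof.
move=> uv0; have [[p up]|h] := pselect (exists p, u p != 0).
  exists (v p), (- u p); rewrite oppr_eq0 up orbT; split => // q.
  by rewrite -(uv0 q p); ring.
exists 1, 0; rewrite oner_eq0; split => // p; rewrite mul1r mul0r addr0.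
by apply/eqP; apply: contra_notT h => ?; exists p.
Qed.

Section degeneracy.
Variables (R : realType) (n : nat).
Local Notation C := R[i].
Implicit Types (A B H K M S : 'M[C]_n) (x y v : 'cV[C]_n) (t : n.-tuple (plane R)).

Lemma innerNl x y : inner (- x) y = - inner x y.
Proof. by rewrite -scaleN1r innerZl mulN1r. Qed.

Lemma innerNr x y : inner x (- y) = - inner x y.
Proof.
apply/eqP; rewrite -addr_eq0 -innerDr addNr.
by rewrite /inner trmx0 map_mx0 mul0mx mxE.
Qed.

Lemma Re_innerC x y : complex.Re (inner x y) = complex.Re (inner y x).
Proof. by rewrite inner_conj; case: (inner y x). Qed.

(* A copy of M^t* whose type does not mention the closed field structure of C. *)
Definition adjoint M : 'M[C]_n := M^t*.

Lemma inner_adjoint M x y : inner (M *m x) y = inner x (adjoint M *m y).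
Proof. exact: inner_adj. Qed.

Lemma quad_bracketE B S t : adjoint S = - S -> quad (lie_bracket B S) t =
  complex.Re (inner ((B + adjoint B) *m of_planes t) (S *m of_planes t)).
Proof.
move=> SN; rewrite quadE /lie_bracket mulmxBl mulmxDl.
rewrite innerDl innerNl innerDl !raddfD raddfN/= addrC; congr (_ + _).
  by rewrite -mulmxA (inner_adjoint S) SN mulNmx innerNr raddfN/= opprK.
by rewrite -mulmxA (inner_adjoint B) Re_innerC.
Qed.

Lemma inner_sum x y : inner x y = \sum_i Num.conj (y i 0) * x i 0.
Proof. by rewrite /inner mxE; apply: eq_bigr => i _; rewrite !mxE. Qed.

Lemma inner_delta (c : C) (i j : 'I_n) y x :
  inner y (c *: delta_mx i j *m x) = Num.conj (c * x j 0) * y i 0.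
Proof.
rewrite inner_sum (bigD1 i)//= big1 ?addr0 => [|k ki].
  rewrite -scalemxAl mxE mxE (bigD1 j)//= big1 ?addr0 => [|l lj].
    by rewrite mxE !eqxx mul1r.
  by rewrite mxE (negbTE lj) andbF mul0r.
rewrite -scalemxAl mxE mxE big1 ?mulr0 ?conjC0 ?mul0r// => l _.
by rewrite mxE (negbTE ki) mul0r.
Qed.

Lemma inner_elementary_generator (i j : 'I_n) b y x : i != j ->
  inner y (elementary_generator R (i, j, b) *m x) =
  let s : C := if b then 'i else 1 in
  Num.conj (s * x j 0) * y i 0 - Num.conj (Num.conj s * x i 0) * y j 0.
Proof.
move=> ij; rewrite /elementary_generator (negbTE ij) mulmxBl.
by rewrite innerDr innerNr inner_delta inner_delta.
Qed.

(** The hypothesis makes [y] orthogonal, for the real inner product, to every velocity at [x]; such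
    a vector is normal to the sphere through [x]. *)
Lemma real_collinear x y : x != 0 ->
  (forall p, complex.Re (inner y (elementary_generator R p *m x)) = 0) ->
  exists l : R, y = l%:C *: x.
Proof.
move=> x0 H.
(* This says that the matrix y x^t* is Hermitian. Off the diagonal the parameters s = 1 and s = i
   give its real and imaginary parts; on the diagonal the generator i E_ii is used. *)
have E i j : Num.conj (x j 0) * y i 0 = x i 0 * Num.conj (y j 0).
  have [<-|ij] := eqVneq i j.
    have := H (i, i, true); rewrite /elementary_generator eqxx inner_delta.
    case: (x i 0) (y i 0) => [a b] [c e] /= h.
    have h1 : a * e = b * c by apply/eqP; rewrite -subr_eq0 -h; apply/eqP; ring.
    apply/eqP; rewrite eq_complex/=; apply/andP; split; apply/eqP; first by ring.
    by rewrite mulNr mulrN h1; ring.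
  have := H (i, j, true); rewrite (inner_elementary_generator _ _ _ ij).
  have := H (i, j, false); rewrite (inner_elementary_generator _ _ _ ij).
  move: (x i 0) (y i 0) (x j 0) (y j 0) {H} => [a b] [c e] [a' b'] [c' e'] /= h h'.
  apply/eqP; rewrite eq_complex/=; apply/andP; split; apply/eqP.
    by apply/eqP; rewrite -subr_eq0 -h; apply/eqP; ring.
  by apply/eqP; rewrite -subr_eq0 -h'; apply/eqP; ring.
have [j xj] : exists j, x j 0 != 0.
  apply/existsP; apply: contra_neqT x0 => /existsPn h; apply/colP => j.
  by rewrite mxE; apply/eqP; have := h j; rewrite negbK.
pose m := Num.conj (y j 0) / Num.conj (x j 0).
have cx : Num.conj (x j 0) != 0 by rewrite conjC_eq0.
have ym i : y i 0 = m * x i 0.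
  by apply: (mulfI cx); rewrite E /m; field.
have mr : complex.Im m = 0.
  have := E j j; rewrite ym; move: (x j 0) xj m {cx ym E} => [a b] + [c e] /=.
  rewrite eq_complex/= => ab /eqP; rewrite eq_complex/= => /andP[_ /eqP h].
  have {}h : 2 * e * (a ^+ 2 + b ^+ 2) = 0 by lra.
  move/eqP: h; rewrite !mulf_eq0 pnatr_eq0/= => /orP[/eqP//|].
  by rewrite paddr_eq0 ?sqr_ge0// !sqrf_eq0 (negbTE ab).
exists (complex.Re m); apply/colP => i; rewrite ym mxE; congr (_ * _).
by move: mr; case: (m) => a b /= ->.
Qed.

Lemma innerZr_real x y (h : R) : inner x (h%:C *: y) = h%:C * inner x y.
Proof.
by rewrite innerZr; congr (_ * _); apply/eqP; rewrite eq_complex/= oppr0 !eqxx.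
Qed.

Lemma numerical_mapD A x v (h : R) : numerical_map A (x + h%:C *: v) =
  numerical_map A x + h%:C * (inner (A *m x) v + inner (A *m v) x) + (h ^+ 2)%:C * numerical_map A v.
Proof.
rewrite /numerical_map mulmxDr -scalemxAr !innerDl !innerDr !innerZl !innerZr_real.
rewrite (_ : (h ^+ 2)%:C = h%:C * h%:C); last by rewrite expr2 rmorphM.
move: (inner (A *m x) x) (inner (A *m x) v) (inner (A *m v) x) (inner (A *m v) v) => a b c e.
by move: h%:C => k; ring.
Qed.

Lemma differentialE A x v :
  differential A x v = to_plane (inner (A *m x) v + inner (A *m v) x).
Proof.
pose w := inner (A *m x) v + inner (A *m v) x; pose q := numerical_map A v.
rewrite /differential /derive1.
apply: (@cvg_lim _ (@norm_hausdorff R (R * R)%type)); apply: (@cvg_trans _ ((fun h : R =>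
    (complex.Re w + h * complex.Re q, complex.Im w + h * complex.Im q)) @ 0^')).
  apply: near_eq_cvg; near=> h.
  have h0 : h != 0 by near: h; exact: nbhs_dnbhs_neq.
  rewrite addr0 !numerical_mapD -/w -/q /to_plane.
  move: (numerical_map A x) w q => [a b] [c e] [f g] /=.
  apply: injective_projections; rewrite /= /GRing.scale/=; field; exact: h0.
have c0 : h @[h --> 0^'] --> (0 : R) by exact: cvg_within.
have lin (a b : R) : a + h * b @[h --> 0^'] --> a.
  rewrite -[X in _ --> X]addr0 -[X in _ --> _ + X](mul0r b).
  by apply: cvgD; [exact: cvg_cst|apply: cvgM => //; exact: cvg_cst].
exact: (cvg_pair (lin _ _) (lin _ _)).
Unshelve. all: by end_near. Qed.

Definition hermitian_part A := A + adjoint A.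

(** For a unit vector [x]: the combination a dX1 + b dX2 of the two coordinates of the differential
    vanishes on the tangent space, since its gradient, the vector on the left, is normal to the
    sphere. [hermitian_part] is twice the usual Hermitian part. *)
Definition degenerate A x := exists a b l : R, ((a != 0) || (b != 0)) /\
  hermitian_part ((a -i* b) *: A) *m x = l%:C *: x.

Lemma Re_differential A x v (a b : R) :
  a * (differential A x v).1 + b * (differential A x v).2 =
  complex.Re (inner (hermitian_part ((a -i* b) *: A) *m x) v).
Proof.
rewrite differentialE /hermitian_part mulmxDl innerDl raddfD/=.
rewrite [X in _ = _ + X]Re_innerC -inner_adjoint -!scalemxAl !innerZl !Re_mul/=.
by move: (inner (A *m x) v) (inner (A *m v) x) => [c e] [f g] /=; ring.
Qed.

(** The differential takes its values in the line orthogonal to (a, b), so it never attains (a,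
    b). *)
Lemma degenerate_critical A x : unit_sphere x -> degenerate A x -> critical_point A x.
Proof.
move=> x1 [a [b [l [ab Hx]]]]; split => //; apply/eqP/negP => /eqP/seteqP[_ /(_ (a, b) I)[v xv dv]].
have := Re_differential A x v a b; rewrite dv Hx innerZl Re_mul/= mul0r subr0.
rewrite Re_innerC xv mulr0 => /eqP; rewrite -!expr2 paddr_eq0 ?sqr_ge0// !sqrf_eq0.
by case/orP: ab => /negbTE ->; rewrite ?andbF.
Qed.


Lemma adjoint_generator p : adjoint (elementary_generator R p) = - elementary_generator R p.
Proof. by case: (elementary_generatorP R p). Qed.

Lemma plane_sphere_neq0 t : plane_sphere t -> of_planes t != 0.
Proof.
move=> t1; apply/negP => /eqP t0; move: t1; rewrite /plane_sphere /= /planes_norm /cnorm t0.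
by rewrite /inner mulmx0 mxE sqrtr0 => /eqP; rewrite eq_sym oner_eq0.
Qed.

Lemma quad_bracket_comb A S t (a b : R) : quad (lie_bracket ((a -i* b) *: A) S) t =
  a * quad (lie_bracket A S) t + b * quad (lie_bracket ((0 -i* 1) *: A) S) t.
Proof.
rewrite -!quadZ -quadD.
rewrite (_ : lie_bracket _ _ = a%:C *: lie_bracket A S + b%:C *: lie_bracket ((0 -i* 1) *: A) S)//.
rewrite /lie_bracket -!scalemxAl -!scalemxAr.
have -> : a -i* b = a%:C + b%:C * (0 -i* 1) :> C.
  by apply/eqP; rewrite eq_complex/=; apply/andP; split; apply/eqP; ring.
move: (A *m S) (S *m A) => U V.
by apply/matrixP => i j; rewrite !mxE; ring.
Qed.

(** All minors vanish, so one combination of the two families of flow derivatives is zero; its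
    gradient is orthogonal to every velocity, and [real_collinear] makes it a multiple of the
    point. *)
Lemma plane_minor2_degenerate A t : plane_sphere t -> plane_minor2 A t = 0 ->
  degenerate A (of_planes t).
Proof.
move=> Dt D0.
pose d1 p := quad (lie_bracket A (elementary_generator R p)) t.
pose d2 p := quad (lie_bracket ((0 -i* 1) *: A) (elementary_generator R p)) t.
have minor0 p q : d1 p * d2 q - d1 q * d2 p = 0.
  have mE : lie_minor (@numerical_flow R n) (plane_numerical_map A) p q t = d1 p * d2 q - d1 q * d2 p.
    rewrite /lie_minor.
    have e1 r : lie (@numerical_flow R n) r (fun t => (plane_numerical_map A t).1) t = d1 r.
      exact: (lie_quad A r Dt).
    have e2 r : lie (@numerical_flow R n) r (fun t => (plane_numerical_map A t).2) t = d2 r.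
      rewrite (_ : (fun s => _) = quad ((0 -i* 1) *: A)); first exact: lie_quad.
      by apply/funext => s; rewrite plane_numerical_map2.
    by rewrite !e1 !e2.
  move/eqP: D0; rewrite psumr_eq0 => [/allP/(_ p)|i _]; last first.
    by apply: sumr_ge0 => j _; rewrite sqr_ge0.
  rewrite mem_index_enum => /(_ isT)/=; rewrite psumr_eq0 => [/allP/(_ q)|j _]; last first.
    by rewrite sqr_ge0.
  by rewrite mem_index_enum => /(_ isT)/=; rewrite sqrf_eq0 mE => /eqP.
have [a [b [ab dab]]] := minors_dependent minor0.
have [|l Hl] := @real_collinear (of_planes t) (hermitian_part ((a -i* b) *: A) *m of_planes t)
  (plane_sphere_neq0 Dt).
  move=> p; rewrite -[RHS](dab p) -quad_bracket_comb.
  by rewrite quad_bracketE//; exact: adjoint_generator.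
by exists a, b, l.
Qed.

End degeneracy.

Section nondegeneracy.
Variables (R : realType) (n : nat).
Local Notation C := R[i].
Implicit Types (A B H K M S : 'M[C]_n) (x y v : 'cV[C]_n) (t : n.-tuple (plane R)).

Lemma real_norm2_eigenvector A t : adjoint A = A -> plane_sphere t -> real_norm2 A t = 0 ->
  exists l : R, A *m of_planes t = l%:C *: of_planes t.
Proof.
move=> AA Dt D0.
have d0 p : quad (lie_bracket A (elementary_generator R p)) t = 0.
  have e : lie (@numerical_flow R n) p (real_numerical_map A) t =
      quad (lie_bracket A (elementary_generator R p)) t by exact: (lie_quad A p Dt).
  move/eqP: D0; rewrite psumr_eq0 => [/allP/(_ p)|i _]; last by rewrite sqr_ge0.
  by rewrite mem_index_enum => /(_ isT)/=; rewrite sqrf_eq0 e => /eqP.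
have [|l Hl] := @real_collinear _ _ (of_planes t) ((A + adjoint A) *m of_planes t)
  (plane_sphere_neq0 Dt).
  by move=> p; rewrite -(d0 p) quad_bracketE//; exact: adjoint_generator.
exists (l / 2); move: Hl; rewrite AA mulmxDl => Hl.
have -> : (l / 2)%:C = l%:C / 2 :> C by rewrite rmorphM fmorphV rmorph_nat.
move: (A *m of_planes t) (of_planes t) l%:C Hl => z x c /colP Hz.
by apply/colP => i; have := Hz i; rewrite !mxE mulrAC => <-; field.
Qed.

Lemma inner_diag x : inner x x = (complex.Re (inner x x))%:C.
Proof.
by have := inner_conj x x; case: (inner x x) => a b [] /= h;
  apply/eqP; rewrite eq_complex/= eqxx/=; apply/eqP; lra.
Qed.

Lemma inner_diag_gt0 x : x != 0 -> 0 < complex.Re (inner x x).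
Proof.
move=> x0; have [i xi] : exists i, x i 0 != 0.
  apply/existsP; apply: contra_neqT x0 => /existsPn h; apply/colP => j.
  by rewrite mxE; apply/eqP; have := h j; rewrite negbK.
have sq (z : C) : complex.Re (Num.conj z * z) = complex.Re z ^+ 2 + complex.Im z ^+ 2.
  by case: z => a b /=; ring.
rewrite inner_sum Re_sum (bigD1 i)//= sq ltr_wpDr//.
  by apply: sumr_ge0 => j _; rewrite sq addr_ge0 ?sqr_ge0.
move: xi; case: (x i 0) => a b; rewrite eq_complex/= negb_and => ab.
by rewrite lt_neqAle addr_ge0 ?sqr_ge0// eq_sym paddr_eq0 ?sqr_ge0// !sqrf_eq0 negb_and ab.
Qed.

Lemma mulmx_delta M (i : 'I_n) : M *m delta_mx i 0 = col i M :> 'cV[C]_n.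
Proof. by rewrite colE. Qed.

Lemma mulmx_eq0 M : (forall x, M *m x = 0) -> M = 0.
Proof.
move=> M0; apply/matrixP => i j; have := M0 (delta_mx j 0).
by rewrite mulmx_delta => /colP/(_ i); rewrite !mxE.
Qed.

(** Basis vectors make [M] diagonal, and sums of two of them make its diagonal entries equal. *)
Lemma all_eigenvectors M : (forall x, exists l : R, M *m x = l%:C *: x) ->
  exists l : R, M = l%:C%:M.
Proof.
move=> HM.
have [l Hl] := choice (fun i : 'I_n => HM (delta_mx i 0)).
have Mij i j : M i j = (l j)%:C * (i == j)%:R.
  by have /colP/(_ i) := Hl j; rewrite mulmx_delta !mxE eqxx andbT.
have ll i j : l i = l j.
  have [->//|ij] := eqVneq i j.
  have [c Hc] := HM (delta_mx i 0 + delta_mx j 0).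
  move: Hc; rewrite mulmxDr !mulmx_delta => /colP Hc.
  have := Hc i; have := Hc j; rewrite !mxE !Mij !eqxx/= (negbTE ij) eq_sym (negbTE ij)/=.
  by rewrite ?mulr0 ?addr0 ?add0r !mulr1 => -[->] [->].
case: (posnP n) => [n0|n0].
  exists 0; apply/matrixP => i; have := ltn_ord i; rewrite {2}n0.
  by [].
exists (l (Ordinal n0)); apply/matrixP => i j; rewrite Mij mxE (ll j (Ordinal n0)).
exact: mulr_natr.
Qed.

(** The coefficients in the hypothesis may depend on [x]; the point is to make them constant. Unless
    [H] is scalar there is [x0] that is not an eigenvector of [H], and the combination found at [x0]
    turns out to work for all vectors. *)
Lemma hermitian_pair H K : adjoint H = H -> adjoint K = K ->
  (forall x, exists a b l : R, ((a != 0) || (b != 0)) /\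
    a%:C *: (H *m x) + b%:C *: (K *m x) = l%:C *: x) ->
  exists a b l : R, ((a != 0) || (b != 0)) /\ a%:C *: H + b%:C *: K = l%:C%:M.
Proof.
move=> HH KK HK.
have [/all_eigenvectors[l Hl]|] := pselect (forall x, exists l : R, H *m x = l%:C *: x).
  by exists 1, 0, l; rewrite oner_eq0; split => //; rewrite scale1r scale0r addr0.
move=> /existsNP[x0 Hx0].
have x00 : x0 != 0.
  by apply/negP => /eqP x00; apply: Hx0; exists 0; rewrite x00 mulmx0 scaler0.
have n0 := inner_diag_gt0 x00.
have [a [b [l [ab Hab]]]] := HK x0.
have RC (r : R) : r != 0 -> r%:C != 0 :> C by rewrite fmorph_eq0.
have b0 : b != 0.
  apply/negP => /eqP b0; apply: Hx0; move: ab Hab; rewrite b0 eqxx orbF => a0.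
  rewrite scale0r addr0 => Hab; exists (l / a).
  by rewrite rmorphM fmorphV mulrC -scalerA -Hab scalerA mulVf ?scale1r// RC.
(* The pair is normalized at [x0]: [K'] kills [x0], and [q], the image of [x0] under [H'], is
   nonzero and orthogonal to [x0]. This only changes the coefficients a, b, l of the relations. *)
pose c := a / b; pose m := l / b.
pose K' := K + c%:C *: H - m%:C%:M.
pose r0 := complex.Re (inner (H *m x0) x0) / complex.Re (inner x0 x0).
pose H' := H - r0%:C%:M.
have scM (r : R) x : r%:C%:M *m x = r%:C *: x by rewrite mul_scalar_mx.
have K'x0 : K' *m x0 = 0.
  rewrite /K' mulmxBl mulmxDl scM -scalemxAl.
  apply: (scalerI (RC _ b0)); rewrite scaler0 scalerBr scalerDr !scalerA -!rmorphM/=.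
  have -> : b * c = a by rewrite mulrC divfK.
  have -> : b * m = l by rewrite mulrC divfK.
  by apply/eqP; rewrite subr_eq0 addrC Hab.
have adjR (r : R) x y : inner (r%:C *: x) y = inner x (r%:C *: y).
  by rewrite innerZl innerZr_real.
have H'sym x y : inner (H' *m x) y = inner x (H' *m y).
  by rewrite /H' !mulmxBl !innerDl !innerDr innerNl innerNr inner_adjoint HH !scM adjR.
have K'sym x y : inner (K' *m x) y = inner x (K' *m y).
  rewrite /K' !mulmxBl !mulmxDl !innerDl !innerDr innerNl innerNr !scM adjR.
  have -> : inner (c%:C *: H *m x) y = inner x (c%:C *: H *m y).
    rewrite -[_ *: H *m x]scalemxAl -[_ *: H *m y]scalemxAl innerZl innerZr_real.
    by rewrite (inner_adjoint H) HH.
  by rewrite (inner_adjoint K) KK.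
pose q := H' *m x0.
have q0 : q != 0.
  apply/negP => /eqP; rewrite /q /H' mulmxBl scM => /eqP; rewrite subr_eq0 => /eqP h.
  by apply: Hx0; exists r0.
have qx0 : inner q x0 = 0.
  have Hd : inner (H *m x0) x0 = (complex.Re (inner (H *m x0) x0))%:C.
    have := inner_conj (H *m x0) x0; rewrite -{1}HH -inner_adjoint.
    case: (inner (H *m x0) x0) => u w [] /= h.
    by apply/eqP; rewrite eq_complex/= eqxx/=; apply/eqP; lra.
  rewrite /q /H' mulmxBl innerDl innerNl scM innerZl Hd inner_diag -rmorphM -rmorphB/=.
  by rewrite /r0 divfK ?subrr// gt_eqF.
(* Pairing the relation at [x0 + y] with [x0] leaves a2 <y, q> = l2 <x0, x0>. The right side is real
   and Im <y, q> is not 0, so a2 and then l2 vanish, and only the [K'] term remains. *)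
have key y : inner y x0 = 0 -> complex.Im (inner y q) != 0 -> K' *m y = 0.
  move=> yx0 yq.
  have [a1 [b1 [l1 [ab1 Hab1]]]] := HK (x0 + y).
  pose a2 := a1 - b1 * c; pose l2 := l1 - a1 * r0 + b1 * c * r0 - b1 * m.
  have Hab2 : a2%:C *: (H' *m (x0 + y)) + b1%:C *: (K' *m (x0 + y)) = l2%:C *: (x0 + y).
    have a2E : a2%:C = a1%:C - b1%:C * c%:C :> C.
      by apply/eqP; rewrite eq_complex/=; apply/andP; split; apply/eqP; rewrite /a2; ring.
    have l2E : l2%:C = l1%:C + (b1%:C * c%:C * r0%:C - a1%:C * r0%:C - b1%:C * m%:C) :> C.
      by apply/eqP; rewrite eq_complex/=; apply/andP; split; apply/eqP; rewrite /l2; ring.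
    rewrite a2E l2E /H' /K' !mulmxBl !(mulmxDl K) !scM -!scalemxAl.
    move: (x0 + y) Hab1 => z; move: (H *m z) (K *m z) => u w.
    move: a1%:C b1%:C c%:C r0%:C m%:C l1%:C {a2E l2E} => a1' b1' c' r0' m' l1' /colP Hz.
    by apply/colP => i; have := Hz i; rewrite !mxE => h; rewrite [in RHS]mulrDl -h; ring.
  have h1 : a2%:C * inner y q = l2%:C * inner x0 x0.
    have := congr1 (fun u => inner u x0) Hab2.
    rewrite /= innerDl !innerZl H'sym K'sym K'x0 -/q.
    have -> : inner (x0 + y) 0 = 0 :> C by rewrite /inner trmx0 map_mx0 mul0mx mxE.
    rewrite !innerDl yx0 addr0 mulr0 addr0.
    have -> : inner x0 q = 0 by rewrite inner_conj qx0; apply/eqP; rewrite eq_complex/= oppr0 !eqxx.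
    by rewrite add0r.
  have a20 : a2 = 0.
    have /(congr1 (@complex.Im R)) := h1.
    rewrite inner_diag !Im_mul/= !mulr0 !mul0r !addr0 => /eqP.
    by rewrite mulf_eq0 (negbTE yq) orbF => /eqP.
  have l20 : l2 = 0.
    move: h1; rewrite a20 mul0r inner_diag => /esym/eqP.
    by rewrite -rmorphM/= fmorph_eq0 mulf_eq0 (gt_eqF n0) orbF => /eqP.
  have b10 : b1 != 0.
    apply/negP => /eqP b10; move: ab1 a20; rewrite /a2 b10 mul0r subr0 eqxx orbF.
    by move=> /eqP.
  move: Hab2; rewrite a20 l20 !scale0r add0r mulmxDr K'x0 add0r => /eqP.
  by rewrite scaler_eq0 fmorph_eq0 (negbTE b10) => /eqP.
(* The condition on Im <y, q> is removed by adding i q to y, since Im <i q, q> = |q|^2 > 0. *)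
have perp y : inner y x0 = 0 -> K' *m y = 0.
  move=> yx0.
  have iq0 : inner ((0 +i* 1) *: q) x0 = 0 by rewrite innerZl qx0 mulr0.
  have iqq : complex.Im (inner ((0 +i* 1) *: q) q) != 0.
    by rewrite innerZl inner_diag Im_mul/= mul0r add0r mul1r gt_eqF// inner_diag_gt0.
  have K'iq := key _ iq0 iqq.
  have [yq|yq] := eqVneq (complex.Im (inner y q)) 0; last exact: key.
  rewrite -[y](addrK ((0 +i* 1) *: q)) mulmxBr K'iq subr0; apply: key.
    by rewrite innerDl yx0 iq0 addr0.
  by rewrite innerDl raddfD/= yq add0r.
have K'0 : K' = 0.
  apply: mulmx_eq0 => x.
  pose s := inner x x0 / inner x0 x0.
  have nz : inner x0 x0 != 0 by rewrite inner_diag RC// gt_eqF.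
  rewrite -[x](subrK (s *: x0)) mulmxDr -scalemxAr K'x0 scaler0 addr0; apply: perp.
  by rewrite innerDl innerNl innerZl /s divfK// subrr.
exists c, 1, m; rewrite oner_eq0 orbT; split => //.
by move/eqP: K'0; rewrite subr_eq0 scale1r addrC => /eqP.
Qed.

Lemma adjoint_hermitian_part A : adjoint (hermitian_part A) = hermitian_part A.
Proof.
have adjK : adjoint (adjoint A) = A.
  by apply/matrixP => i j; rewrite !mxE; exact: conjCK.
have adjD M M' : adjoint (M + M') = adjoint M + adjoint M'.
  by rewrite /adjoint linearD/= map_mxD.
by rewrite /hermitian_part adjD adjK addrC.
Qed.

Lemma hermitian_part_comb A (a b : R) : hermitian_part ((a -i* b) *: A) =
  a%:C *: hermitian_part A + b%:C *: hermitian_part ((0 -i* 1) *: A).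
Proof.
apply/matrixP => i j; rewrite !mxE.
move: (A i j) (A j i) => [u w] [u' w'].
by apply/eqP; rewrite eq_complex/=; apply/andP; split; apply/eqP; ring.
Qed.

Lemma degenerateZ A x (c : R) : c != 0 -> degenerate A (c%:C *: x) -> degenerate A x.
Proof.
move=> c0 [a [b [l [ab H]]]]; exists a, b, l; split => //.
have c0' : c%:C != 0 :> C by rewrite fmorph_eq0.
by apply: (scalerI c0'); rewrite scalemxAr H !scalerA mulrC.
Qed.

Lemma Re_inner_hermitian_part A x (a b : R) :
  complex.Re (inner (hermitian_part ((a -i* b) *: A) *m x) x) =
  2 * (a * complex.Re (numerical_map A x) + b * complex.Im (numerical_map A x)).
Proof.
rewrite /hermitian_part mulmxDl innerDl raddfD/= [X in _ + X]Re_innerC -inner_adjoint.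
rewrite -scalemxAl innerZl Re_mul/= /numerical_map; ring.
Qed.

Lemma unit_sphere_inner x : unit_sphere x -> complex.Re (inner x x) = 1.
Proof.
rewrite /unit_sphere /= /cnorm => /(congr1 (fun r => r ^+ 2)).
rewrite expr1n sqr_sqrtr//; have [->|x0] := eqVneq x 0.
  by rewrite /inner mulmx0 mxE.
by rewrite ltW// inner_diag_gt0.
Qed.

(** If Delta vanished on the whole sphere, every point would be degenerate, and [hermitian_pair]
    would give a fixed scalar combination; the numerical range would then lie on a line. *)
Lemma nondegenerate_point A : interior (to_plane @` numerical_range A) !=set0 ->
  exists2 t, plane_sphere t & plane_minor2 A t != 0.
Proof.
move=> [z zW]; apply: contrapT => H.
have deg x : degenerate A x.
  have [->|x0] := eqVneq x 0.
    by exists 1, 0, 0; rewrite oner_eq0; split => //; rewrite mulmx0 scaler0.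
  have x1 := inner_diag_gt0 x0.
  have s0 : 0 < planes_norm (to_planes x) by rewrite /planes_norm to_planesK sqrtr_gt0.
  apply: (@degenerateZ _ _ (planes_norm (to_planes x))^-1); first by rewrite invr_eq0 gt_eqF.
  rewrite -[x in _ *: x]to_planesK -of_planes_direction.
  apply: plane_minor2_degenerate; first exact: planes_norm_direction.
  apply/eqP; apply: contra_notT H => D0; exists (direction (to_planes x)) => //.
  exact: planes_norm_direction.
have [|a [b [l [ab Hab]]]] := hermitian_pair (adjoint_hermitian_part A)
  (adjoint_hermitian_part ((0 -i* 1) *: A)).
  move=> x; have [a [b [l [ab Hx]]]] := deg x; exists a, b, l; split => //.
  rewrite -Hx (hermitian_part_comb A a b).
  move: (hermitian_part A) (hermitian_part ((0 -i* 1) *: A)) => U V.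
  by rewrite mulmxDl -!scalemxAl.
have line (y : R * R) : (to_plane @` numerical_range A) y -> 2 * (a * y.1 + b * y.2) = l.
  move=> [_ [x x1 <-] <-]; rewrite -Re_inner_hermitian_part (hermitian_part_comb A a b) Hab.
  by rewrite mul_scalar_mx innerZl Re_mul/= mul0r subr0 unit_sphere_inner// mulr1.
(* A small step from the interior point along the normal (a, b) stays in the range but leaves the
   line. *)
have cz : (z.1 + h * a, z.2 + h * b) @[h --> (0 : R)^'] --> (z.1, z.2).
  have lin (u w : R) : u + h * w @[h --> (0 : R)^'] --> u.
    rewrite -[X in _ --> X]addr0 -[X in _ --> _ + X](mul0r w).
    apply: cvgD; first exact: cvg_cst.
    by apply: cvgM; [exact: cvg_within|exact: cvg_cst].
  exact: (cvg_pair (lin _ _) (lin _ _)).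
have zW' : nbhs (z.1, z.2) (to_plane @` numerical_range A) by case: (z) zW.
have [h [/line hW h0]] : exists h : R,
    (to_plane @` numerical_range A) (z.1 + h * a, z.2 + h * b) /\ h != 0.
  near (0 : R)^' => h; exists h; split; last by near: h; exact: nbhs_dnbhs_neq.
  by near: h; exact: cz zW'.
have zl := line _ (nbhs_singleton zW).
have : h * (a ^+ 2 + b ^+ 2) = 0 by rewrite /= in hW; move: hW zl; lra.
move/eqP; rewrite mulf_eq0 (negbTE h0)/= paddr_eq0 ?sqr_ge0// !sqrf_eq0.
by case/orP: ab => /negbTE ->; rewrite ?andbF.
Unshelve. all: by end_near. Qed.

End nondegeneracy.

(** * Zeros of polynomials *)

Section polynomial_zeros.
Variable R : realType.

Lemma poly_roots_seq (p : {poly R}) : p != 0 -> exists s : seq R, forall x, root p x -> x \in s.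
Proof.
have [m] := ubnP (size p); elim: m p => // m IH p pm p0.
have [[a /factor_theorem[q pE]]|H] := pselect (exists a, root p a); last first.
  by exists [::] => x px; exfalso; apply: H; exists x.
have q0 : q != 0 by apply: contra_neq p0 => q0; rewrite pE q0 mul0r.
have [|s sP] := IH q _ q0.
  by move: pm; rewrite pE size_Mmonic ?monicXsubC// size_XsubC addn2 ltnS.
exists (a :: s) => x; rewrite pE rootM root_XsubC in_cons => /orP[/sP->|->//].
by rewrite orbT.
Qed.

Lemma poly_zeros_null (p : {poly R}) : p != 0 ->
  lebesgue_measure ([set x | p.[x] = 0] : set (measurableTypeR R)) = 0%E.
Proof.
move=> p0; have [s sP] := poly_roots_seq p0.
apply: countable_lebesgue_measure0; apply: finite_set_countable.
by apply: sub_finite_set (finite_seq s) => x /= px; apply: sP; apply/eqP.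
Qed.

Lemma product_null d1 d2 (T1 : measurableType d1) (T2 : measurableType d2)
    (m1 : {sigma_finite_measure set T1 -> \bar R}) (m2 : {sigma_finite_measure set T2 -> \bar R})
    (E : set (T1 * T2)) (N : set T2) :
  measurable E -> measurable N -> m2 N = 0%E ->
  (forall y, ~ N y -> m1 [set x | E (x, y)] = 0%E) -> (m1 \x m2)%E E = 0%E.
Proof.
move=> mE mN N0 H; rewrite product_measure12// /product_measure2.
rewrite (ae_eq_integral (cst 0%E))//; first by rewrite integral0.
- exact: measurable_fun_ysection.
- exists N; split => // y /= h; apply: contrapT => Ny; apply: h => _.
  rewrite -[RHS](H _ Ny)/=; congr (m1 _).
  by apply/seteqP; split => x; rewrite /ysection/= inE.
Qed.

(** One real coordinate varies at a time, so that finiteness of roots in one variable and Tonelli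
    suffice. *)
Definition coordinatewise_poly n (f : n.-tuple (plane R) -> R) := forall t i (u : plane R),
  (exists p : {poly R}, forall s, f (tset t i (s, u.2)) = p.[s]) /\
  (exists p : {poly R}, forall s, f (tset t i (u.1, s)) = p.[s]).

(** The polynomial y -> g (z0.1, y) is not zero. For y outside its finitely many roots, s -> g (s,
    y) does not vanish at z0.1, so it also has finitely many roots. *)
Lemma plane_zeros_null (g : plane R -> R) (z0 : plane R) : measurable_fun setT g ->
  (forall u : plane R, (exists p : {poly R}, forall s, g (s, u.2) = p.[s]) /\
     (exists p : {poly R}, forall s, g (u.1, s) = p.[s])) ->
  g z0 != 0 -> lebesgue_plane [set z | g z = 0] = 0%E.
Proof.
move=> mg gp g0.
have m0 : measurable [set z | g z = 0].
  by rewrite -[X in measurable X]setTI; exact: (mg measurableT [set 0]).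
have [_ [p pE]] := gp z0.
have p0 : p != 0.
  by apply: contra_neq g0 => p0; case: (z0) pE => a b /= ->; rewrite p0 horner0.
apply: (@product_null _ _ _ _ lebesgue_measure lebesgue_measure _ [set y : measurableTypeR R | p.[y] = 0]) => //.
- have mg1 : measurable_fun setT (fun y => g (z0.1, y)).
    by apply: (measurableT_comp mg); exact: pair1_measurable.
  rewrite (_ : [set y | _] = setT `&` (fun y => g (z0.1, y)) @^-1` [set 0]); first exact: mg1.
  by rewrite setTI; apply/seteqP; split => y /=; rewrite pE.
- exact: poly_zeros_null.
- move=> y py; have [[q qE] _] := gp (z0.1, y).
  have q0 : q != 0.
    apply/negP => /eqP q0; apply: py => /=; rewrite -pE.
    by rewrite (qE z0.1) q0 horner0.
  rewrite -(poly_zeros_null q0); congr (lebesgue_measure _).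
  by apply/seteqP; split => x /=; rewrite -qE.
Qed.

(** With head [z0] fixed, induction makes the function nonzero for almost every tail; for each such
    tail it is nonzero at [z0] as a function of the head, and the planar case applies. *)
Lemma tuple_zeros_null n (f : n.-tuple (plane R) -> R) t0 : measurable_fun setT f ->
  coordinatewise_poly f -> f t0 != 0 ->
  tuple_measure (@lebesgue_plane R) n [set t | f t = 0] = 0%E.
Proof.
elim: n f t0 => [|n IH] f t0 mf fp f0.
  rewrite /= diracE memNset//= => h; move/eqP: f0; apply.
  by rewrite -[RHS]h; congr f; rewrite (tuple0 t0).
pose cons (z : plane R) (t : n.-tuple (plane R)) : n.+1.-tuple (plane R) := [tuple of z :: t].
have consL z t k : tnth (cons z t) (lift ord0 k) = tnth t k by exact: tnthS.
have consE z t i u : cons z (tset t i u) = tset (cons z t) (lift ord0 i) u.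
  apply: eq_from_tnth => j; rewrite tnth_mktuple.
  have [k ->|->] := unliftP ord0 j; last by [].
  by rewrite !consL tnth_mktuple (inj_eq (@lift_inj _ _)).
have cons0 z z' t : cons z t = tset (cons z' t) ord0 z.
  apply: eq_from_tnth => j; rewrite tnth_mktuple.
  by have [k ->|->] := unliftP ord0 j; rewrite ?consL.
have mc : measurable_fun setT (fun p : plane R * n.-tuple (plane R) => cons p.1 p.2).
  exact: measurable_cons.
have mfc : measurable_fun setT (fun p : plane R * n.-tuple (plane R) => f (cons p.1 p.2)).
  exact: measurableT_comp mf mc.
pose z0 := thead t0; pose t1 := [tuple of behead t0].
have t0E : t0 = cons z0 t1 by exact: tuple_eta.
pose h t := f (cons z0 t).
have mh : measurable_fun setT h.
  exact: (measurableT_comp mfc (pair1_measurable z0)).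
have h0 : h t1 != 0 by rewrite /h -t0E.
have hp : coordinatewise_poly h.
  move=> t i u; have [[p pE] [q qE]] := fp (cons z0 t) (lift ord0 i) u.
  by split; [exists p|exists q] => s; rewrite /h consE.
rewrite /= /cons_measure /pushforward.
apply: (@product_null _ _ _ _ lebesgue_plane (tuple_measure lebesgue_plane n) _ [set t | h t = 0]) => //.
- by rewrite -[X in measurable X]setTI; exact: (mfc measurableT [set 0]).
- by rewrite -[X in measurable X]setTI; exact: (mh measurableT [set 0]).
- exact: IH mh hp h0.
- move=> t ht; apply: (@plane_zeros_null (fun z => f (cons z t)) z0) => //.
  + exact: (measurableT_comp mfc (pair2_measurable t)).
  + move=> u; have [[p pE] [q qE]] := fp (cons z0 t) ord0 u.
    by split; [exists p|exists q] => s; rewrite (cons0 _ z0).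
  + exact/eqP.
Qed.

End polynomial_zeros.

Section linewise_polynomial.
Variables (R : realType) (n : nat).
Local Notation C := R[i].
Implicit Types (A B : 'M[C]_n) (F G : 'cV[C]_n -> R) (t : n.-tuple (plane R)).

(** All real lines are allowed, so that [numerical_mapD] gives the property for quadratic forms at
    once; varying a real or imaginary part of one entry is a special line. *)
Definition linewise_poly F := forall x v, exists p : {poly R}, forall s, F (x + s%:C *: v) = p.[s].

Lemma linewise_polyD F G : linewise_poly F -> linewise_poly G -> linewise_poly (F \+ G).
Proof.
move=> HF HG x v; have [p pE] := HF x v; have [q qE] := HG x v.
by exists (p + q) => s; rewrite hornerD -pE -qE.
Qed.

Lemma linewise_polyN F : linewise_poly F -> linewise_poly (\- F).
Proof.
by move=> HF x v; have [p pE] := HF x v; exists (- p) => s; rewrite hornerN -pE.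
Qed.

Lemma linewise_polyM F G : linewise_poly F -> linewise_poly G -> linewise_poly (F \* G).
Proof.
move=> HF HG x v; have [p pE] := HF x v; have [q qE] := HG x v.
by exists (p * q) => s; rewrite hornerM -pE -qE.
Qed.

Lemma linewise_poly_sum (I : finType) (F : I -> 'cV[C]_n -> R) :
  (forall i, linewise_poly (F i)) -> linewise_poly (fun x => \sum_i F i x).
Proof.
move=> HF x v; have [p pE] := choice (fun i => HF i x v).
by exists (\sum_i p i) => s; rewrite horner_sum; apply: eq_bigr => i _; rewrite pE.
Qed.

Definition cquad B (x : 'cV[C]_n) : R := complex.Re (inner (B *m x) x).

Lemma linewise_poly_cquad B : linewise_poly (cquad B).
Proof.
move=> x v; exists ((cquad B x)%:P +
  (complex.Re (inner (B *m x) v + inner (B *m v) x))%:P * 'X + (cquad B v)%:P * 'X ^+ 2) => s.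
have := numerical_mapD B x v s; rewrite /numerical_map /cquad => ->.
rewrite !hornerE.
move: (inner (B *m x) x) (inner (B *m x) v + inner (B *m v) x) (inner (B *m v) v).
by move=> [a b] [c e] [f g] /=; ring.
Qed.

Lemma coordinatewise_linewise_poly F : linewise_poly F ->
  coordinatewise_poly (fun t => F (of_planes t)).
Proof.
move=> HF t i u; split.
  have [p pE] := HF (of_planes (tset t i (0, u.2))) (delta_mx i 0).
  exists p => s; rewrite -pE; congr F; apply/colP => j; rewrite !mxE !tnth_mktuple.
  by case: eqP => _; apply/eqP; rewrite eq_complex/= ?mulr1 ?mulr0 ?mul0r ?addr0 ?add0r ?subr0 !eqxx.
have [p pE] := HF (of_planes (tset t i (u.1, 0))) ((0 +i* 1) *: delta_mx i 0).
exists p => s; rewrite -pE; congr F; apply/colP => j; rewrite !mxE !tnth_mktuple.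
by case: eqP => _; apply/eqP; rewrite eq_complex/=; apply/andP; split; apply/eqP; ring.
Qed.

End linewise_polynomial.

Section numerical_zeros.
Variables (R : realType) (n : nat).
Hypothesis n0 : (0 < n)%N.
Local Notation C := R[i].
Local Notation index := ('I_n * 'I_n * bool)%type.
Local Notation P := (surface_probability R n).
Local Notation D := (@plane_sphere R n).
Implicit Types (A B : 'M[C]_n) (t : n.-tuple (plane R)) (p : index).

Lemma quad_div B t (c : R) : quad B [tuple ((tnth t i).1 / c, (tnth t i).2 / c) | i < n] =
  c^-1 ^+ 2 * quad B t.
Proof.
have -> : [tuple ((tnth t i).1 / c, (tnth t i).2 / c) | i < n] =
    to_planes (c^-1%:C *: of_planes t) :> n.-tuple (plane R).
  apply: eq_from_tnth => i; rewrite !tnth_mktuple !mxE /to_plane /=.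
  by congr pair; ring.
rewrite !quadE to_planesK -scalemxAr innerZl innerZr_real mulrA -rmorphM/= Re_mul/=.
by rewrite mul0r subr0 expr2.
Qed.

Lemma measurable_quad B : measurable_fun setT (quad B).
Proof.
apply: (measurableT_comp measurable_fst).
exact: (measurable_funPT (plane_numerical_map B)).
Qed.

Let S := elementary_generator R.

(** The explicit polynomial that agrees with [plane_minor2] on the sphere: squares of products of
    two quadratic forms, hence homogeneous of degree 8. *)
Definition bracket_minor2 A t := \sum_(p : index) \sum_(q : index)
  (quad (lie_bracket A (S p)) t * quad (lie_bracket ((0 -i* 1) *: A) (S q)) t -
   quad (lie_bracket A (S q)) t * quad (lie_bracket ((0 -i* 1) *: A) (S p)) t) ^+ 2.

Definition bracket_norm2 A t := \sum_(p : index) quad (lie_bracket A (S p)) t ^+ 2.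

Lemma plane_minor2E A t : D t -> plane_minor2 A t = bracket_minor2 A t.
Proof.
move=> Dt; apply: eq_bigr => p _; apply: eq_bigr => q _; congr (_ ^+ 2).
have X2E : (fun t => (plane_numerical_map A t).2) = quad ((0 -i* 1) *: A).
  by apply/funext => s; rewrite plane_numerical_map2.
have e1 r : lie (@numerical_flow R n) r (fun t => (plane_numerical_map A t).1) t =
  quad (lie_bracket A (S r)) t by exact: (lie_quad A r Dt).
by rewrite /lie_minor !e1 X2E !lie_quad.
Qed.

Lemma real_norm2E A t : D t -> real_norm2 A t = bracket_norm2 A t.
Proof.
move=> Dt; apply: eq_bigr => p _; congr (_ ^+ 2); exact: (lie_quad A p Dt).
Qed.

(** Homogeneity makes the zero set stable under scaling, so its Lebesgue nullity passes to the
    sphere. *)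
Lemma sphere_zeros_null (F : 'cV[C]_n -> R) (k : nat) t0 :
  measurable_fun setT (fun t => F (of_planes t)) -> linewise_poly F ->
  (forall t (c : R), F (of_planes [tuple ((tnth t i).1 / c, (tnth t i).2 / c) | i < n]) =
    c^-1 ^+ k * F (of_planes t)) ->
  F (of_planes t0) != 0 -> P.-negligible [set t | F (of_planes t) = 0].
Proof.
move=> mF pF hF F0; have mE : measurable [set t | F (of_planes t) = 0].
  by rewrite -[X in measurable X]setTI; exact: (mF measurableT [set 0]).
exists [set t | F (of_planes t) = 0]; split => //.
apply: surface_probability_null => //.
  move=> t c c0 /=; rewrite hF => /eqP; rewrite mulf_eq0 expf_eq0 invr_eq0 gt_eqF//= andbF.
  by move=> /eqP.
exact: (tuple_zeros_null mF (coordinatewise_linewise_poly pF) F0).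
Qed.

Lemma bracket_minor2_null A t0 : bracket_minor2 A t0 != 0 ->
  P.-negligible [set t | bracket_minor2 A t = 0].
Proof.
pose m p q (x : 'cV[C]_n) := cquad (lie_bracket A (S p)) x * cquad (lie_bracket ((0 -i* 1) *: A) (S q)) x -
   cquad (lie_bracket A (S q)) x * cquad (lie_bracket ((0 -i* 1) *: A) (S p)) x.
apply: (@sphere_zeros_null (fun x => \sum_p \sum_q m p q x ^+ 2) 8 t0).
- apply: measurable_sum => p; apply: measurable_sum => q; apply: measurable_funX.
  by apply: measurable_funB; apply: measurable_funM; exact: measurable_quad.
- apply: linewise_poly_sum => p; apply: linewise_poly_sum => q.
  have H : linewise_poly (m p q).
    apply: linewise_polyD; last apply: linewise_polyN.
      by apply: linewise_polyM; exact: linewise_poly_cquad.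
    by apply: linewise_polyM; exact: linewise_poly_cquad.
  exact: (linewise_polyM H H).
- move=> t c; rewrite mulr_sumr; apply: eq_bigr => p _; rewrite mulr_sumr; apply: eq_bigr => q _.
  have E B : cquad B (of_planes [tuple ((tnth t i).1 / c, (tnth t i).2 / c) | i < n]) =
    c^-1 ^+ 2 * cquad B (of_planes t) by exact: quad_div.
  rewrite /m !E; do 4 move: (cquad _ (of_planes t)) => ?.
  by ring.
Qed.

Lemma bracket_norm2_null A t0 : bracket_norm2 A t0 != 0 ->
  P.-negligible [set t | bracket_norm2 A t = 0].
Proof.
apply: (@sphere_zeros_null (fun x => \sum_p cquad (lie_bracket A (S p)) x ^+ 2) 4 t0).
- by apply: measurable_sum => p; apply: measurable_funX; exact: measurable_quad.
- apply: linewise_poly_sum => p; apply: linewise_polyM; exact: linewise_poly_cquad.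
- move=> t c; rewrite mulr_sumr; apply: eq_bigr => p _.
  have E B : cquad B (of_planes [tuple ((tnth t i).1 / c, (tnth t i).2 / c) | i < n]) =
    c^-1 ^+ 2 * cquad B (of_planes t) by exact: quad_div.
  rewrite !E; move: (cquad _ (of_planes t)) => ?.
  by ring.
Qed.

(** The event that [X] lands in a null set splits according to [g]: where [g] is positive the first
    hypothesis applies, and elsewhere on the sphere [h] is 0. *)
Lemma negligible_dominates dS (T' : measurableType dS) (X : {mfun n.-tuple (plane R) >-> T'})
    (la : {measure set T' -> \bar R}) (g h : n.-tuple (plane R) -> R) :
  (forall E, measurable E -> la E = 0%E ->
    P.-negligible (D `&` X @^-1` E `&` [set t | 0 < g t])) ->
  (forall t, D t -> 0 <= g t) -> (forall t, D t -> g t = h t) ->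
  P.-negligible [set t | h t = 0] -> distribution P X `<< la.
Proof.
move=> HE g0 gh h0; apply/null_content_dominatesP => E mE E0.
have mXE : measurable (X @^-1` E) by rewrite -[X in measurable X]setTI; exact: measurable_funPT.
have -> : distribution P X E = P (X @^-1` E) by [].
rewrite -(@probability_setI1 _ _ _ P (X @^-1` E) D)//; last 2 first.
- exact: measurable_plane_sphere.
- exact: surface_probability_sphere n0.
apply: measure_negligible; first by apply: measurableI => //; exact: measurable_plane_sphere.
apply: negligibleS (negligibleU (HE E mE E0) h0) => t [Et Dt] /=.
have := g0 t Dt; rewrite le_eqVlt => /orP[/eqP gt|gt]; last by left.
by right; rewrite /= -gh.
Qed.

Lemma numerical_measure_dominated A : interior (to_plane @` numerical_range A) !=set0 ->
  numerical_measure A `<< lebesgue_plane.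
Proof.
move=> /nondegenerate_point[t0 Dt0]; rewrite plane_minor2E// => /bracket_minor2_null.
apply: (@negligible_dominates _ _ (plane_numerical_map A) lebesgue_plane (plane_minor2 A)).
- by move=> E mE E0; exact: numerical_null.
- by move=> t Dt; apply: sumr_ge0 => p _; apply: sumr_ge0 => q _; rewrite sqr_ge0.
- by move=> t Dt; rewrite plane_minor2E.
Qed.

Lemma real_numerical_measure_dominated A : adjoint A = A -> ~~ is_scalar_mx A ->
  real_numerical_measure A `<< lebesgue_measure.
Proof.
move=> AA nA.
have [t0 Dt0 D0] : exists2 t, D t & real_norm2 A t != 0.
  apply: contrapT => H; move/negP : nA; apply.
  have [x|l ->] := @all_eigenvectors R n A; last exact: scalar_mx_is_scalar.
  have [->|x0] := eqVneq x 0; first by exists 0; rewrite mulmx0 scaler0.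
  have x1 := inner_diag_gt0 x0.
  have s0 : 0 < planes_norm (to_planes x) by rewrite /planes_norm to_planesK sqrtr_gt0.
  have Dx := planes_norm_direction s0.
  have [|l] := real_norm2_eigenvector AA Dx.
    by apply/eqP; apply: contra_notT H => D0; exists (direction (to_planes x)).
  rewrite of_planes_direction to_planesK -scalemxAr => H1; exists l.
  have sn : (planes_norm (to_planes x))^-1%:C != 0 :> C by rewrite fmorph_eq0 invr_eq0 gt_eqF.
  by apply: (scalerI sn); rewrite H1 !scalerA mulrC.
move: D0; rewrite real_norm2E// => /bracket_norm2_null.
apply: (@negligible_dominates _ _ (real_numerical_map A) lebesgue_measure (real_norm2 A)).
- by move=> E mE E0; exact: real_numerical_null.
- by move=> t Dt; apply: sumr_ge0 => p _; rewrite sqr_ge0.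
- by move=> t Dt; rewrite real_norm2E.
Qed.

End numerical_zeros.

(** * Compactness of the sphere *)

Section sphere_compactness.
Variables (R : realType) (n : nat).
Local Notation C := R[i].
Local Notation D := (@plane_sphere R n).
Implicit Types (A B : 'M[C]_n) (F G : 'cV[C]_n -> R) (u : 'rV[R]_(n + n)).

(** C^n in real coordinates, as row vectors so that [rV_compact] and [EVT_min_rV] apply. *)
Definition complex_col u : 'cV[C]_n := \col_i (u 0 (lshift n i) +i* u 0 (rshift n i)).

Lemma continuous_bigsum (T : topologicalType) (I : Type) (r : seq I) (f : I -> T -> R) :
  (forall i, continuous (f i)) -> continuous (fun x => \sum_(i <- r) f i x).
Proof.
move=> cf; elim: r => [|i r IH] x.
  by under eq_fun do rewrite big_nil; exact: cvg_cst.
by under eq_fun do rewrite big_cons; exact: (cvgD (cf i x) (IH x)).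
Qed.

Definition continuous_col F := continuous (fun u => F (complex_col u)).

Lemma continuous_col_cquad B : continuous_col (cquad B).
Proof.
pose cc (f : 'rV[R]_(n + n) -> C) :=
  continuous (fun u => complex.Re (f u)) /\ continuous (fun u => complex.Im (f u)).
have ccM f g : cc f -> cc g -> cc (fun u => f u * g u).
  move=> [f1 f2] [g1 g2]; split => u.
    under eq_fun do rewrite Re_mul.
    exact: (cvgB (cvgM (f1 u) (g1 u)) (cvgM (f2 u) (g2 u))).
  under eq_fun do rewrite Im_mul.
  exact: (cvgD (cvgM (f1 u) (g2 u)) (cvgM (f2 u) (g1 u))).
have ccS (f : 'I_n -> 'rV[R]_(n + n) -> C) : (forall i, cc (f i)) -> cc (fun u => \sum_i f i u).
  move=> cf; split => u.
    under eq_fun do rewrite Re_sum.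
    by apply: (continuous_bigsum (f := fun i u => complex.Re (f i u))) => i; case: (cf i).
  under eq_fun do rewrite Im_sum.
  by apply: (continuous_bigsum (f := fun i u => complex.Im (f i u))) => i; case: (cf i).
have ccx i : cc (fun u => complex_col u i 0).
  split => u; under eq_fun do rewrite mxE /=; exact: coord_continuous.
have ccj i : cc (fun u => Num.conj (complex_col u i 0)).
  split => u.
    by under eq_fun do rewrite mxE /=; exact: coord_continuous.
  by under eq_fun do rewrite mxE /=; exact: (cvgN (@coord_continuous R 1 (n + n) 0 (rshift n i) u)).
have ccc (c : C) : cc (fun=> c) by split; [exact: (@cst_continuous _ _ (complex.Re c))|exact: (@cst_continuous _ _ (complex.Im c))].
have [+ _] : cc (fun u => inner (B *m complex_col u) (complex_col u)).
  rewrite (_ : (fun u => _) = fun u =>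
    \sum_i Num.conj (complex_col u i 0) * \sum_j B i j * complex_col u j 0).
    apply: (ccS _) => i; apply: (ccM _ _) => //.
    by apply: (ccS _) => j; apply: (ccM _ _).
  apply/funext => u; rewrite inner_sum; apply: eq_bigr => i _.
  by congr (_ * _); rewrite mxE.
by [].
Qed.

(** The minimum over the compact sphere is positive; it is written 2 c to match the hypothesis of
    the local densities. *)
Lemma sphere_lower_bound F : continuous_col F ->
  (forall t, D t -> 0 < F (of_planes t)) ->
  exists2 c, 0 < c & forall t, D t -> 2 * c <= F (of_planes t).
Proof.
move=> cF F0.
pose S : set 'rV[R]_(n + n) := [set u | cquad 1%:M (complex_col u) = 1].
have SD u : S u -> D (to_planes (complex_col u)).
  by rewrite /S /= /cquad mul1mx /plane_sphere /= /planes_norm to_planesK /cnorm => ->; rewrite sqrtr1.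
have DS t : D t -> exists2 u, S u & complex_col u = of_planes t.
  move=> Dt; pose u : 'rV[R]_(n + n) :=
    row_mx (\row_i (tnth t i).1) (\row_i (tnth t i).2).
  have uE : complex_col u = of_planes t.
    by apply/colP => i; rewrite [LHS]mxE [RHS]mxE /u row_mxEl row_mxEr !mxE.
  exists u => //; rewrite /S /= uE /cquad mul1mx.
  exact: unit_sphere_inner.
have cS : compact S.
  apply: (@subclosed_compact _ _ [set u : 'rV[R]_(n + n) | forall i, `[-1, 1]%classic (u ord0 i)]).
  - rewrite (_ : S = (fun u => cquad 1%:M (complex_col u)) @^-1` [set 1]) //.
    apply: closed_comp => [u _|]; first exact: continuous_col_cquad.
    exact: closed_eq.
  - by apply: (@rV_compact R (n + n) (fun=> `[-1, 1]%classic)) => _; exact: segment_compact.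
  - move=> u Su k /=; rewrite in_itv/= -ler_norml.
    rewrite -(splitK k); case: (fintype.split k) => i /=.
      by have [+ _] := coord_le1 i (SD _ Su); rewrite to_planesK mxE.
    by have [_ +] := coord_le1 i (SD _ Su); rewrite to_planesK mxE.
(* When n = 0 the sphere is empty and any positive constant will do. *)
have [[u0 Su0]|S0] := pselect (S !=set0); last first.
  exists 1 => // t /DS[u Su _]; exfalso; apply: S0; exists u; exact: Su.
have [|u /set_mem Su umin] := EVT_min_rV (ex_intro _ u0 Su0) cS (f := fun u => F (complex_col u)).
  by apply: continuous_subspaceT.
exists (F (complex_col u) / 2); first by rewrite divr_gt0// -[complex_col u]to_planesK F0//; exact: SD.
move=> t /DS[v Sv <-]; rewrite mulrC divfK//.
by apply: umin; exact: mem_set.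
Qed.

Lemma continuous_colB F G : continuous_col F -> continuous_col G -> continuous_col (F \- G).
Proof. by move=> cF cG u; exact: (cvgB (cF u) (cG u)). Qed.

Lemma continuous_colD F G : continuous_col F -> continuous_col G -> continuous_col (F \+ G).
Proof. by move=> cF cG u; exact: (cvgD (cF u) (cG u)). Qed.

Lemma continuous_colM F G : continuous_col F -> continuous_col G -> continuous_col (F \* G).
Proof. by move=> cF cG u; exact: (cvgM (cF u) (cG u)). Qed.

Lemma continuous_col_cst (c : R) : continuous_col (cst c).
Proof. exact: cst_continuous. Qed.

Let S := elementary_generator R.

(** A zero of the right side is a degenerate, hence critical, point with value [z]. Away from the
    critical values the expression is positive, and compactness makes it uniformly so. *)
Lemma plane_lower_bound A (z : R * R) : ~ (to_plane @` critical_values A) z ->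
  exists2 c, 0 < c & forall t, D t -> 2 * c <= plane_minor2 A t +
    (((plane_numerical_map A t).1 - z.1) ^+ 2 + ((plane_numerical_map A t).2 - z.2) ^+ 2).
Proof.
move=> zA; pose A' := (0 -i* 1) *: A.
pose m p q := (cquad (lie_bracket A (@S n p)) \* cquad (lie_bracket A' (S q))) \-
   (cquad (lie_bracket A (S q)) \* cquad (lie_bracket A' (S p))).
pose G x := \sum_p \sum_q (m p q \* m p q) x.
pose F := G \+ (((cquad A \- cst z.1) \* (cquad A \- cst z.1)) \+
   ((cquad A' \- cst z.2) \* (cquad A' \- cst z.2))).
have FE t : D t -> F (of_planes t) = plane_minor2 A t +
    (((plane_numerical_map A t).1 - z.1) ^+ 2 + ((plane_numerical_map A t).2 - z.2) ^+ 2).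
  by move=> Dt; rewrite plane_minor2E// plane_numerical_map2.
have Q := continuous_col_cquad.
have cm p q : continuous_col (m p q).
  by apply: continuous_colB; apply: continuous_colM; exact: Q.
have cz B (c : R) : continuous_col (cquad B \- cst c).
  by apply: continuous_colB; [exact: Q|exact: continuous_col_cst].
have cF : continuous_col F.
  apply: continuous_colD; last by apply: continuous_colD; apply: continuous_colM.
  apply: (continuous_bigsum (f := fun p u => \sum_q (m p q \* m p q) (complex_col u))) => p.
  apply: (continuous_bigsum (f := fun q u => (m p q \* m p q) (complex_col u))) => q.
  exact: continuous_colM.
have [|c c0 cP] := sphere_lower_bound cF; last first.
  by exists c => // t Dt; rewrite -FE//; exact: cP.
move=> t Dt; rewrite FE//.
have G0 : 0 <= plane_minor2 A t.
  by apply: sumr_ge0 => p _; apply: sumr_ge0 => q _; rewrite sqr_ge0.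
rewrite lt_neqAle addr_ge0 ?addr_ge0 ?sqr_ge0// andbT eq_sym.
rewrite paddr_eq0 ?addr_ge0 ?sqr_ge0// paddr_eq0 ?sqr_ge0// !sqrf_eq0 !subr_eq0.
apply/negP => /andP[/eqP D0 /andP[/eqP e1 /eqP e2]]; apply: zA.
exists (numerical_map A (of_planes t)).
  exists (of_planes t) => //; apply: degenerate_critical => //.
  exact: plane_minor2_degenerate.
by apply: injective_projections.
Qed.

Lemma real_lower_bound A (z : R) : adjoint A = A -> ~ real_spectrum A z ->
  exists2 c, 0 < c & forall t, D t -> 2 * c <= real_norm2 A t + (real_numerical_map A t - z) ^+ 2.
Proof.
move=> AA zA.
pose m p := cquad (lie_bracket A (@S n p)).
pose F := (fun x => \sum_p (m p \* m p) x) \+ ((cquad A \- cst z) \* (cquad A \- cst z)).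
have FE t : D t -> F (of_planes t) = real_norm2 A t + (real_numerical_map A t - z) ^+ 2.
  by move=> Dt; rewrite real_norm2E.
have Q := continuous_col_cquad.
have cz : continuous_col (cquad A \- cst z).
  by apply: continuous_colB; [exact: Q|exact: continuous_col_cst].
have cF : continuous_col F.
  apply: continuous_colD; last exact: continuous_colM.
  apply: (continuous_bigsum (f := fun p u => (m p \* m p) (complex_col u))) => p.
  by apply: continuous_colM; exact: Q.
have [|c c0 cP] := sphere_lower_bound cF; last first.
  by exists c => // t Dt; rewrite -FE//; exact: cP.
move=> t Dt; rewrite FE//.
have G0 : 0 <= real_norm2 A t by apply: sumr_ge0 => p _; rewrite sqr_ge0.
rewrite lt_neqAle addr_ge0 ?sqr_ge0// andbT eq_sym paddr_eq0 ?sqr_ge0// sqrf_eq0 subr_eq0.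
apply/negP => /andP[/eqP D0 /eqP e1]; apply: zA.
have [l Hl] := real_norm2_eigenvector AA Dt D0.
have x1 := unit_sphere_inner Dt.
have zl : z = l.
  by rewrite -e1 /real_numerical_map quadE Hl innerZl Re_mul/= mul0r subr0 x1 mulr1.
(* [eigenvalue] concerns row vectors, so the eigenvector is conjugated and transposed; [A] being
   self-adjoint and [l] real, the eigenvalue is the same. *)
rewrite /real_spectrum /= zl; apply/eigenvalueP; exists ((of_planes t)^t*).
  have := congr1 (fun x : 'cV[C]_n => x^t*) Hl; rewrite trmx_mul map_mxM.
  rewrite -[X in _ *m X]/(adjoint A) AA => ->.
  rewrite linearZ/= map_mxZ; congr (_ *: _).
  by apply/eqP; rewrite eq_complex/= oppr0 !eqxx.
apply/negP => /eqP x0; move: x1; rewrite /inner x0 mul0mx mxE/= => /eqP.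
by rewrite eq_sym oner_eq0.
Qed.

End sphere_compactness.

(** * Gluing local densities *)

Section smooth_density.
Context (R : realType) (V : normedModType R) d (T : measurableType d).
Variables (psi : V -> T) (phi : T -> V).
Hypotheses (psiK : cancel psi phi) (phiK : cancel phi psi).
Variables (la : {sigma_finite_measure set T -> \bar R}) (Q : set (set T)).
Variable U : nat -> set V.
Hypotheses (oU : forall i, open (U i)) (mU : forall i, measurable (phi @^-1` U i))
  (U0 : forall i, (0 < la (phi @^-1` U i))%E)
  (UQ : forall i, exists A, [/\ Q A, measurable A & phi @^-1` U i `<=` A])
  (Ubase : forall z N, nbhs z N -> exists2 i, U i z & U i `<=` N).
Variables (mu : set T -> \bar R) (f0 : T -> \bar R).
Hypotheses (f0_fin : forall x, f0 x \is a fin_num) (f0_int : la.-integrable setT f0)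
  (f0E : forall A, measurable A -> mu A = (\int[la]_(x in A) f0 x)%E).

Definition locally_C_density (k : nat) (N : set V) := exists nu,
  has_C_density psi k la Q nu /\
  forall E, measurable E -> E `<=` phi @^-1` N -> nu E = mu E.

(** A nonzero value of a continuous function persists on a basic open set, and basic sets have
    positive measure. *)
Lemma null_open_eq0 (h : V -> R) i : continuous h ->
  la.-negligible (phi @^-1` (U i `&` [set x | h x != 0])) -> forall x, U i x -> h x = 0.
Proof.
move=> ch hn x Ux; apply: contrapT => /eqP hx.
have [|j Ujx Uj] := Ubase (z := x) (N := U i `&` [set x | h x != 0]).
  apply: filterI; first exact: open_nbhs_nbhs.
  by apply: (cvgr_neq0 _ (ch x)) => //; exact: nbhs_filter.
have := U0 j; rewrite (measure_negligible (mU j)) ?ltxx//.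
by apply: negligibleS hn => y Ujy; exact: Uj.
Qed.

(** The basic set lies in a member of [Q], where both parts of the density are integrable; the
    negative part can then be subtracted, and [f0] has the same integrals as the difference over all
    measurable subsets. *)
Lemma local_version k i : locally_C_density k (U i) -> exists g : T -> R,
  [/\ measurable_fun setT g, of_class_C k setT (g \o psi) &
     la.-negligible (phi @^-1` U i `&` [set y | f0 y <> (g y)%:E])].
Proof.
move=> [nu [[Gp [Gn [[mGp mGn] _ CG iG nuE]]] numu]].
have mG : measurable_fun setT (Gp \- Gn) by exact: measurable_funB.
exists (Gp \- Gn); split => //.
have [A [QA mA UA]] := UQ i; have [iGp iGn] := iG A QA.
have ae : ae_eq la (phi @^-1` U i) f0 (EFin \o (Gp \- Gn)).
  apply: integral_ae_eq => //.
  - exact: (integrableS measurableT).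
  - by apply/measurable_EFinP; exact: measurable_funTS.
  - move=> E EU mE; rewrite -f0E// -(numu E mE EU).
    have EA : E `<=` A by exact: subset_trans UA.
    have iGp' := integrableS mA mE EA iGp; have iGn' := integrableS mA mE EA iGn.
    rewrite (integralB_EFin mE iGp' iGn') -nuE// addeK//.
    exact: integrable_fin_num.
case: ae => N [mN N0 HN]; exists N; split => // y [Uy /= fg]; apply: HN => /= H.
exact: (fg (H Uy)).
Qed.

(** Continuous versions agree wherever two of them are defined, so [f] is glued from the versions of
    class C^0 alone; near each point of [O] it coincides with the version of class C^k, for every
    [k]. Countability of the base keeps [f] measurable and the exceptional set null. *)
Lemma smooth_density (O : set V) :
  (forall z, O z -> exists2 N, nbhs z N & forall k, locally_C_density k N) ->
  exists f : V -> R, [/\ measurable_fun setT (f \o phi),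
    {ae la, forall y, f0 y = (f (phi y))%:E} & smooth_on O f].
Proof.
move=> HO.
(* All orders are asked for at once, so the sets used for gluing do not depend on [k]. *)
pose good i := forall k, locally_C_density k (U i).
pose rep k i g := [/\ measurable_fun setT g, of_class_C k setT (g \o psi) &
     la.-negligible (phi @^-1` U i `&` [set y | f0 y <> (g y)%:E])].
have rep_unique k k' i j g g' : rep k i g -> rep k' j g' ->
    forall x, U i x -> U j x -> g (psi x) = g' (psi x).
  move=> [_ Cg ng] [_ Cg' ng'] x Uix Ujx.
  have cgg' : continuous (fun x => g (psi x) - g' (psi x)).
    have cg : continuous (g \o psi) by case: (k) Cg => [|?] [cg _] y; exact: cg.
    have cg' : continuous (g' \o psi) by case: (k') Cg' => [|?] [cg' _] y; exact: cg'.
    by move=> y; exact: (cvgB (cg y) (cg' y)).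
  have [|l Ulx Ul] := Ubase (z := x) (N := U i `&` U j).
    by apply: filterI; exact: open_nbhs_nbhs.
  apply/eqP; rewrite -subr_eq0; apply/eqP.
  apply: (@null_open_eq0 _ l cgg' _ _ Ulx).
  apply: negligibleS (negligibleU ng ng') => y [Uly /=]; rewrite phiK => gg.
  have [Uiy Ujy] := Ul _ Uly.
  have [fg|fg] := pselect (f0 y = (g y)%:E); last by left.
  right; split => //= fg'; move: gg; rewrite subr_eq0 => /eqP; apply.
  by move: fg'; rewrite fg => -[].
have version i : exists g : T -> R, good i -> rep 0 i g.
  have [gi|ngi] := pselect (good i); last by exists (cst 0).
  by have [g gP] := local_version (gi 0); exists g.
have [G GP] := choice version.
pose W x := exists i, good i /\ U i x.
(* The index is chosen arbitrarily, and [rep_unique] makes the value independent of the choice. Off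
   the good sets [f] falls back on [f0]. *)
pose f x := if pselect (W x) is left h then G (projT1 (cid h)) (psi x) else fine (f0 (psi x)).
have fG i x : good i -> U i x -> f x = G i (psi x).
  move=> gi Ux; rewrite /f; case: pselect => [h|]; last by case; exists i.
  by case: cid => j [gj Ujx] /=; exact: (rep_unique _ _ _ _ _ _ (GP _ gj) (GP _ gi)).
pose E i := phi @^-1` U i `&` [set _ | good i].
have mE i : measurable (E i).
  rewrite /E; have [gi|ngi] := pselect (good i).
    by rewrite (_ : [set _ | _] = setT) ?setIT//; apply/seteqP; split.
  by rewrite (_ : [set _ | _] = set0) ?setI0//; apply/seteqP; split.
have fW y : ~ (\bigcup_i E i) y -> f (phi y) = fine (f0 y).
  by move=> Wy; rewrite /f; case: pselect => [[i [gi Uiy]]|_]; [exfalso; apply: Wy; exists i|rewrite phiK].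
have mf0 : measurable_fun setT f0 by case/integrableP : f0_int.
exists f; split.
- rewrite -(setvU (\bigcup_i E i)); apply/measurable_funU.
  + by apply: measurableC; exact: bigcupT_measurable.
  + exact: bigcupT_measurable.
  split.
    apply: (@eq_measurable_fun _ _ _ _ _ (fine \o f0)).
      by move=> y /set_mem Wy /=; rewrite fW.
    apply: measurable_funTS; apply/measurable_EFinP.
    by rewrite (_ : EFin \o _ = f0)//; apply/funext => y /=; rewrite fineK.
  apply/measurable_fun_bigcup => // i.
  have [gi|ngi] := pselect (good i); last first.
    by rewrite (_ : E i = set0); [exact: measurable_fun_set0|apply/seteqP; split => // y []].
  apply: (@eq_measurable_fun _ _ _ _ _ (G i)).
    by move=> y /set_mem[Uy _] /=; rewrite (fG i)// phiK.
  by apply: measurable_funTS; have [] := GP i gi.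
- have nN i : la.-negligible (E i `&` [set y | f0 y <> (G i y)%:E]).
    have [gi|ngi] := pselect (good i); last first.
      by apply: negligibleS (@negligible_set0 _ _ _ la) => y [[]].
    by have [_ _] := GP i gi; apply: negligibleS => y [[]].
  apply: negligibleS (negligible_bigcup nN) => y /= fy.
  have [[i _ [Uy gi]]|Wy] := pselect ((\bigcup_i E i) y).
    by exists i => //; split => //= fG'; apply: fy; rewrite (fG i)// phiK.
  by exfalso; apply: fy; rewrite fW// fineK.
- move=> k; apply/of_class_C_pointwise => x Ox.
  have [N Nx HN] := HO x Ox; have [i Uix UiN] := Ubase Nx.
  have gi : good i.
    move=> k'; have [nu [Hnu numu]] := HN k'; exists nu; split => // A mA AU.
    by apply: numu => //; apply: subset_trans AU _ => y; exact: UiN.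
  have [g gP] := local_version (gi k); have [_ Cg _] := gP.
  apply: (@near_of_class_C _ _ _ (g \o psi)).
    near=> y; have Uy : U i y by near: y; exact: open_nbhs_nbhs.
    by rewrite (fG i y gi Uy)/=; exact: (rep_unique _ _ _ _ _ _ gP (GP _ gi)).
  exact: of_class_C_sub Cg.
Unshelve. all: by end_near. Qed.

End smooth_density.

(** * A countable base of rational intervals and squares *)

Section rational_intervals.
Variable R : realType.

Definition rational_interval (i : rat * nat) : set R :=
  `]ratr i.1 - i.2.+1%:R^-1, ratr i.1 + i.2.+1%:R^-1[%classic.

Lemma rational_interval_base (e : R) : 0 < e -> exists m, forall z, exists2 q,
  rational_interval (q, m) z & forall y, rational_interval (q, m) y -> `|z - y| < e.
Proof.
move=> e0; have e20 : 0 < e / 2 by rewrite divr_gt0.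
have [m _ me] := near_infty_natSinv_lt (PosNum e20).
have {}me : m.+1%:R^-1 < e / 2 :> R by apply: me => /=.
have d0 : 0 < m.+1%:R^-1 :> R by rewrite invr_gt0.
exists m => z; rewrite /rational_interval /=.
move: (m.+1%:R^-1 : R) me d0 => d de d0.
have [|q] := @rat_in_itvoo R (z - d) (z + d); first by lra.
rewrite in_itv/= => /andP[q1 q2]; exists q.
  by rewrite in_itv/=; apply/andP; split; lra.
move=> y; rewrite in_itv/= => /andP[y1 y2].
by rewrite ltr_norml; apply/andP; split; lra.
Qed.

Lemma lebesgue_rational_interval i :
  (0 < lebesgue_measure (rational_interval i : set (measurableTypeR R)))%E.
Proof.
have d0 : 0 < i.2.+1%:R^-1 :> R by rewrite invr_gt0.
rewrite /rational_interval lebesgue_measure_itv /=.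
move: (i.2.+1%:R^-1 : R) (ratr i.1 : R) d0 => d q d0.
rewrite lte_fin ifT; last by lra.
by rewrite -EFinB lte_fin; lra.
Qed.

(** A number that codes no pair gets a default pair, so that every member of the base, whatever its
    index, is an interval of positive length. *)
Definition line_base (k : nat) : set R := rational_interval (odflt (0, 0%N) (unpickle k)).

Definition plane_base (k : nat) : set (R * R) :=
  let i : rat * rat * nat := odflt (0, 0, 0%N) (unpickle k) in
  rational_interval (i.1.1, i.2) `*` rational_interval (i.1.2, i.2).

Lemma line_baseP z (N : set R) : nbhs z N -> exists2 k, line_base k z & line_base k `<=` N.
Proof.
move=> /nbhs_ballP[e /= e0 zN]; have [m mP] := rational_interval_base e0.
have [q qz qP] := mP z; exists (pickle (q, m)); rewrite /line_base pickleK//=.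
by move=> y /qP; exact: zN.
Qed.

Lemma plane_baseP (z : R * R) (N : set (R * R)) : nbhs z N ->
  exists2 k, plane_base k z & plane_base k `<=` N.
Proof.
move=> /nbhs_ballP[e /= e0 zN]; have [m mP] := rational_interval_base e0.
have [q1 qz1 qP1] := mP z.1; have [q2 qz2 qP2] := mP z.2.
exists (pickle (q1, q2, m)); rewrite /plane_base pickleK//=.
by move=> y [/qP1 y1 /qP2 y2]; apply: zN; split.
Qed.

End rational_intervals.

Lemma real_smooth_density (R : realType) (mu : probability (measurableTypeR R) R) (O : set R) :
  mu `<< lebesgue_measure ->
  (forall z, O z -> exists2 N, nbhs z N & forall k,
     locally_C_density (idfun : R -> measurableTypeR R) idfun lebesgue_measure (@rays R) mu k N) ->
  exists f : R -> R,
  [/\ measurable_fun [set: measurableTypeR R] (f : measurableTypeR R -> measurableTypeR R),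
      {ae lebesgue_measure, forall x,
        Radon_Nikodym (charge_of_finite_measure mu) lebesgue_measure x = (f x)%:E} &
      smooth_on O f].
Proof.
move=> dom HO.
apply: (@smooth_density R R _ (measurableTypeR R) idfun idfun _ lebesgue_measure (@rays R)
  (@line_base R) _ _ _ _ _ mu).
- by [].
- by move=> k; exact: itv_open.
- by move=> k; exact: measurable_itv.
- by move=> k; exact: lebesgue_rational_interval.
- move=> k; rewrite /line_base; set i := odflt _ _.
  exists `](ratr i.1 - i.2.+1%:R^-1 : R), +oo[%classic; split.
  + by exists (ratr i.1 - i.2.+1%:R^-1).
  + exact: measurable_itv.
  + by move=> y; rewrite /rational_interval /= !in_itv/= => /andP[->].
- by move=> z N; exact: line_baseP.
- by move=> x; exact: Radon_Nikodym_fin_num.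
- exact: Radon_Nikodym_integrable.
- by move=> A mA; rewrite -Radon_Nikodym_integral.
- exact: HO.
Qed.

Lemma plane_smooth_density (R : realType) (mu : probability (plane R) R) (O : set (R * R)) :
  mu `<< lebesgue_plane ->
  (forall z, O z -> exists2 N, nbhs z N & forall k,
     locally_C_density (idfun : R * R -> plane R) idfun lebesgue_plane (@quadrants R) mu k N) ->
  exists f : R * R -> R,
  [/\ measurable_fun [set: plane R] (f : plane R -> measurableTypeR R),
      {ae lebesgue_plane, forall z,
        Radon_Nikodym (charge_of_finite_measure mu) lebesgue_plane z = (f z)%:E} &
      smooth_on O f].
Proof.
move=> dom HO.
have mI i : measurable (rational_interval i : set (measurableTypeR R)) by exact: measurable_itv.
apply: (@smooth_density R (R * R)%type _ (plane R) idfun idfun _ lebesgue_plane (@quadrants R)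
  (@plane_base R) _ _ _ _ _ mu).
- by [].
- move=> k; rewrite /plane_base; set i := odflt _ _.
  rewrite (_ : _ `*` _ = (fst @^-1` rational_interval (i.1.1, i.2)) `&`
    (snd @^-1` rational_interval (i.1.2, i.2))); last by [].
  apply: openI; apply: open_comp => [y _|]; try exact: itv_open.
    exact: cvg_fst.
  exact: cvg_snd.
- by move=> k; exact: measurableX.
- move=> k; rewrite [X in (_ < X)%E](lebesgue_planeX (mI _) (mI _)).
  by rewrite mule_gt0//; exact: lebesgue_rational_interval.
- move=> k; rewrite /plane_base; set i := odflt _ _.
  pose a : R * R := (ratr i.1.1 - i.2.+1%:R^-1, ratr i.1.2 - i.2.+1%:R^-1).
  exists (`]a.1, +oo[ `*` `]a.2, +oo[); split.
  + by exists a.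
  + by apply: measurableX; exact: measurable_itv.
  + by move=> y []; rewrite /rational_interval /= !in_itv/= => /andP[-> _] /andP[-> _].
- by move=> z N; exact: plane_baseP.
- by move=> x; exact: Radon_Nikodym_fin_num.
- exact: Radon_Nikodym_integrable.
- by move=> A mA; rewrite -Radon_Nikodym_integral.
- exact: HO.
Qed.

Theorem proposition2p4 (R : realType) (n : nat) (A : 'M[R[i]]_n) :
  (interior (to_plane @` numerical_range A) !=set0 ->
    numerical_measure A `<< lebesgue_plane /\
    exists f : R * R -> R,
      [/\ measurable_fun [set: plane R] (f : plane R -> measurableTypeR R),
          {ae lebesgue_plane, forall z, numerical_density A z = (f z)%:E} &
          smooth_on (~` (to_plane @` critical_values A)) f]) /\
  (A \is hermsymmx -> ~~ is_scalar_mx A ->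
    numerical_range A `<=` [set z | z \is Num.real] /\
    real_numerical_measure A `<< lebesgue_measure /\
    exists f : R -> R,
      [/\ measurable_fun [set: measurableTypeR R]
            (f : measurableTypeR R -> measurableTypeR R),
          {ae lebesgue_measure,
            forall x, real_numerical_density A x = (f x)%:E} &
          smooth_on (~` real_spectrum A) f]).
Proof.
split.
- move=> WA.
  (* For n = 0 there is no unit vector and the numerical range is empty. *)
  have n0 : (0 < n)%N.
    case: n A WA => [|//] A [z /nbhs_singleton[_ [x x1 _] _]]; exfalso.
    have := unit_sphere_inner x1.
    by rewrite /inner mxE big_ord0/= => /eqP; rewrite eq_sym oner_eq0.
  have dom := numerical_measure_dominated n0 WA; split => //.
  apply: plane_smooth_density => // z zA.
  have [c c0 cP] := plane_lower_bound zA.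
  (* The disc on which the cutoff is 1; it is the same for every order of smoothness. *)
  exists [set y | (y.1 - z.1) ^+ 2 + (y.2 - z.2) ^+ 2 <= c / 2].
    have sq (g : R * R -> R) : g y @[y --> z] --> g z -> (g y - g z) ^+ 2 @[y --> z] --> (0 : R).
      move=> cg; have cd : g y - g z @[y --> z] --> (0 : R).
        by rewrite -(subrr (g z)); apply: cvgB => //; exact: cvg_cst.
      by rewrite -[X in _ --> X](mulr0 (0 : R)); exact: (cvgM cd cd).
    have c1 : (y.1 - z.1) ^+ 2 @[y --> z] --> (0 : R) by apply: (sq fst); exact: cvg_fst.
    have c2 : (y.2 - z.2) ^+ 2 @[y --> z] --> (0 : R) by apply: (sq snd); exact: cvg_snd.
    have cv : (y.1 - z.1) ^+ 2 + (y.2 - z.2) ^+ 2 @[y --> z] --> (0 : R).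
      by rewrite -[X in _ --> X](addr0 (0 : R)); exact: (cvgD c1 c2).
    by have := cvgr_le _ cv; apply; rewrite divr_gt0.
  by move=> k; exact: (@local_numerical_density R n n0 A z c k c0 cP).
- move=> HA nA.
  (* The matrix of size 0 is scalar. *)
  have n0 : (0 < n)%N by case: n A HA nA => [|//] A _; rewrite (flatmx0 A) mx0_is_scalar.
  have AA : adjoint A = A.
    by have /is_hermitianmxP := HA; rewrite expr0 scale1r => /esym.
  split.
    move=> z [x x1 <-] /=.
    have := inner_conj (A *m x) x; rewrite -{1}AA -inner_adjoint /numerical_map.
    case: (inner (A *m x) x) => a b [] /= h.
    by rewrite complex_real; apply/eqP; lra.
  have dom := real_numerical_measure_dominated n0 AA nA; split => //.
  apply: real_smooth_density => // z zA.
  have [c c0 cP] := real_lower_bound AA zA.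
  exists [set y | (y - z) ^+ 2 <= c / 2].
    have cd : y - z @[y --> z] --> (0 : R).
      by rewrite -(subrr z); apply: cvgB => //; exact: cvg_cst.
    have cv : (y - z) ^+ 2 @[y --> z] --> (0 : R).
      by rewrite -[X in _ --> X](mulr0 (0 : R)); exact: (cvgM cd cd).
    by have := cvgr_le _ cv; apply; rewrite divr_gt0.
  by move=> k; exact: (@local_real_numerical_density R n n0 A z c k c0 cP).
Qed.
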